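(* Let $a>0$, $\lambda\in\mathbb{R}$ with $4\lambda+a\ge0$, let $1<p<\infty$, and let $\beta,\gamma\in\mathbb{R}$. Then the two-sided inequality $$c_1\bigl\|r^{\beta}f(r)\bigr\|_{p,d\nu_{\lambda,a}}\le\bigl\|\rho^{-\gamma}H_{\lambda,a}(f)(\rho)\bigr\|_{p,d\nu_{\lambda,a}}\le c_2\bigl\|r^{\beta}f(r)\bigr\|_{p,d\nu_{\lambda,a}}$$ holds for all functions $f\in GM$ with $f\ge0$ and $$\int_0^1r^{2\lambda+a-1}|f(r)|\,dr+\int_1^\infty r^{\lambda+a/4}\,|df(r)|<\infty$$ (with constants $0<c_1\le c_2<\infty$ that depend on $f$ at most through its $GM$ constants) if and only if $$\beta-\gamma=(2\lambda+a)\Bigl(\frac1{p'}-\frac1p\Bigr)$$ and $$\frac{2\lambda+a}{p'}-\frac{4\lambda+3a}{4}<\beta<\frac{2\lambda+a}{p'}.$$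
   Context: $\mathbb{R}_+=[0,\infty)$, and $p'$ is the Hölder conjugate of $p$. Norms below take values in $[0,\infty]$. General monotone functions: a function $f$ on $(0,\infty)$ that is of locally bounded variation on $[\varepsilon,\infty)$ for every $\varepsilon>0$ is general monotone, written $f\in GM$, if it vanishes at infinity and there exist constants $C>0$ and $c_0>1$ (the $GM$ constants of $f$) such that for every $r>0$ $$\int_r^\infty|df(u)|\le C\int_{r/c_0}^\infty|f(u)|\,\frac{du}{u},$$ where $\int|df(u)|$ is the Riemann–Stieltjes integral (total variation). For a Bessel function $J_\mu$ of the first kind, $j_\mu(t)=2^\mu\Gamma(\mu+1)t^{-\mu}J_\mu(t)$, so $j_\mu(0)=1$. The measure is $d\nu_{\lambda,a}(r)=b_{\lambda,a}r^{2\lambda+a-1}\,dr$ on $\mathbb{R}_+$, where $b_{\lambda,a}^{-1}=\int_0^\infty e^{-t^a/a}t^{2\lambda+a-1}\,dt=a^{2\lambda/a}\Gamma(2\lambda/a+1)$, and $\|f\|_{p,d\nu_{\lambda,a}}=\bigl(\int_{\mathbb{R}_+}|f(r)|^p\,d\nu_{\lambda,a}(r)\bigr)^{1/p}$. The $a$-deformed Hankel transform (for $4\lambda+a\ge0$) is $$H_{\lambda,a}(f)(\rho)=\int_{\mathbb{R}_+}f(r)\,j_{2\lambda/a}\Bigl(\frac2a(\rho r)^{a/2}\Bigr)\,d\nu_{\lambda,a}(r),\qquad\rho>0,$$ understood as an improper integral, i.e. as $\lim_{A\to0+,\,B\to\infty}\int_A^B$; under the integrability assumption in the claim it exists and is continuous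 for $\rho>0$. *)

(* Defs.v *)
From HB Require Import structures.
From mathcomp Require Export all_boot all_order all_algebra.
From mathcomp Require Export all_classical all_reals all_analysis.

Set Implicit Arguments.
Unset Strict Implicit.
Unset Printing Implicit Defensive.

Export Order.TTheory GRing.Theory Num.Theory.
Export numFieldNormedType.Exports.

Local Open Scope classical_set_scope.
Local Open Scope ring_scope.

Section RiemannStieltjes.
Context {R : realType}.
Implicit Types (w V f : R -> R) (a b r : R).

(* As in [variation], the partition points of [a, b] are a :: s. *)
Definition RS_sum w V a b (s : seq R) (xi : nat -> R) : R :=
  let t := nth b (a :: s) in
  \sum_(0 <= n < size s) w (xi n) * (V (t n.+1) - V (t n)).

Definition is_RS_integral w V a b (I : R) : Prop :=
  forall eps : R, 0 < eps -> exists2 delta : R, 0 < delta &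
    forall (s : seq R) (xi : nat -> R),
      let t := nth b (a :: s) in
      itv_partition a b s ->
      (forall n, (n < size s)%N ->
        [/\ t n.+1 - t n < delta, t n <= xi n & xi n <= t n.+1]) ->
      `|RS_sum w V a b s xi - I| < eps.

Definition RS_integral w V a b : R := xget 0 (is_RS_integral w V a b).

(* \int_r^oo w(u) |df(u)|: improper Riemann-Stieltjes integral of w against
   the variation function u |-> TV r u f. *)
Definition variation_integral w f r : \bar R :=
  lim ((RS_integral w (fun u => fine (total_variation r u f)) r b)%:E
         @[b --> +oo]).

End RiemannStieltjes.

Section GeneralMonotone.
Context {R : realType}.

(* f is general monotone with GM constants C and c0; only the values of f on
   ]0, +oo[ matter. *)
Definition GM_with (C c0 : R) (f : R -> R) : Prop :=
  [/\ 0 < C, 1 < c0,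
      forall eps b : R, 0 < eps -> bounded_variation eps b f,
      f u @[u --> +oo] --> 0 &
      forall r : R, 0 < r ->
        (variation_integral (fun=> 1%R) f r <=
         C%:E * \int[lebesgue_measure]_(u in `[(r / c0)%R, +oo[)
                  (`|f u| / u)%:E)%E].

End GeneralMonotone.

Section Bessel.
Context {R : realType}.

(* Used for x > 0 only. *)
Definition Gamma (x : R) : R :=
  Rintegral lebesgue_measure `]0, +oo[ (fun t => t `^ (x - 1) * expR (- t)).

Definition besselJ (mu t : R) : R :=
  limn (series (fun k : nat =>
    (-1) ^+ k / (k`!%:R * Gamma (k%:R + mu + 1)) * (t / 2) `^ (k.*2%:R + mu))).

Definition besselj (mu t : R) : R :=
  if t == 0 then 1 else 2 `^ mu * Gamma (mu + 1) * t `^ (- mu) * besselJ mu t.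

End Bessel.

Section DeformedHankel.
Context {R : realType}.
Variables lam a : R.

Definition nu_const : R :=
  (Rintegral lebesgue_measure `]0, +oo[
     (fun t => expR (- (t `^ a / a)) * t `^ (2 * lam + a - 1)))^-1.

Definition nu_density (r : R) : R := nu_const * r `^ (2 * lam + a - 1).

Definition nu_norm (p : R) (g : R -> R) : \bar R :=
  poweR (\int[lebesgue_measure]_(r in `]0%R, +oo[)
           (`|g r| `^ p * nu_density r)%:E)%E p^-1.

Definition hankel (f : R -> R) (rho : R) : R :=
  lim (Rintegral lebesgue_measure `[AB.1, AB.2]
         (fun r => f r * besselj (2 * lam / a) (2 / a * (rho * r) `^ (a / 2))
                   * nu_density r)
       @[AB --> filter_prod 0^'+ (pinfty_nbhs R)]).

End DeformedHankel.

(* Main.v *)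
From HB Require Import structures.
Require Import Defs.
From mathcomp Require Import ring lra measurable_realfun.

(** Write [d = 2 lam + a] and [k = lam + a / 4]. In terms of
    [hnorm p b g], the integral of [|r^b g|^p dr / r], the two sides of the
    inequality are norms of [f] at [b' = beta + d / p] and of its transform at
    [b = d / p - gamma], and the conditions on the exponents read [b = d - b']
    and [0 < b < d - k].

    The kernel. In the variable [x = rho r] the kernel is [hK x], equal to [1]
    at the origin, and Bessel's equation makes it the first component of a
    rotating pair with friction. Its energy decreases, so [|hK| <= 1]; after
    multiplication by [x^k] the amplitude of the pair stays between two positive
    constants at infinity ([kernel_amplitude]). Hence the primitive [hPhi] of
    [hK x * x^(d - 1)] is of size [x^k] ([hPhi_bound]), much smaller than [x^d].

    Upper bound. Let [V r] be the variation of [f] beyond [r]. Summation by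
    parts ([abel_bound], [hint_tail]) against [hPhi] bounds the transform by the
    multiplicative convolution of [V] with a profile which is [1] before [1] and
    [y^(k - d)] beyond ([hankel_le_conv]). By Schur's test for [dr / r] this
    operator is bounded for [0 < b < d - k]. General monotonicity bounds [V r]
    by the integral of [|f u| / u] over [u >= r / c0], and Hardy's inequality
    ([hnorm_tail]) returns to [f].

    Lower bound. The Gaussian [exp (- t^a / a)] is an eigenfunction of the
    transform ([gauss_transform]). Pairing with it, Gaussian averages of [f]
    at scale [x] are at most Gaussian averages at scale [1 / x] of the absolute
    value of the transform ([hankel_gauss_ge]). Since [f >= 0], averaging over
    the scales bounds the tails of [f] ([tail_le_gauss_avg]), and by general
    monotonicity these bound [f] itself. Schur's test and Hardy's inequality
    conclude, as [b' > 0].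

    Necessity. The functions [(r / t)^N] cut off at [r = t], for [t < 1], are
    general monotone with constants independent of [t] ([tpow_GM_with]). With
    [N] a multiple of [a], their transforms are explicit: up to constants they
    are [t^d * hG (t rho)] ([hankel_tpow]). Comparing powers of [t] as [t]
    tends to [0] gives [b = d - b']. The upper inequality for one [t] makes the
    norm of [hG] at [b] finite. As [hG] does not vanish at the origin, [b > 0]
    ([hnorm_hG_near0]). At infinity [hG] is of size [y^(k - d)] in the mean:
    its normalization [hW] is driven by the rotating pair, and if it were
    small in the mean, a bounded combination of [hW] and the pair would grow
    like a logarithm ([hW_diverges]); thus [b < d - k] ([hnorm_hG_neary]). *)

Set Implicit Arguments.
Unset Strict Implicit.
Unset Printing Implicit Defensive.

Local Open Scope classical_set_scope.
Local Open Scope ring_scope.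

(** * Integration on the half-line *)

Lemma le_of_eq d (T : porderType d) (x y : T) : x = y -> (x <= y)%O.
Proof. by move->. Qed.

Section Tools.
Context {R : realType}.
Notation mu := (@lebesgue_measure R).
Notation Rp := (`](0 : R), +oo[%classic).
Implicit Types (a b c x y : R) (f g h : R -> R).

Lemma integral_ftc (F f : R -> R) (a b : R) : a <= b ->
  (forall x, a <= x <= b -> is_derive x 1 F (f x)) ->
  (forall x, a <= x <= b -> {for x, continuous f}) ->
  (\int[mu]_(x in `[a, b]) (f x)%:E = (F b - F a)%:E)%E.
Proof.
rewrite le_eqVlt => /predU1P[<-|ab] dF cf.
  by rewrite set_itv1 integral_set1 subrr.
have cF x : a <= x <= b -> {for x, continuous F}.
  move=> /dF[+ _] => /derivable1_diffP ?.
  exact: differentiable_continuous.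
apply: continuous_FTC2 => //.
- apply: continuous_in_subspaceT => x; rewrite inE/= in_itv/= => xab.
  exact: cf.
- split.
  + by move=> x; rewrite in_itv/= => /andP[ax xb]; apply: (@ex_derive _ _ _ _ _ _ _ (dF x _)); rewrite !ltW.
  + by apply: cvg_at_right_filter; apply: cF; rewrite lexx ltW.
  + by apply: cvg_at_left_filter; apply: cF; rewrite lexx ltW.
- move=> x; rewrite in_itv/= => /andP[ax xb]; rewrite derive1E.
  by apply: (@derive_val _ _ _ _ _ _ _ (dF x _)); rewrite !ltW.
Qed.

Lemma cont_integrable (f : R -> R) (a b : R) :
  (forall x, a <= x <= b -> {for x, continuous f}) ->
  mu.-integrable `[a, b] (EFin \o f).
Proof.
move=> cf; apply: continuous_compact_integrable; first exact: segment_compact.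
by apply: continuous_in_subspaceT => x; rewrite inE/= in_itv/= => /cf.
Qed.

(** The integral of a nonnegative function is a supremum over the simple
    functions below it, so that monotonicity holds without measurability. *)
Lemma le_int_ge0 (D : set R) (f g : R -> \bar R) :
  (forall x, D x -> (0 <= f x)%E) -> (forall x, D x -> (f x <= g x)%E) ->
  (\int[mu]_(x in D) f x <= \int[mu]_(x in D) g x)%E.
Proof.
move=> f0 fg; rewrite integral_mkcond [leRHS]integral_mkcond.
have g0 x : D x -> (0 <= g x)%E by move=> Dx; apply: le_trans (fg _ Dx); exact: f0.
rewrite !ge0_integralTE; last 2 first.
- by move=> x; apply: erestrict_ge0 => y; exact: g0.
- by move=> x; apply: erestrict_ge0 => y; exact: f0.
apply: le_ereal_sup => _ /= [h hf <-]; exists h => // x.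
apply: le_trans (hf x) _; rewrite !patchE; case: ifPn => // /set_mem.
exact: fg.
Qed.

Lemma integral_setI_if (D : set R) (P : R -> bool) (h : R -> \bar R) :
  (\int[mu]_(x in D `&` [set x | P x]) h x = \int[mu]_(x in D) (if P x then h x else 0))%E.
Proof.
rewrite integral_mkcondr; apply: eq_integral => x _.
by rewrite patchE/=; case: ifPn => [/set_mem/= ->//|]; case: ifP => // Px /negP[]; rewrite inE.
Qed.

Lemma ge0_integralZl_EFin (D : set R) (c : R) (h : R -> R) : measurable D -> measurable_fun D h ->
  (forall x, D x -> 0 <= h x) -> 0 <= c ->
  (c%:E * \int[mu]_(x in D) (h x)%:E = \int[mu]_(x in D) (c * h x)%:E)%E.
Proof.
move=> mD mh h0 c0; under [RHS]eq_integral do rewrite EFinM.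
rewrite ge0_integralZl//; exact/measurable_EFinP.
Qed.

Lemma measurable_abs (D : set R) (h : R -> R) :
  measurable_fun D h -> measurable_fun D (fun r => `|h r|).
Proof. by move=> mh; exact: measurableT_comp. Qed.

Lemma dominated_on (D : set R) (s : nat -> R -> \bar R) (g G : R -> \bar R) :
  measurable D -> (forall n, measurable_fun D (s n)) -> measurable_fun D g ->
  (forall x, D x -> s n x @[n --> \oo] --> g x) -> mu.-integrable D G ->
  (forall n x, D x -> (`|s n x| <= G x)%E) ->
  mu.-integrable D g /\
  (\int[mu]_(x in D) s n x)%E @[n --> \oo] --> (\int[mu]_(x in D) g x)%E.
Proof.
move=> mD ms mg sg iG sG.
have [] := @dominated_convergence _ _ _ mu D mD s g G ms mg _ iG _ => //.
  by apply: aeW => x; exact: sg.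
by apply: aeW => x n; exact: sG.
Qed.

(** By uniqueness of Lebesgue measure, only intervals have to be compared. *)
Lemma pushforward_scale (c : R) (A : set R) : 0 < c -> measurable A ->
  (pushforward mu ( *%R c : _ -> measurableTypeR R) A = c^-1%:E * mu A)%E.
Proof.
move=> c0 mA.
pose c' : {nonneg R} := NngNum (ltW c0).
have mc : measurable_fun setT ( *%R c : measurableTypeR R -> measurableTypeR R).
  exact: mulrl_measurable.
pose mix := isMeasurableFun.Build _ _ _ _ _ mc.
pose phi : {mfun measurableTypeR R >-> measurableTypeR R} :=
  HB.pack ( *%R c : measurableTypeR R -> measurableTypeR R) mix.
pose m (h : measurable_fun setT phi) : {measure set measurableTypeR R -> \bar R} := mscale c' (pushforward mu phi).
rewrite -[LHS]/(pushforward mu phi A).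
have -> : mu A = m mc mc A.
  apply: lebesgue_measure_unique => // _ [[x y]] _ <-.
  rewrite /m /= /mscale /= /pushforward.
  rewrite [X in (_ = _ * mu X)%E](_ : _ = `]x / c, y / c]%classic); last first.
    apply/seteqP; split => z /=; rewrite !in_itv/=;
      by rewrite ltr_pdivrMr// ler_pdivlMr// mulrC.
  rewrite !lebesgue_measure_itv/= !lte_fin ltr_pM2r ?invr_gt0//.
  case: ifPn => _; last by rewrite mule0.
  by rewrite -!EFinD -EFinM; congr EFin; field; rewrite gt_eqF.
by rewrite /m/= /mscale/= muleA -EFinM mulVf ?gt_eqF// mul1e.
Qed.

(** This is what makes [dx / x] invariant under dilations. *)
Lemma int_scale (c : R) (h : R -> \bar R) : 0 < c ->
  measurable_fun Rp h -> (forall x, 0 < x -> (0 <= h x)%E) ->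
  (\int[mu]_(x in Rp) h (c * x)%R
   = c^-1%:E * \int[mu]_(x in Rp) h x)%E.
Proof.
move=> c0 mh h0.
have mc : measurable_fun setT ( *%R c : measurableTypeR R -> measurableTypeR R).
  exact: mulrl_measurable.
pose mix := isMeasurableFun.Build _ _ _ _ _ mc.
pose phi : {mfun measurableTypeR R >-> measurableTypeR R} :=
  HB.pack ( *%R c : measurableTypeR R -> measurableTypeR R) mix.
have D : phi @^-1` Rp = Rp.
  by apply/seteqP; split => x /=; rewrite !in_itv/= !andbT pmulr_rgt0.
transitivity (\int[pushforward mu phi]_(x in Rp) h x)%E.
  rewrite ge0_integral_pushforward// ?D//.
  by move=> y; rewrite inE/= in_itv/= andbT => /h0.
have ci : 0 <= c^-1 by rewrite invr_ge0 ltW.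
transitivity (\int[mscale (NngNum ci) mu]_(x in Rp) h x)%E.
  by apply: eq_measure_integral => A mA _; exact: pushforward_scale.
by rewrite ge0_integral_mscale// => x; rewrite /= in_itv/= andbT => /h0.
Qed.

Section ProductSections.
Variables (D E : set R) (h : R -> R -> \bar R).

Let H := (fun z : R * R => h z.1 z.2) \_ (D `*` E).

(** Integrals over a product set are moved to the whole plane by extending the
    integrand with [0]; Tonelli's and Fubini's theorems then apply to the
    extension [H]. The function [G] stands for the identity or for the absolute
    value. *)
Let int_sectionl (G : \bar R -> \bar R) : G 0%E = 0%E ->
  (fun x => \int[mu]_y G (H (x, y)))%E =
  (fun x => \int[mu]_(y in E) G (h x y))%E \_ D.
Proof.
move=> G0; apply/funext => x; rewrite patchE; case: ifPn => [/set_mem Dx|/negP Dx].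
  rewrite [RHS]integral_mkcond; apply: eq_integral => y _.
  rewrite /H !patchE; case: ifPn => [/set_mem[_ /= Ey]|/negP nE].
    by rewrite mem_set.
  by rewrite memNset// => Ey; apply: nE; rewrite inE; split.
apply: integral0_eq => y _; rewrite /H patchE memNset// => -[/= Dx' _].
by apply: Dx; rewrite inE.
Qed.

Let int_sectionr :
  (fun y => \int[mu]_x H (x, y))%E = (fun y => \int[mu]_(x in D) h x y)%E \_ E.
Proof.
apply/funext => y; rewrite patchE; case: ifPn => [/set_mem Ey|/negP Ey].
  rewrite [RHS]integral_mkcond; apply: eq_integral => x _.
  rewrite /H !patchE; case: ifPn => [/set_mem[/= Dx _]|/negP nE].
    by rewrite mem_set.
  by rewrite memNset// => Dx; apply: nE; rewrite inE; split.
apply: integral0_eq => x _; rewrite /H patchE memNset// => -[_ /= Ey'].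
by apply: Ey; rewrite inE.
Qed.

Hypotheses (mD : measurable D) (mE : measurable E).
Hypothesis mh : measurable_fun (D `*` E) (fun z => h z.1 z.2).

Let mH : measurable_fun setT H.
Proof. by apply/(measurable_restrictT _ _).1 => //; exact: measurableX. Qed.

Let H_ge0 : (forall x y, D x -> E y -> (0 <= h x y)%E) -> forall z, (0 <= H z)%E.
Proof. by move=> h0 z; apply: erestrict_ge0 => -[x y] /= [Dx Ey]; exact: h0. Qed.

Lemma tonelli_on : (forall x y, D x -> E y -> (0 <= h x y)%E) ->
  (\int[mu]_(x in D) \int[mu]_(y in E) h x y
   = \int[mu]_(y in E) \int[mu]_(x in D) h x y)%E.
Proof.
move=> /H_ge0 H0; have := fubini_tonelli (m1 := mu) (m2 := mu) H mH H0.
by rewrite (int_sectionl (G := id))// int_sectionr -!integral_mkcond.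
Qed.

Lemma measurable_int_on : (forall x y, D x -> E y -> (0 <= h x y)%E) ->
  measurable_fun D (fun x => \int[mu]_(y in E) h x y)%E.
Proof.
move=> /H_ge0 H0; have := measurable_fun_fubini_tonelli_F (m2 := mu) H mH H0.
by rewrite /fubini_F (int_sectionl (G := id))// => /(measurable_restrictT _ mD).2.
Qed.

Lemma fubini_on : (\int[mu]_(x in D) \int[mu]_(y in E) `|h x y| < +oo)%E ->
  (\int[mu]_(x in D) \int[mu]_(y in E) h x y
   = \int[mu]_(y in E) \int[mu]_(x in D) h x y)%E.
Proof.
move=> hoo; have iH : (mu \x mu)%E.-integrable setT H.
  apply/(integrable12ltyP mu mu mH).2; rewrite (int_sectionl (G := abse)) ?abse0//.
  by rewrite -integral_mkcond.
have := Fubini iH.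
by rewrite /fubini_F/= /fubini_G/= (int_sectionl (G := id))// int_sectionr -!integral_mkcond.
Qed.

End ProductSections.

Lemma powR_cont (c x : R) : 0 < x -> {for x, continuous (@powR R ^~ c)}.
Proof.
move=> x0; apply: differentiable_continuous; apply/derivable1_diffP.
by apply: derivable_powR; rewrite in_itv/= x0.
Qed.

Lemma powRDp (x s t : R) : 0 < x -> x `^ (s + t) = x `^ s * x `^ t.
Proof. by move=> x0; rewrite powRD// (gt_eqF x0) implybT. Qed.

Lemma powRBp (x s t : R) : 0 < x -> x `^ (s - t) = x `^ s / x `^ t.
Proof. by move=> x0; rewrite powRB// (gt_eqF x0) implybT. Qed.

Lemma powRB1 (x s : R) : 0 < x -> x `^ (s - 1) = x `^ s / x.
Proof. by move=> x0; rewrite powRBp// powRr1// ltW. Qed.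

Lemma powRN_cvgy (c : R) : 0 < c -> x `^ (- c) @[x --> +oo] --> (0 : R).
Proof.
move=> c0; apply/cvgrPdist_lt => /= e e0; near=> x.
have x0 : 0 < x by near: x; exact: nbhs_pinfty_gt.
rewrite sub0r normrN ger0_norm ?powR_ge0// powRN invf_plt ?posrE ?powR_gt0//.
have -> : e^-1 = (e^-1 `^ c^-1) `^ c.
  by rewrite -powRrM mulVf ?gt_eqF// powRr1// invr_ge0 ltW.
rewrite gt0_ltr_powR// ?nnegrE ?powR_ge0 ?(ltW x0)//.
Unshelve. all: by end_near. Qed.

Lemma is_derive_powRc (c x : R) : c != 0 -> 0 < x ->
  is_derive x 1 (fun x => x `^ c / c) (x `^ (c - 1)).
Proof.
move=> c0 x0.
have H := is_derive1_powR c x0.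
have -> : (fun x => x `^ c / c) = c^-1 \*: (@powR R ^~ c).
  by apply/funext => y; rewrite /= mulrC.
apply: is_derive_eq; rewrite /= /GRing.scale/=.
by rewrite mulrA mulVf// mul1r.
Qed.

Lemma measurable_pow (D : set R) c : measurable_fun D (fun t : R => (t `^ c)%:E).
Proof.
by apply: measurable_funTS; apply/measurable_EFinP; exact: measurable_powR.
Qed.

Lemma measurable_powR_Rp (c : R) : measurable_fun Rp (fun x : R => x `^ c).
Proof. by apply: measurable_funTS; exact: measurable_powR. Qed.

Lemma measurable_inv_Rp : measurable_fun Rp (fun x : R => x^-1).
Proof.
apply: open_continuous_measurable_fun => // t.
by rewrite inE/= in_itv/= andbT => t0; apply: continuousV => //; rewrite gt_eqF.
Qed.

Lemma int_pow (A B c : R) : 0 < A -> A <= B -> c != 0 ->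
  (\int[mu]_(t in `[A, B]) (t `^ (c - 1))%:E = ((B `^ c - A `^ c) / c)%:E)%E.
Proof.
move=> A0 AB c0; rewrite mulrBl; apply: (@integral_ftc (fun x => x `^ c / c)) => // x.
  by move=> /andP[Ax _]; apply: is_derive_powRc => //; exact: lt_le_trans Ax.
by move=> /andP[Ax _]; apply: powR_cont; exact: lt_le_trans Ax.
Qed.

Lemma integral_Rp_split (x : R) (h : R -> \bar R) : 0 < x ->
  measurable_fun Rp h -> (forall t, 0 < t -> (0 <= h t)%E) ->
  (\int[mu]_(t in Rp) h t = \int[mu]_(t in `]0%R, x]) h t
     + \int[mu]_(t in `[x, +oo[) h t)%E.
Proof.
move=> x0 mh h0.
have RE : Rp = `]0%R, x] `|` `]x, +oo[.
  apply/seteqP; split => t; rewrite /= !in_itv/= !andbT.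
    by move=> ->; case: (leP t x) => H; [left|right].
  by case=> [/andP[]//|]; exact: lt_trans.
rewrite -integral_itv_obnd_cbnd; last first.
  apply: measurable_funS mh => // t; rewrite /= !in_itv/= !andbT.
  exact: lt_trans.
rewrite RE ge0_integral_setU//= -?RE//.
- move=> t [] /=; rewrite in_itv/= ?andbT.
    by move=> /andP[t0 _]; exact: h0.
  by move=> xt; apply: h0; exact: lt_trans xt.
- apply/disj_setPS => t [] /=; rewrite !in_itv/= andbT => /andP[_ tx].
  by rewrite ltNge tx.
Qed.

Lemma cvg_seq_EFin (u : nat -> R) (l : R) :
  u n @[n --> \oo] --> l -> (u n)%:E @[n --> \oo] --> l%:E.
Proof. by move=> ul; apply: cvg_EFin; [exact: nearW|exact: ul]. Qed.

Lemma natS_cvgy : (n.+1%:R : R) @[n --> \oo] --> +oo.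
Proof.
apply/cvgryPge => A; near=> n.
have : (Num.truncn A <= n)%N by near: n; exact: nbhs_infty_ge.
by rewrite -ltnS -(ler_nat R) => /(le_trans (ltW (truncnS_gt A))).
Unshelve. all: by end_near. Qed.

Lemma harmonic_at_right : (fun n : nat => (n.+1%:R^-1 : R)) @ \oo --> (0 : R)^'+.
Proof.
move=> A [e e0 He]; have := @cvg_harmonic R => /cvgrPdist_lt /(_ e e0) [N _ HN].
exists N => // n /= Nn; apply: He => /=; first exact: HN.
by rewrite invr_gt0.
Qed.

Lemma cvg_harm (f : R -> R) (l : R) : f x @[x --> 0^'+] --> l ->
  f (n.+1%:R^-1) @[n --> \oo] --> l.
Proof. by move=> fl; exact: (cvg_comp _ _ harmonic_at_right fl). Qed.

Lemma cvg_natS (f : R -> R) (l : R) : f x @[x --> +oo] --> l ->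
  f (n.+1%:R) @[n --> \oo] --> l.
Proof. by move=> fl; exact: (cvg_comp _ _ natS_cvgy fl). Qed.

(** Integrals over the half-line are computed as limits along these compact
    intervals, on which the integrands met below are continuous. *)
Lemma cvg_Rp (h : R -> \bar R) :
  measurable_fun Rp h -> (forall x, 0 < x -> (0 <= h x)%E) ->
  (\int[mu]_(x in `[(n.+1%:R^-1)%R, n.+1%:R%R]) h x)%E @[n --> \oo]
    --> (\int[mu]_(x in Rp) h x)%E.
Proof.
move=> mh h0.
have -> : Rp = \bigcup_(n : nat) `[(n.+1%:R^-1 : R), n.+1%:R]%classic.
  apply/seteqP; split => x /=; rewrite ?in_itv/= ?andbT.
    move=> x0; exists (Num.truncn (Num.max x x^-1)) => //=.
    have := Num.Theory.truncnS_gt (Num.max x x^-1).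
    rewrite gt_max => /andP[/ltW xm /ltW xm'].
    by rewrite in_itv/= xm andbT invf_ple// posrE.
  by move=> [n _] /=; rewrite in_itv/= => /andP[+ _]; apply: lt_le_trans; rewrite invr_gt0.
apply: ge0_nondecreasing_set_cvg_integral => //.
- move=> m n mn; rewrite subsetEset => x /=; rewrite !in_itv/= => /andP[mx xm].
  rewrite (le_trans _ mx) ?(le_trans xm) ?ler_nat ?ltnS//.
  by rewrite lef_pV2 ?posrE// ler_nat.
- move=> n; apply: measurable_funS mh => // x /=; rewrite !in_itv/= andbT => /andP[+ _].
  by apply: lt_le_trans; rewrite invr_gt0.
- move=> n x /=; rewrite in_itv/= => /andP[+ _] => H; apply: h0; apply: lt_le_trans H.
  by rewrite invr_gt0.
Qed.

Lemma int_pow0 (x c : R) : 0 < x -> 0 < c ->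
  (\int[mu]_(t in `]0%R, x]) (t `^ (c - 1))%:E = (x `^ c / c)%:E)%E.
Proof.
move=> x0 c0.
have -> : `]0%R, x]%classic = \bigcup_(n : nat) `[x * n.+1%:R^-1, x]%classic.
  apply/seteqP; split => y /=; rewrite ?in_itv/= ?andbT.
    move=> /andP[y0 yx]; exists (Num.truncn (x / y)) => //=.
    have := Num.Theory.truncnS_gt (x / y).
    by rewrite in_itv/= yx andbT ltr_pdivrMr// ler_pdivrMr// mulrC => /ltW.
  move=> [n _] /=; rewrite in_itv/= => /andP[+ ->]; rewrite andbT; apply: lt_le_trans.
  by rewrite divr_gt0.
have H n : x * n.+1%:R^-1 <= x by rewrite ler_pdivrMr// ler_peMr ?(ltW x0)// ler1n.
have cv : (\int[mu]_(t in `[(x * n.+1%:R^-1)%R, x]) (t `^ (c - 1))%:E)%E @[n --> \oo]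
    --> (\int[mu]_(t in \bigcup_n `[(x * n.+1%:R^-1)%R, x]%classic) (t `^ (c - 1))%:E)%E.
  apply: ge0_nondecreasing_set_cvg_integral => //.
  - move=> m n mn; rewrite subsetEset => y /=; rewrite !in_itv/= => /andP[+ ->].
    rewrite andbT; apply: le_trans; rewrite ler_pM2l// lef_pV2 ?posrE// ler_nat.
    by rewrite ltnS.
  - by move=> n; exact: measurable_pow.
  - by move=> n y _; rewrite lee_fin powR_ge0.
apply/esym/(cvg_unique _ _ cv) => //.
rewrite (_ : (fun n => _) = (fun n : nat =>
   ((x `^ c - (x / n.+1%:R) `^ c) / c)%:E)); last first.
  by apply/funext => n; rewrite int_pow ?divr_gt0 ?gt_eqF.
apply: cvg_EFin; first by near=> n.
rewrite -[X in _ --> X](subr0 (x `^ c / c)).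
rewrite /comp/=; under eq_fun do rewrite mulrBl.
apply: cvgB; first exact: cvg_cst.
rewrite -(mul0r c^-1); apply: cvgM; last exact: cvg_cst.
under eq_fun do rewrite powRM ?(ltW x0) ?invr_ge0//.
rewrite -(mulr0 (x `^ c)); apply: cvgM; first exact: cvg_cst.
exact: (@cvg_harm (@powR R ^~ c)) (powR_cvg0 c0).
Unshelve. all: by end_near. Qed.

Lemma int_powy (x c : R) : 0 < x -> 0 < c ->
  (\int[mu]_(t in `[x, +oo[) (t `^ (- c - 1))%:E = (x `^ (- c) / c)%:E)%E.
Proof.
move=> x0 c0.
have c0' : - c != 0 by rewrite oppr_eq0 gt_eqF.
have D (t : R) : x <= t ->
    is_derive t 1 (fun x => x `^ (- c) / (- c)) (t `^ (- c - 1)).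
  by move=> xt; apply: is_derive_powRc => //; exact: lt_le_trans xt.
rewrite (@ge0_continuous_FTC2y _ _ (fun x => x `^ (- c) / (- c)) x 0).
- by rewrite sub0e -EFinN; congr EFin; rewrite invrN mulrN opprK.
- by move=> t _; exact: powR_ge0.
- apply: continuous_in_subspaceT => y; rewrite inE/= in_itv/= andbT => xy.
  by apply: powR_cont; exact: lt_le_trans xy.
- rewrite -(mul0r (- c)^-1); apply: cvgM; last exact: cvg_cst.
  exact: powRN_cvgy.
- by move=> t /ltW /D [].
- apply: cvg_at_right_filter.
  by apply: cvgM; [exact: powR_cont|exact: cvg_cst].
- by move=> t; rewrite in_itv/= andbT derive1E => /ltW /D [].
Qed.

(** At exponent [c = 0] the primitive is a logarithm, and for [c < 0] the
    integrand is larger still; the interval from [y] to [x] is chosen so that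
    the logarithm alone contributes [A]. *)
Lemma int_pow0_div (x c : R) : 0 < x -> c <= 0 ->
  (\int[mu]_(t in `]0%R, x]) (t `^ (c - 1))%:E = +oo)%E.
Proof.
move=> x0 c0; apply/eqyP => A A0.
pose y := x * expR (- (A / x `^ c)).
have y0 : 0 < y by rewrite mulr_gt0// expR_gt0.
have yx : y <= x.
  by rewrite ger_pMr// expR_le1 oppr_le0 divr_ge0// ?powR_ge0// ltW.
apply: (@le_trans _ _ (\int[mu]_(t in `[y, x]) (t `^ (c - 1))%:E)%E); last first.
  apply: ge0_subset_integral => //.
  - exact: measurable_pow.
  - by move=> t _; rewrite lee_fin powR_ge0.
  - by move=> t /=; rewrite !in_itv/= => /andP[yt ->]; rewrite (lt_le_trans y0).
apply: (@le_trans _ _ (\int[mu]_(t in `[y, x]) (x `^ c * t^-1)%:E)%E); last first.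
  apply: ge0_le_integral => //.
  - by move=> t; rewrite /= in_itv/= => /andP[yt _]; rewrite lee_fin mulr_ge0 ?powR_ge0 ?invr_ge0// (le_trans (ltW y0)).
  - apply/measurable_EFinP; apply: measurable_funM => //.
    apply: (@measurable_funS _ _ _ _ Rp) => //.
      by move=> t; rewrite /= !in_itv/= andbT => /andP[/(lt_le_trans y0)].
    exact: measurable_inv_Rp.
  - exact: measurable_pow.
  - move=> t; rewrite /= in_itv/= => /andP[yt tx]; rewrite lee_fin.
    have t0 := lt_le_trans y0 yt.
    rewrite powRB1// ler_pM2r ?invr_gt0//.
    rewrite -(opprK c) !(powRN _ (- c)) lef_pV2 ?posrE ?powR_gt0//.
    by rewrite ge0_ler_powR ?nnegrE ?oppr_ge0// ltW.
have -> : (\int[mu]_(t in `[y, x]) (x `^ c * t^-1)%:E = (x `^ c * ln x - x `^ c * ln y)%:E)%E.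
  apply: (@integral_ftc (fun t => x `^ c * ln t) (fun t => x `^ c * t^-1)) => // t /andP[yt _];
    have t0 := lt_le_trans y0 yt.
  - have H := is_derive1_ln t0.
    by apply: is_derive_eq; rewrite /= /GRing.scale/= ?mulr0 ?addr0 ?add0r ?mulr1.
  - by apply: continuousM; [exact: cvg_cst|apply: continuousV => //; rewrite gt_eqF].
rewrite lee_fin -mulrBr -ln_div ?posrE// /y invfM mulrA divff ?gt_eqF// mul1r.
by rewrite -expRN opprK expRK mulrC divfK// gt_eqF// powR_gt0.
Qed.

(** * Moments of the generalized Gaussian *)

Section Gauss.
Variable a : R.
Hypothesis a0 : 0 < a.

Definition gauss (t : R) : R := expR (- (t `^ a / a)).

Lemma gauss_gt0 t : 0 < gauss t. Proof. exact: expR_gt0. Qed.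

Lemma gauss_ge0 t : 0 <= gauss t. Proof. exact: expR_ge0. Qed.

Lemma gauss_le1 t : gauss t <= 1.
Proof. by rewrite expR_le1 oppr_le0 divr_ge0 ?powR_ge0 ?ltW. Qed.

Lemma measurable_gauss D : measurable_fun D gauss.
Proof.
apply: measurable_funTS; apply: measurableT_comp => //.
by apply: measurableT_comp => //; apply: measurable_funM.
Qed.

Lemma gauss_antitone s t : 0 <= s -> s <= t -> gauss t <= gauss s.
Proof.
move=> s0 st; rewrite ler_expR lerN2 ler_pM2r ?invr_gt0// ge0_ler_powR// ?nnegrE.
- exact: ltW.
- exact: le_trans st.
Qed.

(** Raise [y / q <= expR (y / q)] to the power [q = s / a], with
    [y = t^a / a]. *)
Lemma gauss_decay (s : R) : 0 < s -> exists2 C : R, 0 < C &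
  forall t : R, 0 < t -> gauss t <= C * t `^ (- s).
Proof.
move=> s0; pose q := s / a; have q0 : 0 < q by rewrite divr_gt0.
exists ((a * q) `^ q); first by rewrite powR_gt0// mulr_gt0.
move=> t t0; pose y := t `^ a / a.
have y0 : 0 < y by rewrite divr_gt0// powR_gt0.
have yq : (y / q) `^ q <= expR y.
  have -> : expR y = expR (y / q) `^ q by rewrite -expRM divfK ?gt_eqF.
  have yq0 : 0 <= y / q := ltW (divr_gt0 y0 q0).
  rewrite ge0_ler_powR ?nnegrE ?expR_ge0 ?(ltW q0)//.
  by apply: le_trans (expR_ge1Dx _); rewrite lerDr.
have aq0 : 0 < a * q by rewrite mulr_gt0.
have E : (a * q) `^ q * (y / q) `^ q = t `^ s.
  have yq0 : 0 <= y / q := ltW (divr_gt0 y0 q0).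
  rewrite -powRM ?(ltW aq0)//.
  have -> : a * q * (y / q) = t `^ a by rewrite /y; field; rewrite !gt_eqF.
  by rewrite -powRrM /q mulrC divfK ?gt_eqF.
rewrite /gauss expRN powRN ler_pdivlMr ?powR_gt0// -E mulrC ler_pdivrMr ?expR_gt0//.
by rewrite ler_pM2l ?powR_gt0.
Qed.

Definition gauss_moment (c : R) : \bar R :=
  (\int[mu]_(t in Rp) (gauss t * t `^ (c - 1))%:E)%E.

Lemma measurable_gauss_pow (D : set R) c :
  measurable_fun D (fun t => (gauss t * t `^ c)%:E).
Proof.
apply/measurable_EFinP; apply: measurable_funM; first exact: measurable_gauss.
by apply: measurable_funTS; exact: measurable_powR.
Qed.

Lemma gauss_pow_ge0 c t : (0 <= (gauss t * t `^ c)%:E)%E.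
Proof. by rewrite lee_fin mulr_ge0 ?gauss_ge0 ?powR_ge0. Qed.

Lemma gauss_moment_gt0 c : 0 < c -> (0 < gauss_moment c)%E.
Proof.
move=> c0.
apply: (@lt_le_trans _ _ (\int[mu]_(t in `]0%R, 1%R]) (gauss 1 * t `^ (c - 1))%:E)%E).
  under eq_integral do rewrite EFinM.
  rewrite ge0_integralZl//=.
  - by rewrite int_pow0// powR1 mule_gt0// lte_fin ?gauss_gt0// divr_gt0.
  - exact: measurable_pow.
  - by move=> t _; rewrite lee_fin powR_ge0.
  - by rewrite lee_fin gauss_ge0.
apply: (@le_trans _ _ (\int[mu]_(t in `]0%R, 1%R]) (gauss t * t `^ (c - 1))%:E)%E).
  apply: ge0_le_integral; first exact: measurable_itv.
  - by move=> t _; rewrite lee_fin mulr_ge0 ?gauss_ge0 ?powR_ge0.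
  - apply/measurable_EFinP; apply: measurable_funM => //.
    by apply: measurable_funTS; exact: measurable_powR.
  - exact: measurable_gauss_pow.
  - move=> t; rewrite /= in_itv/= => /andP[t0 t1]; rewrite lee_fin ler_wpM2r ?powR_ge0//.
    by apply: gauss_antitone => //; exact: ltW.
apply: ge0_subset_integral => //.
- exact: measurable_gauss_pow.
- by move=> t _; exact: gauss_pow_ge0.
- by move=> t; rewrite /= !in_itv/= andbT => /andP[].
Qed.

Lemma gauss_moment_lty c : 0 < c -> (gauss_moment c < +oo)%E.
Proof.
move=> c0; have [C C0 HC] := @gauss_decay (c + 1) ltac:(by rewrite addr_gt0).
rewrite /gauss_moment (@integral_Rp_split 1)//; last 2 first.
- exact: measurable_gauss_pow.
- by move=> t _; exact: gauss_pow_ge0.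
apply: lte_add_pinfty.
  apply: (@le_lt_trans _ _ (\int[mu]_(t in `]0%R, 1%R]) (t `^ (c - 1))%:E)%E).
    apply: ge0_le_integral; first exact: measurable_itv.
    - by move=> t _; exact: gauss_pow_ge0.
    - exact: measurable_gauss_pow.
    - exact: measurable_pow.
    - by move=> t _; rewrite lee_fin ler_piMl ?powR_ge0// gauss_le1.
  by rewrite int_pow0// ltry.
apply: (@le_lt_trans _ _ (\int[mu]_(t in `[1%R, +oo[) (C%:E * (t `^ (- 1 - 1))%:E))%E).
  apply: ge0_le_integral => //.
  - by move=> t _; exact: gauss_pow_ge0.
  - exact: measurable_gauss_pow.
  - by apply: measurable_funeM; exact: measurable_pow.
  - move=> t; rewrite /= in_itv/= andbT => t1; have t0 : 0 < t by exact: lt_le_trans t1.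
    rewrite -EFinM lee_fin (le_trans (ler_wpM2r (powR_ge0 _ _) (HC t t0)))//.
    rewrite -mulrA -powRDp//.
    by rewrite (_ : - (c + 1) + (c - 1) = - 1 - 1)//; ring.
rewrite ge0_integralZl//=; last 3 first.
- exact: measurable_pow.
- by move=> t _; rewrite lee_fin powR_ge0.
- by rewrite lee_fin ltW.
by rewrite int_powy// -EFinM ltry.
Qed.

Lemma gauss_moment_fin c : 0 < c -> gauss_moment c \is a fin_num.
Proof. by move=> c0; rewrite gt0_fin_numE ?gauss_moment_lty// gauss_moment_gt0. Qed.

Lemma is_derive_gauss (t : R) : 0 < t -> is_derive t 1 gauss (- (t `^ (a - 1) * gauss t)).
Proof.
move=> t0; have H := is_derive_powRc (lt0r_neq0 a0) t0.
have : is_derive t 1 (expR \o (- (fun x => x `^ a / a))) (gauss t * - (t `^ (a - 1))).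
  by apply: is_derive1_comp.
by rewrite mulrN mulrC.
Qed.

Lemma gauss_pow_cvg0 c : 0 < c -> (gauss t * t `^ c) @[t --> 0^'+] --> (0 : R).
Proof.
move=> c0; apply: (@squeeze_cvgr _ _ _ _ (cst 0) (@powR R ^~ c)).
- near=> t; rewrite mulr_ge0 ?gauss_ge0 ?powR_ge0//=.
  by rewrite ler_piMl ?powR_ge0 ?gauss_le1.
- exact: cvg_cst.
- exact: powR_cvg0.
Unshelve. all: by end_near. Qed.

Lemma gauss_pow_cvgy c : 0 < c -> (gauss t * t `^ c) @[t --> +oo] --> (0 : R).
Proof.
move=> c0; have [C C0 HC] := @gauss_decay (c + 1) ltac:(by rewrite addr_gt0).
apply: (@squeeze_cvgr _ _ _ _ (cst 0) (fun t => C * t `^ (- 1))).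
- near=> t; have t0 : 0 < t by near: t; exact: nbhs_pinfty_gt.
  rewrite mulr_ge0 ?gauss_ge0 ?powR_ge0//=.
  rewrite (le_trans (ler_wpM2r (powR_ge0 _ _) (HC t t0)))//.
  rewrite -mulrA -powRDp//.
  by rewrite (_ : - (c + 1) + c = - 1)//; ring.
- exact: cvg_cst.
- by rewrite -(mulr0 C); apply: cvgM; [exact: cvg_cst|exact: powRN_cvgy].
Unshelve. all: by end_near. Qed.

(** The derivative of [gauss t * t^c] has integral zero because this function
    vanishes at both ends. For [a = 1] this is the functional equation of the
    Gamma function. *)
Lemma gauss_moment_rec c : 0 < c -> gauss_moment (c + a) = (c%:E * gauss_moment c)%E.
Proof.
move=> c0.
have mg e := @measurable_gauss_pow Rp e.
have c1 := @cvg_Rp _ (mg (c - 1)) (fun t _ => gauss_pow_ge0 _ t).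
have c2 := @cvg_Rp _ (mg (c + a - 1)) (fun t _ => gauss_pow_ge0 _ t).
have cc := cvgeZl (isT : (c%:E \is a fin_num)%E) c1.
apply/(cvg_unique _ _ cc) => //.
pose G (t : R) := gauss t * t `^ c.
have cG : ((G n.+1%:R - G n.+1%:R^-1)%:E) @[n --> \oo] --> (0 : \bar R)%E.
  apply: cvg_EFin; first by near=> n.
  rewrite /comp/= -[X in _ --> X](subr0 0); apply: cvgB.
  - exact: (@cvg_natS G) (gauss_pow_cvgy c0).
  - exact: (@cvg_harm G) (gauss_pow_cvg0 c0).
rewrite -[gauss_moment _]adde0.
have := cvgeD _ c2 cG.
rewrite fin_num_adde_defl// => /(_ _ isT); apply: cvg_trans; apply: near_eq_cvg.
near=> n.
set A := n.+1%:R^-1; set B := n.+1%:R.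
have A0 : 0 < A by rewrite invr_gt0.
have AB : A <= B by rewrite (@le_trans _ _ 1) ?invf_le1 ?ler1n.
have t0 t : A <= t <= B -> 0 < t by move=> /andP[+ _]; exact: lt_le_trans.
have cont e t : 0 < t -> {for t, continuous (fun t => gauss t * t `^ e)}.
  move=> t0'; apply: continuousM; last exact: powR_cont.
  apply: differentiable_continuous; apply/derivable1_diffP.
  exact: (@ex_derive _ _ _ _ _ _ _ (is_derive_gauss t0')).
have intg e : mu.-integrable `[A, B] (EFin \o (fun t => gauss t * t `^ e)).
  by apply: cont_integrable => t /t0; exact: cont.
have <- : (\int[mu]_(t in `[A, B])
    (c * (gauss t * t `^ (c - 1)) - gauss t * t `^ (c + a - 1))%:E
    = (G B - G A)%:E)%E.
  apply: (@integral_ftc G) => // t /t0 {}t0.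
    have h1 := is_derive_gauss t0; have h2 := is_derive1_powR c t0.
    rewrite /G; apply: is_derive_eq; rewrite /= /GRing.scale/=.
    rewrite (_ : c + a - 1 = c + (a - 1)); last by ring.
    by rewrite (powRD (s := a - 1)) ?(gt_eqF t0) ?implybT//; ring.
  apply: continuousB; last exact: cont.
  by apply: continuousM; [exact: cvg_cst|exact: cont].
under [X in (_ + X)%E]eq_integral do rewrite EFinB EFinM.
rewrite integralB//=; [|by apply: integrableZl => //; exact: intg|exact: intg].
rewrite addeCA subee ?adde0; last by apply: integrable_fin_num => //; exact: intg.
by rewrite integralZl//; exact: intg.
Unshelve. all: by end_near. Qed.

End Gauss.

End Tools.

(** * Jensen's inequality and Schur's test *)

Section Schur.
Context {R : realType}.
Notation mu := (@lebesgue_measure R).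
Notation Rp := (`](0 : R), +oo[%classic).

Lemma poweR_le (p : R) (x y : \bar R) : 0 <= p -> (0 <= x)%E -> (x <= y)%E ->
  (x `^ p <= y `^ p)%E.
Proof.
move=> p0 x0 xy; apply: gt0_ler_poweR => //; rewrite in_itv/= leey andbT//.
exact: le_trans xy.
Qed.

(** Young's inequality with a free scale: both sides agree at [g = t], so that
    optimizing over [t] loses nothing. *)
Lemma young_scaled (p t : R) (g : \bar R) : 1 < p -> 0 < t -> (0 <= g)%E ->
  (g <= (t `^ (1 - p) / p)%:E * g `^ p + (t * (1 - p^-1))%:E)%E.
Proof.
move=> p1 t0; have p0 : 0 < p by lra.
case: g => [r|_|//]; last first.
  rewrite poweRyr ?gt_eqF// gt0_muley ?lte_fin ?divr_gt0 ?powR_gt0//.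
rewrite lee_fin => r0; rewrite poweR_EFin -EFinM -EFinD lee_fin.
have q0 : 0 < 1 - p^-1 by rewrite subr_gt0 invf_lt1.
have := @conjugate_powR _ (r / t) 1 p (1 - p^-1)^-1 _ _ p0 _.
rewrite divr_ge0 ?(ltW t0)// ler01 invr_gt0 q0 invrK addrC subrK.
move=> /(_ isT isT isT erefl); rewrite mulr1 powR1 mul1r => H.
rewrite -(ler_pM2r (x := t^-1)) ?invr_gt0//; apply: (le_trans H).
rewrite mulrDl lerD//; last by rewrite mulrAC divff ?gt_eqF ?mul1r.
rewrite powRM ?invr_ge0 ?(ltW t0)//.
have -> : t^-1 `^ p = t `^ (1 - p) * t^-1.
  rewrite -{1}(powR_inv1 (ltW t0)) -powRrM -[in RHS](powR_inv1 (ltW t0)).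
  rewrite -powRDp//; congr powR; ring.
by apply: le_of_eq; ring.
Qed.

(** Young's inequality is integrated against [phi] and then the scale is set to
    its optimal value [(G / A)^(1/p)]. Since [G] may vanish, it is first
    replaced with an upper bound [G' > 0]. *)
Lemma jensen_powR (D : set R) (phi : R -> R) (g : R -> \bar R) (p A : R) :
  measurable D -> 1 < p -> 0 < A ->
  measurable_fun D phi -> measurable_fun D g ->
  (forall x, D x -> 0 <= phi x) -> (forall x, D x -> (0 <= g x)%E) ->
  (\int[mu]_(x in D) (phi x)%:E <= A%:E)%E ->
  ((\int[mu]_(x in D) ((phi x)%:E * g x)) `^ p <=
    (A `^ (p - 1))%:E * \int[mu]_(x in D) ((phi x)%:E * g x `^ p))%E.
Proof.
move=> mD p1 A0 mphi mg phi0 g0 phiA; have p0 : 0 < p by lra.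
set G := (\int[mu]_(x in D) ((phi x)%:E * g x `^ p))%E.
set I := (\int[mu]_(x in D) ((phi x)%:E * g x))%E.
have G0 : (0 <= G)%E.
  by apply: integral_ge0 => x Dx; rewrite mule_ge0 ?poweR_ge0 ?lee_fin ?phi0.
have I0 : (0 <= I)%E.
  by apply: integral_ge0 => x Dx; rewrite mule_ge0 ?g0 ?lee_fin ?phi0.
have mphi' : measurable_fun D (EFin \o phi) by exact/measurable_EFinP.
have mgp : measurable_fun D (fun x => g x `^ p)%E.
  exact: (measurableT_comp (measurable_poweR p) mg).
have young t : 0 < t ->
    (I <= (t `^ (1 - p) / p)%:E * G + (t * (1 - p^-1))%:E * A%:E)%E.
  move=> t0.
  have q0 : 0 <= t * (1 - p^-1).
    by rewrite mulr_ge0 ?(ltW t0)// subr_ge0 invf_le1 ?ltW.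
  have c0 : 0 <= t `^ (1 - p) / p by rewrite divr_ge0 ?powR_ge0 ?ltW.
  apply: (@le_trans _ _ (\int[mu]_(x in D) ((t `^ (1 - p) / p)%:E *
     ((phi x)%:E * g x `^ p) + (t * (1 - p^-1))%:E * (phi x)%:E))%E).
    apply: le_int_ge0 => x Dx; first by rewrite mule_ge0 ?g0 ?lee_fin ?phi0.
    apply: (@le_trans _ _ ((phi x)%:E * ((t `^ (1 - p) / p)%:E * g x `^ p + (t * (1 - p^-1))%:E))%E).
      by rewrite lee_wpmul2l ?lee_fin ?phi0// young_scaled ?g0.
    rewrite ge0_muleDr ?lee_fin ?mule_ge0 ?poweR_ge0 ?lee_fin//.
    by rewrite muleCA (muleC (phi x)%:E _%:E).
  rewrite ge0_integralD//=; last 4 first.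
  - by move=> x Dx; rewrite !mule_ge0 ?poweR_ge0 ?lee_fin ?phi0.
  - by apply: measurable_funeM; exact: emeasurable_funM.
  - by move=> x Dx; rewrite mule_ge0 ?lee_fin ?phi0.
  - exact: measurable_funeM.
  rewrite ge0_integralZl//=; last 2 first.
  - exact: emeasurable_funM.
  - by move=> x Dx; rewrite !mule_ge0 ?poweR_ge0 ?lee_fin ?phi0.
  rewrite [X in (_ + X <= _)%E]ge0_integralZl//=.
  by rewrite leeD2l// lee_wpmul2l.
have key (G' : R) : 0 < G' -> (G <= G'%:E)%E -> (I `^ p <= (A `^ (p - 1) * G')%:E)%E.
  move=> G'0 GG'.
  have GA : 0 < G' / A by rewrite divr_gt0.
  pose t := (G' / A) `^ p^-1; have t0 : 0 < t by rewrite powR_gt0.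
  have tp : t `^ p = G' / A by rewrite -powRrM mulVf ?gt_eqF// powRr1// ltW.
  have IB : (I <= (t * A)%:E)%E.
    apply: (le_trans (young t t0)).
    apply: (@le_trans _ _ ((t `^ (1 - p) / p)%:E * G'%:E + (t * (1 - p^-1))%:E * A%:E)%E).
      by rewrite leeD2r// lee_wpmul2l// lee_fin divr_ge0 ?powR_ge0 ?ltW.
    rewrite -!EFinM -EFinD lee_fin.
    have -> : G' = t `^ p * A by rewrite tp divfK// gt_eqF.
    rewrite powRBp// powRr1 ?(ltW t0)//.
    have tp0 : t `^ p != 0 by rewrite gt_eqF ?powR_gt0.
    by apply: le_of_eq; field; rewrite gt_eqF.
  apply: (@le_trans _ _ ((t * A)%:E `^ p)%E).
    exact: (poweR_le (ltW p0)).
  rewrite poweR_EFin lee_fin powRM ?(ltW t0) ?(ltW A0)// tp.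
  rewrite powRB1//.
  by apply: le_of_eq; field; rewrite gt_eqF.
have Ap : 0 < A `^ (p - 1) by rewrite powR_gt0.
have [Gy|Gy] := eqVneq G +oo%E.
  by rewrite Gy gt0_muley ?leey ?lte_fin.
have Gfin : G \is a fin_num by rewrite ge0_fin_numE// ltey.
apply/lee_addgt0Pr => e e0.
have -> : ((A `^ (p - 1))%:E * G + e%:E = (A `^ (p - 1) * (fine G + e / A `^ (p - 1)))%:E)%E.
  rewrite -[in LHS](fineK Gfin) -EFinM -EFinD mulrDr; congr (_ + _)%:E.
  by rewrite mulrC divfK// gt_eqF.
apply: key; first by rewrite ltr_wpDl ?fine_ge0// divr_gt0.
by rewrite EFinD fineK// leeDl// lee_fin divr_ge0 ?ltW.
Qed.

(** Jensen's inequality with respect to [k x y dy / y], whose mass is at most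
    [A], followed by an exchange of the integrals that brings in the other mass
    [B]. *)
Lemma schur_test (k : R -> R -> R) (g : R -> \bar R) (p A B : R) :
  1 < p -> 0 < A ->
  measurable_fun setT (fun z : R * R => k z.1 z.2) ->
  measurable_fun Rp g ->
  (forall x y, 0 < x -> 0 < y -> 0 <= k x y) ->
  (forall x, 0 < x -> (0 <= g x)%E) ->
  (forall x, 0 < x -> (\int[mu]_(y in Rp) (k x y / y)%:E <= A%:E)%E) ->
  (forall y, 0 < y -> (\int[mu]_(x in Rp) (k x y / x)%:E <= B%:E)%E) ->
  (\int[mu]_(x in Rp) ((\int[mu]_(y in Rp) ((k x y / y)%:E * g y)) `^ p * x^-1%:E)
   <= (A `^ (p - 1) * B)%:E * \int[mu]_(y in Rp) (g y `^ p * y^-1%:E))%E.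
Proof.
move=> p1 A0 mk mg k0 g0 hA hB.
have mRp : measurable Rp by exact: measurable_itv.
have minv := @measurable_inv_Rp R.
have mkx x : measurable_fun Rp (fun y => k x y / y).
  apply: measurable_funM => //; apply: measurable_funTS.
  have : measurable_fun setT ((fun z : R * R => k z.1 z.2) \o (fun y => (x, y))).
    apply: (@measurableT_comp _ _ _ _ _ _ (fun z : R * R => k z.1 z.2)) => //.
    exact: pair1_measurable.
  by [].
have mky y : measurable_fun Rp (fun x => k x y / x).
  apply: measurable_funM => //; apply: measurable_funTS.
  have : measurable_fun setT ((fun z : R * R => k z.1 z.2) \o (fun x => (x, y))).
    apply: (@measurableT_comp _ _ _ _ _ _ (fun z : R * R => k z.1 z.2)) => //.
  by [].
have mgp : measurable_fun Rp (fun x => g x `^ p)%E.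
  exact: (measurableT_comp (measurable_poweR p) mg).
apply: (@le_trans _ _ (\int[mu]_(x in Rp) ((A `^ (p - 1))%:E *
    \int[mu]_(y in Rp) ((k x y / y / x)%:E * g y `^ p)))%E).
  apply: le_int_ge0 => x /=; rewrite in_itv/= andbT => x0.
    by rewrite mule_ge0 ?poweR_ge0// lee_fin invr_ge0 ltW.
  apply: (@le_trans _ _ ((A `^ (p - 1))%:E * \int[mu]_(y in Rp) ((k x y / y)%:E * g y `^ p) * x^-1%:E)%E).
    rewrite lee_wpmul2r ?lee_fin ?invr_ge0 ?(ltW x0)//.
    apply: jensen_powR => //.
    - by move=> y /=; rewrite in_itv/= andbT => y0; rewrite divr_ge0 ?k0 ?ltW.
    - by move=> y /=; rewrite in_itv/= andbT => y0; exact: g0.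
    - exact: hA.
  rewrite -muleA lee_wpmul2l ?lee_fin ?powR_ge0// muleC -ge0_integralZl//=.
  - apply: le_of_eq; apply: eq_integral => y _.
    by rewrite muleA -EFinM (mulrC x^-1).
  - by apply: emeasurable_funM; [apply/measurable_EFinP; exact: mkx|exact: mgp].
  - by move=> y; rewrite in_itv/= andbT => y0; rewrite mule_ge0 ?poweR_ge0// lee_fin divr_ge0 ?k0 ?ltW.
  - by rewrite lee_fin invr_ge0 ltW.
have m2 : measurable_fun (Rp `*` Rp) (fun z : R * R => ((k z.1 z.2 / z.2 / z.1)%:E * g z.2 `^ p)%E).
  have mRR : measurable (Rp `*` Rp) by exact: measurableX.
  apply: emeasurable_funM.
    apply/measurable_EFinP; apply: measurable_funM; last first.
      by apply: (measurable_comp (F := Rp)) minv _ => //; [move=> _ [z [+ _] <-]|exact: measurable_funTS].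
    apply: measurable_funM; first exact: measurable_funTS.
    by apply: (measurable_comp (F := Rp)) minv _ => //; [move=> _ [z [_ +] <-]|exact: measurable_funTS].
  by apply: (measurable_comp (F := Rp)) mgp _ => //; [move=> _ [z [_ +] <-]|exact: measurable_funTS].
have k0' x y : Rp x -> Rp y -> 0 <= k x y / y / x.
  by rewrite /= !in_itv/= !andbT => x0 y0; rewrite !divr_ge0 ?k0 ?ltW.
rewrite ge0_integralZl//=; last 3 first.
- by apply: (@measurable_int_on _ Rp Rp (fun x y => (k x y / y / x)%:E * g y `^ p)%E) => // x y Dx Dy; rewrite mule_ge0 ?poweR_ge0 ?lee_fin ?k0'.
- by move=> x Dx; apply: integral_ge0 => y Dy; rewrite mule_ge0 ?poweR_ge0 ?lee_fin ?k0'.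
- by rewrite lee_fin powR_ge0.
rewrite EFinM -muleA lee_wpmul2l ?lee_fin ?powR_ge0//.
rewrite tonelli_on//; last first.
  by move=> x y Dx Dy; rewrite mule_ge0 ?poweR_ge0 ?lee_fin ?k0'.
have B0 : 0 <= B.
  rewrite -lee_fin; apply: le_trans (hB 1 ltr01); apply: integral_ge0 => x /=.
  by rewrite in_itv/= andbT => x0; rewrite lee_fin divr_ge0 ?k0 ?ltW.
rewrite -ge0_integralZl//=; last 2 first.
- by apply: emeasurable_funM => //; exact/measurable_EFinP.
- by move=> y; rewrite in_itv/= andbT => y0; rewrite mule_ge0 ?poweR_ge0// lee_fin invr_ge0 ltW.
apply: le_int_ge0 => y Dy.
  by apply: integral_ge0 => x Dx; rewrite mule_ge0 ?poweR_ge0 ?lee_fin ?k0'.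
have y0 : 0 < y by move: Dy; rewrite /= in_itv/= andbT.
have -> : (\int[mu]_(x in Rp) ((k x y / y / x)%:E * g y `^ p) =
    (g y `^ p * y^-1%:E) * \int[mu]_(x in Rp) (k x y / x)%:E)%E.
  rewrite -ge0_integralZl//=; last 3 first.
  - by apply/measurable_EFinP; exact: mky.
  - by move=> x; rewrite in_itv/= andbT => x0; rewrite lee_fin divr_ge0 ?k0 ?ltW.
  - by rewrite mule_ge0 ?poweR_ge0// lee_fin invr_ge0 ltW.
  by apply: eq_integral => x _; rewrite muleC -muleA -EFinM; congr (_ * _%:E)%E; ring.
rewrite muleC lee_wpmul2r ?hB//.
by rewrite mule_ge0 ?poweR_ge0// lee_fin invr_ge0 ltW.
Qed.

End Schur.

(** * Monotonicity from the sign of the derivative *)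

Section Deriv.
Context {R : realType}.
Implicit Types (f g : R -> R) (x : R).

Lemma is_derive_cont f (x df : R) : is_derive x 1 f df -> {for x, continuous f}.
Proof.
by move=> [+ _] => /derivable1_diffP ?; exact: differentiable_continuous.
Qed.

Lemma deriv_ge0_le f df (x y : R) : x <= y ->
  (forall t, x <= t <= y -> is_derive t 1 f (df t)) ->
  (forall t, x <= t <= y -> 0 <= df t) -> f x <= f y.
Proof.
move=> xy dF df0; have H t : t \in `]x, y[ -> is_derive t 1 f (df t).
  by rewrite in_itv/= => /andP[xt ty]; apply: dF; rewrite !ltW.
have [|c] := MVT_segment xy H.
  apply: continuous_in_subspaceT => t; rewrite inE/= in_itv/= => xty.
  exact: (is_derive_cont (dF t xty)).
rewrite in_itv/= => xcy E; rewrite -subr_ge0 E mulr_ge0 ?df0// subr_ge0//.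
Qed.

Lemma deriv_le0_ge f df (x y : R) : x <= y ->
  (forall t, x <= t <= y -> is_derive t 1 f (df t)) ->
  (forall t, x <= t <= y -> df t <= 0) -> f y <= f x.
Proof.
move=> xy dF df0; rewrite -lerN2.
apply: (@deriv_ge0_le (fun t => - f t) (fun t => - df t)) => // t xty.
  by have := dF t xty => H; apply: is_deriveN.
by rewrite oppr_ge0 df0.
Qed.

End Deriv.

(** * The entire function behind the normalized Bessel functions *)

Section BesselSeries.
Context {R : realType}.
Variable o : R.
Hypothesis o12 : - 2^-1 <= o.

(** Coefficients of the normalized Bessel function of order [o] in the variable
    [t^2 / 4]. *)
Definition bcoef (k : nat) : R :=
  (-1) ^+ k / (k`!%:R * \prod_(i < k) (o + 1 + i%:R)).

Lemma bfactor_ge i : 2^-1 <= o + 1 + i%:R.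
Proof. by move: (i%:R) (ler0n R i) => y y0; move: o12; lra. Qed.

Lemma bprod_gt0 k : 0 < \prod_(i < k) (o + 1 + i%:R).
Proof. by apply: prodr_gt0 => i _; have := bfactor_ge i; lra. Qed.

Lemma bcoef0 : bcoef 0 = 1.
Proof. by rewrite /bcoef expr0 fact0 big_ord0 mulr1 divr1. Qed.

Lemma bcoefS k : (k.+1%:R) * (o + 1 + k%:R) * bcoef k.+1 = - bcoef k.
Proof.
have := bprod_gt0 k; have := bfactor_ge k.
rewrite /bcoef exprS factS natrM big_ord_recr/=.
set P := \prod_(i < k) _ => h1 h2.
have f0 : k`!%:R != 0 :> R by rewrite pnatr_eq0 -lt0n fact_gt0.
have k0 : k.+1%:R != 0 :> R by rewrite pnatr_eq0.
rewrite -(natr1 k) in k0 *.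
by field; rewrite f0 k0 !gt_eqF//=; lra.
Qed.

(** Coefficients dominated by those of an exponential: their power series
    converge everywhere, and the class is stable under formal derivation. *)
Definition expbounded (c : nat -> R) :=
  exists C r : R, [/\ 0 <= C, 0 <= r & forall k, `|c k| <= C * (r ^+ k / k`!%:R)].

Lemma expbounded_cvg c x : expbounded c -> cvgn (pseries c x).
Proof.
move=> [C [r [C0 r0 H]]]; apply: normed_cvg; rewrite /pseries/=.
apply: (@series_le_cvg _ _ (fun k => C * (exp_coeff (r * `|x|)) k)).
- by move=> n /=; rewrite normr_ge0.
- by move=> n; rewrite /exp_coeff/= mulr_ge0// divr_ge0// exprn_ge0// mulr_ge0.
- move=> n /=; rewrite normrM normrX /exp_coeff/= exprMn.
  by rewrite mulrAC mulrA ler_wpM2r ?exprn_ge0//; rewrite -mulrA; exact: H.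
- by apply: is_cvg_seriesZ; exact: is_cvg_series_exp_coeff.
Qed.

Lemma expbounded_diffs c : expbounded c -> expbounded (pseries_diffs c).
Proof.
move=> [C [r [C0 r0 H]]]; exists (C * r), r; split => //; first exact: mulr_ge0.
move=> k; rewrite /pseries_diffs normrM normr_nat.
have k0 : 0 < k.+1%:R :> R by rewrite ltr0n.
rewrite -ler_pdivlMl//; apply: (le_trans (H k.+1)).
rewrite factS natrM exprS; apply: le_of_eq.
have f0 : k`!%:R != 0 :> R by rewrite pnatr_eq0 -lt0n fact_gt0.
by move: (k.+1%:R) k0 => y y0; field; rewrite f0 gt_eqF.
Qed.

Lemma expbounded_bcoef : expbounded bcoef.
Proof.
exists 1, 2; split => // k; rewrite mul1r /bcoef normrM normrX normrN1 expr1n mul1r.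
have P0 := bprod_gt0 k.
have f0 : 0 < k`!%:R :> R by rewrite ltr0n fact_gt0.
rewrite normfV ger0_norm ?mulr_ge0 ?(ltW f0) ?(ltW P0)//.
rewrite invfM mulrC ler_pM2r ?invr_gt0//.
rewrite invf_ple ?posrE ?exprn_gt0//.
(* the factors of the product are at least 1/2, whence the ratio 2 *)
rewrite -exprVn -[X in _ ^+ X](card_ord k) -prodr_const.
apply: ler_prod => i _; rewrite bfactor_ge andbT invr_ge0.
by [].
Qed.

(** With [z = t^2 / 4] this is the normalized Bessel function [besselj o t],
    see [besselj_bfun]; unlike the latter it is entire, and its derivatives are
    again power series. *)
Definition bfun (z : R) : R := limn (pseries bcoef z).
Definition bfun1 (z : R) : R := limn (pseries (pseries_diffs bcoef) z).
Definition bfun2 (z : R) : R := limn (pseries (pseries_diffs (pseries_diffs bcoef)) z).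

Lemma is_derive_pseries c (x : R) : expbounded c ->
  is_derive x 1 (fun z => limn (pseries c z)) (limn (pseries (pseries_diffs c) x)).
Proof.
move=> hc; have hd := expbounded_diffs hc; have hdd := expbounded_diffs hd.
apply: (@pseries_snd_diffs _ _ (`|x| + 1)); try exact: expbounded_cvg.
by rewrite [ltRHS]ger0_norm ?addr_ge0// ltrDl.
Qed.

Lemma is_derive_bfun (z : R) : is_derive z 1 bfun (bfun1 z).
Proof. by apply: is_derive_pseries; exact: expbounded_bcoef. Qed.

Lemma is_derive_bfun1 (z : R) : is_derive z 1 bfun1 (bfun2 z).
Proof. by apply: is_derive_pseries; apply: expbounded_diffs; exact: expbounded_bcoef. Qed.

Lemma bfun_at0 : bfun 0 = 1.
Proof.
rewrite /bfun; apply/cvg_lim => //.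
apply: cvg_near_cst; near=> n.
have n0 : (0 < n)%N by near: n; exact: nbhs_infty_gt.
rewrite /pseries /series/= -(prednK n0) big_nat_recl//= expr0 mulr1 bcoef0.
by rewrite big1 ?addr0// => i _; rewrite expr0n/= mulr0.
Unshelve. all: by end_near. Qed.

(** Bessel's equation in the variable [z = t^2 / 4]; on coefficients it is the
    recurrence [bcoefS]. *)
Lemma bessel_ode z : z * bfun2 z + (o + 1) * bfun1 z + bfun z = 0.
Proof.
have e0 := expbounded_bcoef; have e1 := expbounded_diffs e0.
have e2 := expbounded_diffs e1.
have c0 : series (fun i => bcoef i * z ^+ i) @ \oo --> bfun z := @expbounded_cvg _ z e0.
have c1 : series (fun i => pseries_diffs bcoef i * z ^+ i) @ \oo --> bfun1 z := @expbounded_cvg _ z e1.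
have c2 := pseries_diffs_equiv (@expbounded_cvg _ z e2).
rewrite -/(bfun2 z) in c2.
have C : (z *: series (fun i => i%:R * pseries_diffs bcoef i * z ^+ i.-1) n +
   (o + 1) *: series (fun i => pseries_diffs bcoef i * z ^+ i) n +
   series (fun i => bcoef i * z ^+ i) n) @[n --> \oo] --> z *: bfun2 z + (o + 1) *: bfun1 z + bfun z.
  apply: cvgD; last exact: c0.
  by apply: cvgD; apply: cvgZr.
apply: (cvg_unique _ C) => //.
apply: cvg_near_cst; near=> n.
rewrite /series/= !scaler_sumr -!big_split/= big1// => i _.
rewrite /pseries_diffs /GRing.scale/=.
have -> : z * (i%:R * (i.+1%:R * bcoef i.+1) * z ^+ i.-1) =
   i%:R * (i.+1%:R * bcoef i.+1) * z ^+ i.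
  by case: i => [|i]; rewrite ?mul0r ?mulr0//= exprS; ring.
have := bcoefS i => H.
have -> : bcoef i = - (i.+1%:R * (o + 1 + i%:R) * bcoef i.+1) by rewrite H opprK.
ring.
Unshelve. all: by end_near. Qed.

End BesselSeries.

Section BesselGamma.
Context {R : realType}.
Notation mu := (@lebesgue_measure R).
Notation Rp := (`](0 : R), +oo[%classic).

Lemma Gamma_moment (x : R) : Gamma x = fine (gauss_moment 1 x).
Proof.
rewrite /Gamma /Rintegral /gauss_moment; congr fine; apply: eq_integral => t.
rewrite inE/= in_itv/= andbT => t0.
by rewrite /gauss powRr1 ?(ltW t0)// divr1 mulrC.
Qed.

Lemma Gamma_gt0 (x : R) : 0 < x -> 0 < Gamma x.
Proof.
move=> x0; rewrite Gamma_moment fine_gt0// gauss_moment_gt0//=.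
by rewrite gauss_moment_lty.
Qed.

Lemma GammaS (x : R) : 0 < x -> Gamma (x + 1) = x * Gamma x.
Proof.
move=> x0; rewrite !Gamma_moment gauss_moment_rec// fineM//.
by rewrite gauss_moment_fin.
Qed.

Lemma Gamma_prod (x : R) k : 0 < x ->
  Gamma (x + k%:R) = Gamma x * \prod_(i < k) (x + i%:R).
Proof.
move=> x0; elim: k => [|k IH]; first by rewrite big_ord0 addr0 mulr1.
rewrite big_ord_recr/= -natr1 addrA GammaS; last by rewrite ltr_wpDr.
by rewrite IH; ring.
Qed.

(** The functional equation of Gamma replaces [Gamma (k + o + 1)] with
    [Gamma (o + 1)] times the product that occurs in [bcoef]. *)
Lemma besselj_bfun (o t : R) : - 2^-1 <= o -> 0 < t ->
  besselj o t = bfun o (t ^+ 2 / 4).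
Proof.
move=> o12 t0; rewrite /besselj (gt_eqF t0).
have o1 : 0 < o + 1 by move: o12; lra.
have G0 := Gamma_gt0 o1.
have t2 : 0 < t / 2 by rewrite divr_gt0.
have E : besselJ o t = ((t / 2) `^ o / Gamma (o + 1)) * bfun o (t ^+ 2 / 4).
  rewrite /besselJ /bfun; apply/cvg_lim => //.
  have c0 := @expbounded_cvg _ _ (t ^+ 2 / 4) (expbounded_bcoef o12).
  have := cvgZr (k := (t / 2) `^ o / Gamma (o + 1)) c0.
  move=> /(_ _); apply: cvg_trans; apply: near_eq_cvg; near=> n.
  rewrite /pseries /series/= scaler_sumr; apply: eq_bigr => k _.
  rewrite /bcoef /GRing.scale/=.
  have -> : k%:R + o + 1 = (o + 1) + k%:R by ring.
  rewrite Gamma_prod//.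
  have -> : (t / 2) `^ (k.*2%:R + o) = (t / 2) `^ o * (t ^+ 2 / 4) ^+ k.
    rewrite powRDp// mulrC powR_mulrn ?(ltW t2)//.
    by rewrite -mul2n exprM expr_div_n -natrX.
  have P0 := bprod_gt0 o12 k; set P := \prod_(i < k) _ in P0 *.
  have f0 : k`!%:R != 0 :> R by rewrite pnatr_eq0 -lt0n fact_gt0.
  move: (k`!%:R) f0 ((-1) ^+ k) ((t ^+ 2 / 4) ^+ k) => F F0 S T.
  by field; rewrite F0 !gt_eqF.
rewrite E powRM ?invr_ge0 ?(ltW t0)// powRN.
have T0 : t `^ o != 0 by rewrite gt_eqF ?powR_gt0.
have -> : 2^-1 `^ o = (2 `^ o)^-1 :> R.
  by rewrite -powR_inv1// -powRrM mulN1r powRN.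
have T2 : 2 `^ o != 0 :> R by rewrite gt_eqF ?powR_gt0.
by field; rewrite T0 T2 gt_eqF.
Unshelve. all: by end_near. Qed.

End BesselGamma.

(** * Size and oscillation of the kernel *)

Section HankelKernel.
Context {R : realType}.
Variables (a lam : R).
Hypothesis a0 : 0 < a.
Hypothesis hlam : 0 <= 4 * lam + a.

Let o := 2 * lam / a.
(** [kap] is the exponent of decay of the kernel at infinity, and [dim] the
    homogeneous dimension of the measure. *)
Definition kap : R := lam + a / 4.
Definition dim : R := 2 * lam + a.

Lemma order_ge : - 2^-1 <= o.
Proof.
rewrite /o ler_pdivlMr//; move: hlam; lra.
Qed.

Lemma kap_ge0 : 0 <= kap. Proof. rewrite /kap; move: hlam; lra. Qed.

Lemma dimE : dim = 2 * kap + a / 2. Proof. by rewrite /dim /kap; field. Qed.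

Lemma dim_gt0 : 0 < dim.
Proof. by rewrite dimE; move: kap_ge0 a0; lra. Qed.

Lemma kap_lt_dim : kap < dim.
Proof. by rewrite dimE; move: kap_ge0 a0; lra. Qed.

(** The value of [t^2 / 4] at [t = (2 / a) x^(a/2)]. *)
Definition hz (x : R) : R := x `^ a / a ^+ 2.
Definition hK (x : R) : R := bfun o (hz x).
(** The derivative of [hK] divided by the angular speed [sp x = x^(a/2 - 1)]:
    Bessel's equation says that the pair [(hK, hL)] rotates at this speed, with
    a friction term on [hL]. *)
Definition hL (x : R) : R := x `^ (a / 2) * bfun1 o (hz x) / a.

Lemma besselj_hK (x : R) : 0 < x -> besselj o (2 / a * x `^ (a / 2)) = hK x.
Proof.
move=> x0; rewrite besselj_bfun ?order_ge//; last first.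
  by rewrite mulr_gt0 ?divr_gt0 ?powR_gt0.
congr bfun; rewrite /hz exprMn -[(_ `^ _) ^+ 2]powR_mulrn ?powR_ge0// -powRrM.
by rewrite divfK ?pnatr_eq0//; field; rewrite gt_eqF.
Qed.

Definition sp (x : R) : R := x `^ (a / 2 - 1).

Lemma is_derive_hz (x : R) : 0 < x -> is_derive x 1 hz (x `^ (a - 1) / a).
Proof.
move=> x0; have H := is_derive_powRc (lt0r_neq0 a0) x0.
have -> : hz = (fun y => a^-1 * (y `^ a / a)).
  by apply/funext => y; rewrite /hz; field; rewrite gt_eqF.
by apply: is_derive_eq; rewrite /GRing.scale/=; ring.
Qed.

Lemma is_derive_hK (x : R) : 0 < x -> is_derive x 1 hK (sp x * hL x).
Proof.
move=> x0; have H := is_derive_hz x0; have H2 := is_derive_bfun order_ge (hz x).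
have : is_derive x 1 (bfun o \o hz) (bfun1 o (hz x) * (x `^ (a - 1) / a)).
  exact: is_derive1_comp.
move=> H3; apply: is_derive_eq; rewrite /sp /hL.
have -> : x `^ (a - 1) = x `^ (a / 2 - 1) * x `^ (a / 2).
  by rewrite -powRDp//; congr powR; field.
ring.
Qed.

Lemma is_derive_hL (x : R) : 0 < x ->
  is_derive x 1 hL (- (sp x * hK x) - 2 * kap * hL x / x).
Proof.
move=> x0; have H := is_derive_hz x0; have H2 := is_derive_bfun1 order_ge (hz x).
have H3 : is_derive x 1 (bfun1 o \o hz) (bfun2 o (hz x) * (x `^ (a - 1) / a)).
  exact: is_derive1_comp.
have H4 := is_derive1_powR (a / 2) x0.
have -> : hL = (fun y => a^-1 * (y `^ (a / 2) * (bfun1 o \o hz) y)).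
  by apply/funext => y; rewrite /hL/=; ring.
apply: is_derive_eq; rewrite /GRing.scale/= /hL /sp /hK.
have ode := bessel_ode order_ge (hz x).
have E1 : x `^ (a - 1) = x `^ (a / 2) * x `^ (a / 2) / x.
  rewrite -powRDp// powRBp//.
  by rewrite powRr1 ?(ltW x0)// -splitr.
have E2 : x `^ (a / 2 - 1) = x `^ (a / 2) / x.
  by rewrite powRB1.
have E3 : hz x = x `^ (a / 2) * x `^ (a / 2) / a ^+ 2.
  by rewrite /hz -powRDp// -splitr.
rewrite E1 E2; move: ode; set b2 := bfun2 _ _; set b1 := bfun1 _ _; set b := bfun _ _.
rewrite E3 => ode; move: ode; set T := x `^ (a / 2) => ode.
have -> : b = - (T * T / a ^+ 2 * b2 + (o + 1) * b1).
  by apply/eqP; rewrite -addr_eq0 addrC ode.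
by rewrite /o /kap; field; rewrite !gt_eqF.
Qed.

Lemma hz_cvg0 : hz x @[x --> 0^'+] --> (0 : R).
Proof.
have : (x `^ a * (a ^+ 2)^-1) @[x --> 0^'+] --> (0 * (a ^+ 2)^-1 : R).
  by apply: cvgM; [exact: powR_cvg0|exact: cvg_cst].
by rewrite mul0r.
Qed.

Lemma bfun_cont : continuous (bfun o).
Proof. by move=> z; exact: is_derive_cont (is_derive_bfun order_ge z). Qed.

Lemma bfun1_cont : continuous (bfun1 o).
Proof. by move=> z; exact: is_derive_cont (is_derive_bfun1 order_ge z). Qed.

Lemma hK_cvg0 : hK x @[x --> 0^'+] --> (1 : R).
Proof.
rewrite -(bfun_at0 o); apply: (cvg_comp hz _ hz_cvg0).
exact: bfun_cont.
Qed.

Lemma hL_cvg0 : hL x @[x --> 0^'+] --> (0 : R).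
Proof.
have : hL x @[x --> 0^'+] --> (0 * bfun1 o 0 * a^-1 : R).
  apply: cvgM; last exact: cvg_cst.
  apply: cvgM; first by apply: powR_cvg0; rewrite divr_gt0.
  apply: (cvg_comp hz _ hz_cvg0); exact: bfun1_cont.
by rewrite !mul0r.
Qed.

Lemma measurable_hK : measurable_fun setT hK.
Proof.
apply: (measurableT_comp (continuous_measurable_fun bfun_cont)).
by apply: measurable_funM => //; exact: measurable_powR.
Qed.

(** The rotation preserves the energy and the friction coefficient [2 kap / x]
    is nonnegative. *)
Lemma hE_noninc (x y : R) : 0 < x -> x <= y ->
  hK y ^+ 2 + hL y ^+ 2 <= hK x ^+ 2 + hL x ^+ 2.
Proof.
move=> x0 xy.
apply: (@deriv_le0_ge _ (fun t => hK t ^+ 2 + hL t ^+ 2)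
   (fun t => - (4 * kap * hL t ^+ 2 / t))) => // t /andP[xt _];
  have t0 := lt_le_trans x0 xt.
  have h1 := is_derive_hK t0; have h2 := is_derive_hL t0.
  by apply: is_derive_eq; rewrite /GRing.scale/=; field; rewrite gt_eqF.
by rewrite oppr_le0 divr_ge0 ?(ltW t0)// mulr_ge0 ?sqr_ge0// mulr_ge0 ?kap_ge0.
Qed.

(** The energy starts from [1] at the origin; this bounds [hK] and [hL]. *)
Lemma hE_le1 (x : R) : 0 < x -> hK x ^+ 2 + hL x ^+ 2 <= 1.
Proof.
move=> x0.
have C : (hK t ^+ 2 + hL t ^+ 2) @[t --> 0^'+] --> (1 : R).
  have : (hK t * hK t + hL t * hL t) @[t --> 0^'+] --> (1 * 1 + 0 * 0 : R).
    by apply: cvgD; apply: cvgM; (exact: hK_cvg0 || exact: hL_cvg0).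
  by rewrite mul0r mulr1 addr0.
apply: (cvgr_to_ge C); near=> t; apply: hE_noninc => //.
by near: t; exact: nbhs_right_le.
Unshelve. all: by end_near. Qed.

Lemma hK_le1 (x : R) : 0 < x -> `|hK x| <= 1.
Proof.
move=> /hE_le1; have := sqr_ge0 (hL x); rewrite ler_norml !expr2.
by move=> h1 h2; apply/andP; split; nra.
Qed.

Lemma hL_le1 (x : R) : 0 < x -> `|hL x| <= 1.
Proof.
move=> /hE_le1; have := sqr_ge0 (hK x); rewrite ler_norml !expr2.
by move=> h1 h2; apply/andP; split; nra.
Qed.

(** Friction cannot dissipate faster than [x^(- 4 kap)]: multiplied by
    [x^(4 kap)] the energy increases, and near the origin it is positive. *)
Lemma hE_gt0 (x : R) : 0 < x -> 0 < hK x ^+ 2 + hL x ^+ 2.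
Proof.
move=> x0.
have [y /andP[y0 yx] Ky] : exists2 y, 0 < y <= x & 2^-1 < hK y.
  have H : \forall y \near 0^'+, 2^-1 < hK y.
    by apply: (cvgr_gt _ hK_cvg0); rewrite invf_lt1// ltr1n.
  have [y Hy] := @filter_ex _ (0 : R)^'+ _ _ (filterI H (filterI (nbhs_right_gt 0) (nbhs_right_le x0))).
  by exists y; case: Hy => //= Hy1 [Hy2 Hy3]; rewrite Hy2.
pose E t := (hK t ^+ 2 + hL t ^+ 2) * t `^ (4 * kap).
have : E y <= E x.
  apply: (@deriv_ge0_le _ E (fun t => 4 * kap * t `^ (4 * kap - 1) * hK t ^+ 2)) => // t /andP[yt _];
    have t0 := lt_le_trans y0 yt.
    have h1 := is_derive_hK t0; have h2 := is_derive_hL t0.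
    have h3 := is_derive1_powR (4 * kap) t0.
    apply: is_derive_eq; rewrite /GRing.scale/=.
    rewrite powRB1//.
    by field; rewrite gt_eqF.
  by rewrite mulr_ge0 ?sqr_ge0// mulr_ge0 ?powR_ge0// mulr_ge0 ?kap_ge0.
have Ey : 0 < E y.
  rewrite mulr_gt0 ?powR_gt0// ltr_pwDl ?sqr_ge0// exprn_gt0//.
  by apply: lt_trans Ky.
move=> /(lt_le_trans Ey); rewrite pmulr_lgt0// powR_gt0//.
Qed.

(** Multiplication by [x^kap] balances the friction: it is replaced with
    [+ kap / x] on [hu] and [- kap / x] on [hv], so that the amplitude stays
    between positive bounds at infinity. *)
Definition hu (x : R) : R := x `^ kap * hK x.
Definition hv (x : R) : R := x `^ kap * hL x.

Lemma is_derive_hu (x : R) : 0 < x -> is_derive x 1 hu (sp x * hv x + kap * hu x / x).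
Proof.
move=> x0; have h1 := is_derive_hK x0; have h3 := is_derive1_powR kap x0.
rewrite /hu /hv; apply: is_derive_eq; rewrite /GRing.scale/=.
rewrite powRB1//.
by field; rewrite gt_eqF.
Qed.

Lemma is_derive_hv (x : R) : 0 < x -> is_derive x 1 hv (- (sp x * hu x) - kap * hv x / x).
Proof.
move=> x0; have h1 := is_derive_hL x0; have h3 := is_derive1_powR kap x0.
rewrite /hu /hv; apply: is_derive_eq; rewrite /GRing.scale/=.
rewrite powRB1//.
by field; rewrite gt_eqF.
Qed.

(** The mixed term cancels the part of order [1 / x] in the derivative of
    [hu^2 + hv^2], which is not integrable at infinity; what remains is of
    order [x^(- a/2 - 1)]. *)
Let Q (x : R) := hu x ^+ 2 + hv x ^+ 2 + 2 * kap * x `^ (- (a / 2)) * hu x * hv x.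

Let is_derive_Q (x : R) : 0 < x ->
  is_derive x 1 Q (- (a * kap * x `^ (- (a / 2) - 1) * hu x * hv x)).
Proof.
move=> x0; have h1 := is_derive_hu x0; have h2 := is_derive_hv x0.
have h3 := is_derive1_powR (- (a / 2)) x0.
rewrite /Q; apply: is_derive_eq; rewrite /GRing.scale/= /sp.
have -> : x `^ (a / 2 - 1) = (x `^ (- (a / 2)))^-1 / x.
  by rewrite powRB1// -powRN opprK.
have T0 : x `^ (- (a / 2)) != 0 by rewrite gt_eqF ?powR_gt0.
rewrite powRB1//.
by field; rewrite T0 gt_eqF.
Qed.

Let amplitude_low (A B q : R) : A <= B -> B <= 5 / 4 * q -> 4 / 5 * A <= q.
Proof. lra. Qed.

Let amplitude_high (A B q : R) : 3 / 4 * q <= A -> A <= B -> q <= 4 / 3 * B.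
Proof. lra. Qed.

(** Far out, [Q] is comparable with [hu^2 + hv^2] and its logarithmic
    derivative is at most [D x = a kap x^(- a/2 - 1)], the derivative of
    [- 2 kap x^(- a/2)]. Hence [Q] times [P 1] decreases and [Q] times [P (-1)]
    increases, where both factors [P e] tend to [1]. *)
Lemma kernel_amplitude : exists x0 c C : R, [/\ 1 <= x0, 0 < c &
  forall x, x0 <= x -> c <= hu x ^+ 2 + hv x ^+ 2 <= C].
Proof.
have k0 := kap_ge0.
have a20 : 0 < a / 2 by rewrite divr_gt0.
(* from x0 on, the mixed term is at most a quarter of hu^2 + hv^2 *)
pose x0 := Num.max 1 ((4 * kap) `^ (a / 2)^-1).
have x01 : 1 <= x0 by rewrite le_max lexx.
have x0p : 0 < x0 := lt_le_trans ltr01 x01.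
have small x : x0 <= x -> 4 * kap * x `^ (- (a / 2)) <= 1.
  move=> xx; have xp := lt_le_trans x0p xx.
  rewrite powRN ler_pdivrMr ?powR_gt0// mul1r.
  have -> : 4 * kap = ((4 * kap) `^ (a / 2)^-1) `^ (a / 2).
    by rewrite -powRrM mulVf ?gt_eqF// powRr1// mulr_ge0.
  rewrite ge0_ler_powR ?nnegrE ?powR_ge0 ?(ltW a20) ?(ltW xp)//.
  by apply: le_trans xx; rewrite le_max lexx orbT.
pose q x := hu x ^+ 2 + hv x ^+ 2.
have q0 x : 0 <= q x by rewrite addr_ge0 ?sqr_ge0.
have uvq x : `|hu x * hv x| <= q x / 2.
  have := sqr_ge0 (hu x - hv x); have := sqr_ge0 (hu x + hv x).
  by rewrite ler_norml /q; move=> h1 h2; apply/andP; split; nra.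
have Qq x : x0 <= x -> `|Q x - q x| <= q x / 4.
  move=> xx; rewrite /Q /q addrAC subrr add0r -mulrA normrM ger0_norm; last first.
    by rewrite !mulr_ge0 ?powR_ge0.
  have := small _ xx; have := uvq x; rewrite -/(q x).
  have := powR_ge0 x (- (a / 2)); set T := x `^ _ => T0.
  have := normr_ge0 (hu x * hv x); set U := `|_| => U0 Uq Tk.
  have := q0 x => qq.
  have : (2 * kap * T) * U <= 2^-1 * (q x / 2) by apply: ler_pM => //; [rewrite !mulr_ge0|lra].
  lra.
have Qlo x : x0 <= x -> 3 / 4 * q x <= Q x.
  by move=> /Qq; rewrite ler_norml => /andP[h1 h2]; lra.
have Qhi x : x0 <= x -> Q x <= 5 / 4 * q x.
  by move=> /Qq; rewrite ler_norml => /andP[h1 h2]; lra.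
pose D x := a * kap * x `^ (- (a / 2) - 1).
have D0 x : 0 <= D x by rewrite !mulr_ge0 ?powR_ge0 ?(ltW a0).
have dQ x : x0 <= x -> `|- (a * kap * x `^ (- (a / 2) - 1) * hu x * hv x)| <= D x * Q x.
  move=> xx; rewrite normrN -mulrA normrM -/(D x) ger0_norm// ler_wpM2l//.
  by have := uvq x; have := Qlo _ xx; have := q0 x; lra.
pose P e x := expR (e * (2 * kap * x `^ (- (a / 2)))).
have P0 e x : 0 < P e x by exact: expR_gt0.
have dP e (x : R) : 0 < x -> is_derive x 1 (P e) (- e * D x * P e x).
  move=> xp; have h3 := is_derive1_powR (- (a / 2)) xp.
  have h4 : is_derive x 1 (expR \o (fun x => e * (2 * kap * x `^ (- (a / 2)))))
     (P e x * (e * (2 * kap * (- (a / 2) * x `^ (- (a / 2) - 1))))).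
    by apply: is_derive1_comp; apply: is_derive_eq; rewrite /GRing.scale/=; ring.
  by apply: is_derive_eq; rewrite /D; field.
have dQP e (x : R) : 0 < x -> is_derive x 1 (fun t => Q t * P e t)
    ((- (a * kap * x `^ (- (a / 2) - 1) * hu x * hv x) - e * D x * Q x) * P e x).
  move=> tp; have h1 := is_derive_Q tp; have h2 := dP e _ tp.
  by apply: is_derive_eq; rewrite /GRing.scale/=; ring.
have up x : x0 <= x -> Q x * P 1 x <= Q x0 * P 1 x0.
  move=> xx; apply: (@deriv_le0_ge _ (fun t => Q t * P 1 t)
    (fun t => (- (a * kap * t `^ (- (a / 2) - 1) * hu t * hv t) - 1 * D t * Q t) * P 1 t) x0 x xx) => t /andP[xt _].
    exact: (dQP 1 t (lt_le_trans x0p xt)).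
  rewrite pmulr_lle0 ?P0// mul1r; have := dQ _ xt; rewrite ler_norml => /andP[_].
  by rewrite subr_le0.
have dn x : x0 <= x -> Q x0 * P (-1) x0 <= Q x * P (-1) x.
  move=> xx; apply: (@deriv_ge0_le _ (fun t => Q t * P (-1) t)
    (fun t => (- (a * kap * t `^ (- (a / 2) - 1) * hu t * hv t) - (-1) * D t * Q t) * P (-1) t) x0 x xx) => t /andP[xt _].
    exact: (dQP (-1) t (lt_le_trans x0p xt)).
  rewrite pmulr_lge0 ?P0// mulN1r mulNr opprK; have := dQ _ xt; rewrite ler_norml => /andP[+ _].
  by rewrite -subr_ge0 opprK.
have e0 x : 0 <= 2 * kap * x `^ (- (a / 2)) by rewrite !mulr_ge0 ?powR_ge0.
have P1 x : 1 <= P 1 x.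
  by rewrite /P mul1r; apply: le_trans (expR_ge1Dx _); rewrite lerDl.
have Pm x : P (-1) x <= 1 by rewrite expR_le1 mulN1r oppr_le0.
have Q0 x : x0 <= x -> 0 <= Q x.
  by move=> /Qlo; apply: le_trans; rewrite mulr_ge0.
have Q00 : 0 < Q x0.
  apply: lt_le_trans (Qlo _ (lexx _)); rewrite mulr_gt0 ?divr_gt0//.
  have -> : q x0 = (x0 `^ kap) ^+ 2 * (hK x0 ^+ 2 + hL x0 ^+ 2).
    by rewrite /q /hu /hv; ring.
  by rewrite mulr_gt0 ?exprn_gt0 ?powR_gt0// hE_gt0.
clear dQP dP; exists x0, (4 / 5 * (Q x0 * P (-1) x0)), (4 / 3 * (Q x0 * P 1 x0)); split => //.
  by rewrite mulr_gt0 ?divr_gt0// mulr_gt0.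
move=> x xx; rewrite -/(q x); apply/andP; split.
- have : Q x * P (-1) x <= Q x by rewrite ler_piMr ?Q0.
  by move=> H; exact: (amplitude_low (le_trans (dn _ xx) H) (Qhi _ xx)).
- have : Q x <= Q x * P 1 x by rewrite ler_peMr ?Q0.
  by move=> H; exact: (amplitude_high (Qlo _ xx) (le_trans H (up _ xx))).
Qed.

Definition hPhi (x : R) : R := - (x `^ kap * hv x).

Lemma is_derive_hPhi (x : R) : 0 < x -> is_derive x 1 hPhi (hK x * x `^ (dim - 1)).
Proof.
move=> x0; have h1 := is_derive_hv x0; have h3 := is_derive1_powR kap x0.
rewrite /hPhi; apply: is_derive_eq; rewrite /GRing.scale/=.
rewrite (powRB (r := kap)) ?(gt_eqF x0) ?implybT// powRr1 ?(ltW x0)//.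
rewrite /hu /sp.
have -> : x `^ (dim - 1) = x `^ kap * x `^ kap * x `^ (a / 2 - 1).
  by rewrite -!powRDp// dimE; congr powR; ring.
by field; rewrite gt_eqF.
Qed.

(** The trivial bound for the primitive [hPhi] would be [x^dim]; the gain comes
    from the oscillation of the kernel. *)
Lemma hPhi_bound : exists2 M : R, 0 < M & forall x, 0 < x -> `|hPhi x| <= M * x `^ kap.
Proof.
have [x0 [c [C [x01 c0 H]]]] := kernel_amplitude.
have x0p : 0 < x0 := lt_le_trans ltr01 x01.
have C0 : 0 <= C.
  by have /andP[h1 h2] := H x0 (lexx _); rewrite (le_trans (ltW c0))// (le_trans h1).
exists (C + 1 + x0 `^ kap) => [|x xp]; first by rewrite ltr_pwDl ?powR_ge0// ltr_wpDl.
rewrite /hPhi normrN normrM ger0_norm ?powR_ge0// mulrC ler_wpM2r ?powR_ge0//.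
case: (leP x0 x) => xx.
  have /andP[_ h2] := H x xx.
  have v2 : hv x ^+ 2 <= C by apply: le_trans h2; rewrite lerDr sqr_ge0.
  apply: (@le_trans _ _ (C + 1)); last by rewrite lerDl powR_ge0.
  by rewrite ler_norml; apply/andP; split; move: v2; rewrite expr2; nra.
apply: (@le_trans _ _ (x0 `^ kap)); last by rewrite lerDr addr_ge0.
rewrite /hv normrM ger0_norm ?powR_ge0//.
apply: (@le_trans _ _ (x `^ kap)); first by rewrite ler_piMr ?powR_ge0 ?hL_le1.
by rewrite ge0_ler_powR ?nnegrE ?kap_ge0 ?ltW.
Qed.

End HankelKernel.

(** * Riemann-Stieltjes integrals against variation functions *)

Section RiemannStieltjes.
Context {R : realType}.
Notation mu := (@lebesgue_measure R).
Notation Rp := (`](0 : R), +oo[%classic).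
Implicit Types (w V J f : R -> R) (a b : R).

Lemma fine_partition a b (d : R) : a < b -> 0 < d -> exists s : seq R,
  itv_partition a b s /\
  forall n, (n < size s)%N -> nth b (a :: s) n.+1 - nth b (a :: s) n < d.
Proof.
move=> ab d0; set N := (Num.truncn ((b - a) / d)).+1.
have N0 : 0 < N%:R :> R by rewrite ltr0n.
pose t i : R := a + (b - a) * i%:R / N%:R.
have t0 : t 0%N = a by rewrite /t mulr0 mul0r addr0.
have tN : t N = b by rewrite /t mulfK ?gt_eqF// addrC subrK.
have tS i : t i.+1 - t i = (b - a) / N%:R.
  by rewrite /t -natr1; field; rewrite gt_eqF.
pose s := mkseq (fun i => t i.+1) N.
have ss : size s = N by rewrite size_mkseq.
have nt i : (i <= N)%N -> nth b (a :: s) i = t i.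
  by case: i => [|i] iN //=; rewrite nth_mkseq.
exists s; split.
  split.
    apply/(pathP b) => i; rewrite ss => iN.
    rewrite nth_mkseq// nt; last exact: ltnW.
    by rewrite -subr_gt0 tS divr_gt0 ?subr_gt0.
  by rewrite (last_nth b) ss nt// tN.
move=> n; rewrite ss => nN; rewrite !nt//; last exact: ltnW.
rewrite tS ltr_pdivrMr// mulrC -ltr_pdivrMr//.
exact: truncnS_gt.
Qed.

(** Two candidates are compared along a partition that is fine enough for
    both. *)
Lemma RS_integral_unique w V a b (I1 I2 : R) : a < b ->
  is_RS_integral w V a b I1 -> is_RS_integral w V a b I2 -> I1 = I2.
Proof.
move=> ab h1 h2; apply/eqP; rewrite -subr_eq0 -normr_le0; apply/ler_addgt0Pr => e e0.
rewrite add0r; have e2 : 0 < e / 2 by rewrite divr_gt0.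
have [d1 d10 H1] := h1 _ e2; have [d2 d20 H2] := h2 _ e2.
have [|s [ps Hs]] := @fine_partition a b (Num.min d1 d2) ab; first by rewrite lt_min d10.
pose xi := nth b (a :: s).
have tt n : (n < size s)%N -> nth b (a :: s) n <= nth b (a :: s) n.+1.
  move=> ns; case: ps => /(pathP b) /(_ n ns) H _; apply: ltW.
  by [].
have := H1 s xi ps; have := H2 s xi ps.
move=> /(_ _)-K2 /(_ _)-K1.
have {}K1 : `|RS_sum w V a b s xi - I1| < e / 2.
  by apply: K1 => n ns; split; rewrite ?tt ?lexx//; have := Hs n ns; rewrite lt_min => /andP[].
have {}K2 : `|RS_sum w V a b s xi - I2| < e / 2.
  by apply: K2 => n ns; split; rewrite ?tt ?lexx//; have := Hs n ns; rewrite lt_min => /andP[].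
have -> : I1 - I2 = (RS_sum w V a b s xi - I2) - (RS_sum w V a b s xi - I1) by ring.
by rewrite (le_trans (ler_normB _ _))// (splitr e) lerD// ltW.
Qed.

Lemma RS_integralE w V a b (I : R) : a < b -> is_RS_integral w V a b I ->
  RS_integral w V a b = I.
Proof.
move=> ab h; apply: (RS_integral_unique ab) (h).
by apply: (@xgetPex _ 0 (is_RS_integral w V a b)); exists I.
Qed.

(** Integration by parts: [J] stands for the integral of [V] with respect to
    [w], of which only the comparison on intervals is used. On each piece of a
    partition, the term of the sum differs from the increment of [w V - J] by
    at most the increment of [w] times that of [V]. *)
Lemma RS_of_primitive w V J a b (M : R) : a <= b -> 0 <= M ->
  (forall x y, a <= x -> x <= y -> y <= b -> V x <= V y) ->
  (forall x y, a <= x -> x <= y -> y <= b -> 0 <= w y - w x <= M * (y - x)) ->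
  (forall x y, a <= x -> x <= y -> y <= b ->
    V x * (w y - w x) <= J y - J x <= V y * (w y - w x)) ->
  is_RS_integral w V a b ((w b * V b - J b) - (w a * V a - J a)).
Proof.
move=> ab M0 ndV wM JV e e0.
have VB : 0 <= V b - V a by rewrite subr_ge0 ndV.
(* the denominator is increased by 1 since V may be constant *)
pose d := e / (M * (V b - V a) + 1).
have MV : 0 < M * (V b - V a) + 1 by rewrite ltr_wpDl// mulr_ge0.
exists d; first by rewrite divr_gt0.
move=> s xi t ps Hs.
have ts : t (size s) = b by rewrite /t (itv_partition_nth_size _ ps).
have t0 : t 0%N = a by [].
have tge n : (n <= size s)%N -> a <= t n by move=> ns; exact: itv_partition_nth_ge ps.
have tle n : (n <= size s)%N -> t n <= b by move=> ns; exact: itv_partition_nth_le ps.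
pose G x := w x * V x - J x.
have -> : w b * V b - J b - (w a * V a - J a) =
    \sum_(0 <= n < size s) (G (t n.+1) - G (t n)).
  by rewrite telescope_sumr// ts.
rewrite /RS_sum -sumrB.
have step n : (n < size s)%N ->
    `|w (xi n) * (V (t n.+1) - V (t n)) - (G (t n.+1) - G (t n))|
    <= M * d * (V (t n.+1) - V (t n)).
  move=> ns; have [h1 h2 h3] := Hs n ns.
  have an := tge n (ltnW ns); have bn := tle n.+1 ns.
  have tt : t n <= t n.+1 := le_trans h2 h3.
  have /andP[w0 wd] := wM _ _ an tt bn.
  have /andP[w1 _] := wM _ _ an h2 (le_trans h3 bn).
  have /andP[w2 _] := wM _ _ (le_trans an h2) h3 bn.
  have /andP[j1 j2] := JV _ _ an tt bn.
  have V0 : 0 <= V (t n.+1) - V (t n) by rewrite subr_ge0 ndV.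
  rewrite /G -[t _]/(nth b (a :: s) n.+1).
  have Md : w (t n.+1) - w (t n) <= M * d.
    by apply: (le_trans wd); rewrite ler_wpM2l// ltW.
  rewrite -/(t n) -/(t n.+1) in h1 h2 h3 *.
  move: (w (t n.+1)) (w (t n)) (V (t n.+1)) (V (t n)) (J (t n.+1)) (J (t n)) (w (xi n)) w0 Md w1 w2 j1 j2 V0 => W1 W0 V1 V0' J1 J0 wx.
  move: (M * d) => m {}h1 h2' h3' h4 h5 h6 h7; clear -h1 h2' h3' h4 h5 h6 h7.
  by rewrite ler_norml; apply/andP; split; nra.
apply: (@le_lt_trans _ _ (M * d * (V b - V a))).
  rewrite big_mkord; apply: (le_trans (ler_norm_sum _ _ _)).
  apply: (@le_trans _ _ (\sum_(i < size s) (M * d * (V (t i.+1) - V (t i))))).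
    by apply: ler_sum => i _; exact: step.
  by rewrite -mulr_sumr -(big_mkord xpredT (fun i => V (t i.+1) - V (t i))) telescope_sumr// ts t0.
have -> : M * d * (V b - V a) =
    e * ((M * (V b - V a)) / (M * (V b - V a) + 1)).
  by rewrite /d; field; rewrite gt_eqF.
by rewrite gtr_pMr// ltr_pdivrMr// mul1r ltrDl.
Qed.

(** Both forms of the variation integral are limits of nondecreasing functions,
    used only through this description of the limit as a least upper bound. *)
Lemma nd_cvgy (h : R -> R) r :
  (forall b c, r < b -> b <= c -> h b <= h c) ->
  exists l : \bar R, [/\ (h b)%:E @[b --> +oo] --> l,
    forall b, r < b -> ((h b)%:E <= l)%E &
    forall C : \bar R, (forall b, r < b -> ((h b)%:E <= C)%E) -> (l <= C)%E].
Proof.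
(* h is only monotone beyond r *)
move=> nd; pose g b := (h (Num.max b (r + 1)))%:E.
have rm b : r < Num.max b (r + 1) by rewrite lt_max ltrDl ltr01 orbT.
have gnd : {homo g : n m / n <= m >-> (n <= m)%E}.
  move=> n m nm; rewrite lee_fin nd ?rm// ge_max !le_max lexx nm/= orbT//.
have gc := nondecreasing_cvge gnd.
exists (ereal_sup (range g)); split.
- apply: cvg_trans gc; apply: near_eq_cvg; near=> b.
  rewrite /g max_l//; near: b; exact: nbhs_pinfty_ge.
- move=> b rb; apply: (@le_trans _ _ (g b)).
    by rewrite lee_fin nd// le_max lexx.
  by apply: ereal_sup_ubound; exists b.
- by move=> C HC; apply: ge_ereal_sup => _ [b _ <-]; exact: HC.
Unshelve. all: by end_near. Qed.

Section Variation.
Variable f : R -> R.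
Hypothesis bvf : forall eps b : R, 0 < eps -> bounded_variation eps b f.

Definition tv (r b : R) : R := fine (total_variation r b f).

Lemma tv_fin r b : 0 < r -> r <= b -> total_variation r b f \is a fin_num.
Proof. by move=> r0 rb; apply/bounded_variationP => //; exact: bvf. Qed.

Lemma tv_ge0 r b : r <= b -> 0 <= tv r b.
Proof. by move=> rb; rewrite fine_ge0// total_variation_ge0. Qed.

Lemma tvD r s b : 0 < r -> r <= s -> s <= b -> tv r b = tv r s + tv s b.
Proof.
move=> r0 rs sb; rewrite /tv (total_variationD f rs sb) fineD//.
  exact: tv_fin.
by apply: tv_fin => //; exact: lt_le_trans rs.
Qed.

Lemma tv_ge r b : 0 < r -> r <= b -> `|f b - f r| <= tv r b.
Proof.
by move=> r0 rb; rewrite -lee_fin /tv fineK ?tv_fin// total_variation_ge.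
Qed.

Lemma tvxx r : tv r r = 0. Proof. by rewrite /tv total_variationxx. Qed.

Lemma RS_integral1 (r b : R) : 0 < r -> r < b ->
  RS_integral (fun=> 1) (fun u => fine (total_variation r u f)) r b = tv r b.
Proof.
move=> r0 rb; apply: RS_integralE => //.
have := @RS_of_primitive (fun=> 1) (tv r) (fun=> 0) r b 0 (ltW rb) (lexx _).
rewrite tvxx !mul1r !subr0; apply.
- move=> x y rx xy yb; rewrite (tvD r0 rx xy) lerDl tv_ge0//.
- by move=> x y _ _ _; rewrite subrr mul0r lexx.
- by move=> x y _ _ _; rewrite !subrr !mulr0 lexx.
Qed.

Lemma variation_integral1P (r : R) : 0 < r ->
  (forall b, r <= b -> ((tv r b)%:E <= variation_integral (fun=> 1%R) f r)%E) /\
  (forall C : R, (forall b, r <= b -> tv r b <= C) ->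
    (variation_integral (fun=> 1%R) f r <= C%:E)%E).
Proof.
move=> r0.
have nd b c : r < b -> b <= c -> tv r b <= tv r c.
  by move=> rb bc; rewrite (tvD r0 (ltW rb) bc) lerDl tv_ge0.
have [l [lc l1 l2]] := nd_cvgy nd.
have -> : variation_integral (fun=> 1) f r = l.
  apply/cvg_lim => //; apply: cvg_trans lc; apply: near_eq_cvg; near=> b.
  have rb : r < b by near: b; apply: nbhs_pinfty_gt; exact: num_real.
  by rewrite RS_integral1.
split=> [b|C HC]; last first.
  by apply: l2 => b rb; rewrite lee_fin HC// ltW.
rewrite le_eqVlt => /predU1P[<-|/l1//].
apply: le_trans (l1 (r + 1) _); last by rewrite ltrDl.
by rewrite tvxx lee_fin tv_ge0// lerDl.
Unshelve. all: by end_near. Qed.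

End Variation.

End RiemannStieltjes.

(** * Abel summation for oscillating integrals *)

Section Abel.
Context {R : realType}.
Notation mu := (@lebesgue_measure R).

Lemma integrable_mull (D : set R) (k : R) (f : R -> R) : measurable D ->
  mu.-integrable D (EFin \o f) -> mu.-integrable D (EFin \o (fun t => k * f t)).
Proof.
move=> mD fi; have -> : EFin \o (fun t => k * f t) = (fun t => k%:E * (EFin \o f) t)%E.
  by apply/funext => t /=; rewrite EFinM.
exact: integrableZl.
Qed.

Lemma integrable_subr (D : set R) (f g : R -> R) : measurable D ->
  mu.-integrable D (EFin \o f) -> mu.-integrable D (EFin \o g) ->
  mu.-integrable D (EFin \o (fun t => f t - g t)).
Proof.
move=> mD fi gi; have -> : EFin \o (fun t => f t - g t) =
    (fun t => (EFin \o f) t - (EFin \o g) t)%E by [].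
exact: integrableB.
Qed.

Lemma Rintegral_ftc (F f : R -> R) (a b : R) : a <= b ->
  (forall x, a <= x <= b -> is_derive x 1 F (f x)) ->
  (forall x, a <= x <= b -> {for x, continuous f}) ->
  \int[mu]_(x in `[a, b]) f x = F b - F a.
Proof.
by move=> ab dF cf; rewrite /Rintegral; have -> := integral_ftc ab dF cf.
Qed.

Lemma Rintegral_cat (f : R -> R) (a c b : R) : a <= c -> c <= b ->
  mu.-integrable `[a, b] (EFin \o f) ->
  \int[mu]_(x in `[a, b]) f x =
  \int[mu]_(x in `[a, c]) f x + \int[mu]_(x in `[c, b]) f x.
Proof.
move=> ac cb fi; have := @Rintegral_itvB _ f (BLeft a) (BRight b) c fi.
rewrite !bnd_simp => /(_ ac cb) H.
have fi' : mu.-integrable `]c, b] (EFin \o f).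
  apply: integrableS fi => // x /=; rewrite !in_itv/= => /andP[cx ->].
  by rewrite andbT (le_trans ac)// ltW.
rewrite -(@Rintegral_itv_obnd_cbnd _ c (BRight b) f)//.
by rewrite -H addrC subrK.
Qed.

Lemma bounded_monotone_integrable (g : R -> R) (a b C : R) :
  measurable_fun `[a, b] g -> (forall x, a <= x <= b -> `|g x| <= C) ->
  mu.-integrable `[a, b] (EFin \o g).
Proof.
move=> mg gC; apply: measurable_bounded_integrable => //.
  by rewrite /= lebesgue_measure_itv/=; case: ifPn => _; rewrite ?ltry.
exists C; split; first exact: num_real.
move=> M CM x /=; rewrite in_itv/= => xab.
by apply: le_trans (ltW CM); exact: gC.
Qed.

Lemma cont_bounded (q : R -> R) (a b : R) : a <= b ->
  (forall x, a <= x <= b -> {for x, continuous q}) ->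
  exists2 M : R, 0 <= M & forall x, a <= x <= b -> `|q x| <= M.
Proof.
move=> ab cq.
have [|c cab Hc] := @EVT_max _ (fun x => `|q x|) a b ab.
  apply: continuous_in_subspaceT => x; rewrite inE/= in_itv/= => xab.
  by apply: (cvg_comp q _ (cq x xab)); exact: norm_continuous.
by exists `|q c| => // x xab; apply: Hc; rewrite in_itv/=.
Qed.

Let abel_step (g1 g2 s1 s2 m g0 x i1 i2 : R) :
  g1 * s1 - m * (g0 - g1) <= x + i1 -> g1 * (s2 - s1) - m * (g1 - g2) <= i2 ->
  g2 * s2 <= g1 * s2 -> g2 * s2 - m * (g0 - g2) <= x + (i1 + i2).
Proof. lra. Qed.

Let abel_end (p m g0 g1 x e : R) : p - m * (g0 - g1) <= x -> 0 <= p ->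
  0 <= m * g1 -> m * g0 <= e -> 0 <= x + e.
Proof. lra. Qed.

(** On a fine subdivision, [q] integrates to increments of [S], and summation
    by parts turns the sum of [g * (increment of S)] into a sum of values of
    [S], which are nonnegative, times decrements of [g], which are nonnegative
    too. The error is at most the mesh times [M * g a]. *)
Lemma abel_pos (q S g : R -> R) (a b : R) : a <= b ->
  (forall x, a <= x <= b -> is_derive x 1 S (q x)) ->
  (forall x, a <= x <= b -> {for x, continuous q}) ->
  (forall x, a <= x <= b -> 0 <= S x) ->
  measurable_fun `[a, b] g ->
  (forall x, a <= x <= b -> 0 <= g x) ->
  (forall x y, a <= x -> x <= y -> y <= b -> g y <= g x) ->
  0 <= S a * g a + \int[mu]_(x in `[a, b]) (q x * g x).
Proof.
move=> ab dS cq S0 mg g0 gni.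
have [M M0 qM] := cont_bounded ab cq.
have mq : measurable_fun `[a, b] q.
  apply: subspace_continuous_measurable_fun => //.
  by apply: continuous_in_subspaceT => x; rewrite inE/= in_itv/= => /cq.
have gC x : a <= x <= b -> `|g x| <= g a.
  by move=> /andP[ax xb]; rewrite ger0_norm ?gni ?g0 ?ax.
have ga0 : 0 <= g a by apply: g0; rewrite lexx.
have sub x y : a <= x -> y <= b -> `[x, y] `<=` `[a, b]%classic.
  move=> ax yb z /=; rewrite !in_itv/= => /andP[xz zy].
  by rewrite (le_trans ax xz) (le_trans zy yb).
have iqg x y : a <= x -> y <= b -> mu.-integrable `[x, y] (EFin \o (fun t => q t * g t)).
  move=> ax yb; apply: (@bounded_monotone_integrable _ _ _ (M * g a)).
    by apply: (measurable_funS _ (sub _ _ ax yb)) => //; exact: measurable_funM.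
  move=> z /andP[xz zy]; have zab : a <= z <= b by rewrite (le_trans ax xz) (le_trans zy yb).
  by rewrite normrM ler_pM ?qM ?gC.
have iq x y : a <= x -> y <= b -> mu.-integrable `[x, y] (EFin \o q).
  move=> ax yb; apply: (@bounded_monotone_integrable _ _ _ M).
    by apply: (measurable_funS _ (sub _ _ ax yb)).
  move=> z /andP[xz zy]; apply: qM; by rewrite (le_trans ax xz) (le_trans zy yb).
have step x y : a <= x -> x <= y -> y <= b ->
    g x * (S y - S x) - M * (y - x) * (g x - g y) <= \int[mu]_(t in `[x, y]) (q t * g t).
  move=> ax xy yb.
  have -> : S y - S x = \int[mu]_(t in `[x, y]) q t.
    apply/esym; apply: Rintegral_ftc => // z /andP[xz zy].
      by apply: dS; rewrite (le_trans ax xz) (le_trans zy yb).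
    by apply: cq; rewrite (le_trans ax xz) (le_trans zy yb).
  have igx : mu.-integrable `[x, y] (EFin \o (fun t => g x * q t)).
    by apply: integrable_mull => //; exact: iq.
  rewrite -RintegralZl//; last exact: iq.
  rewrite lerBlDr -lerBlDl -RintegralB//; last exact: iqg.
  apply: (@le_trans _ _ (\int[mu]_(t in `[x, y]) (M * (g x - g y)))).
    apply: le_Rintegral => //.
    - by apply: integrable_subr => //; exact: iqg.
    - by apply: (@bounded_monotone_integrable _ _ _ (`|M * (g x - g y)|)) => //; exact: measurable_cst.
    - move=> t /=; rewrite in_itv/= => /andP[xt ty].
      have tab : a <= t <= b by rewrite (le_trans ax xt) (le_trans ty yb).
      have := qM t tab; rewrite ler_norml => /andP[q1 q2].
      have g1 := gni _ _ ax xt (le_trans ty yb).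
      have g2 := gni _ _ (le_trans ax xt) ty yb.
      rewrite [g x * _]mulrC -mulrBr; apply: (@le_trans _ _ (M * (g x - g t))).
        by rewrite ler_wpM2r// subr_ge0.
      by rewrite ler_wpM2l// lerD2l lerN2.
  rewrite Rintegral_cst//= lebesgue_measure_itv/= lte_fin.
  move: xy; rewrite le_eqVlt => /predU1P[->|xy].
    by rewrite ltxx/= mulr0 subrr mulr0 mul0r.
  by rewrite xy/= mulrAC.
have key N : forall n, (n <= N.+1)%N ->
   let t := a + (b - a) / N.+1%:R * n%:R in
   g t * S t - M * ((b - a) / N.+1%:R) * (g a - g t) <=
     S a * g a + \int[mu]_(x in `[a, t]) (q x * g x).
  set h := (b - a) / N.+1%:R.
  have h0 : 0 <= h by rewrite divr_ge0// subr_ge0.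
  have hN : h * N.+1%:R = b - a by rewrite divfK// pnatr_eq0.
  elim=> [_|n IH nN] /=.
    by rewrite mulr0 addr0 set_itv1 Rintegral_set1 subrr mulr0 subr0 addr0 mulrC.
  have tn : a + h * n%:R <= b.
    by rewrite -lerBrDl -hN ler_wpM2l// ler_nat ltnW.
  have tn1 : a + h * n.+1%:R <= b by rewrite -lerBrDl -hN ler_wpM2l// ler_nat.
  have an : a <= a + h * n%:R by rewrite lerDl mulr_ge0.
  have tt : a + h * n%:R <= a + h * n.+1%:R by rewrite lerD2l ler_wpM2l// ler_nat.
  have {}IH := IH (ltnW nN).
  have st := step _ _ an tt tn1.
  set t := a + h * n%:R in IH st tn an tt *; set t' := a + h * n.+1%:R in st tn1 tt *.
  have htt : t' - t = h by rewrite /t' /t -natr1; ring.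
  have -> : \int[mu]_(x in `[a, t']) (q x * g x) =
     \int[mu]_(x in `[a, t]) (q x * g x) + \int[mu]_(x in `[t, t']) (q x * g x).
    by rewrite -Rintegral_cat//; exact: iqg.
  rewrite htt in st.
  have S1 : 0 <= S t' by apply: S0; rewrite (le_trans an tt).
  have gg := gni _ _ an tt tn1.
  have gS : g t' * S t' <= g t * S t' by rewrite ler_wpM2r.
  exact: abel_step IH st gS.
apply/ler_addgt0Pr => e e0.
(* the number of pieces that makes the total error at most e *)
pose N := Num.truncn (M * (b - a) * g a / e).
have := key N N.+1 (leqnn _) => /=.
rewrite divfK ?pnatr_eq0// (addrC a) subrK => K.
have gb : 0 <= g b by apply: g0; rewrite ab lexx.
have Sb : 0 <= S b by apply: S0; rewrite ab lexx.
have Nb : M * ((b - a) / N.+1%:R) * g a <= e.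
  rewrite -(ler_pM2r (x := N.+1%:R)) ?ltr0n//.
  have -> : M * ((b - a) / N.+1%:R) * g a * N.+1%:R = M * (b - a) * g a.
    by rewrite mulrA [LHS]mulrAC divfK ?pnatr_eq0.
  by rewrite [leRHS]mulrC -ler_pdivrMr// ltW// truncnS_gt.
have h0 : 0 <= M * ((b - a) / N.+1%:R) by rewrite mulr_ge0// divr_ge0// subr_ge0.
exact: abel_end K (mulr_ge0 gb Sb) (mulr_ge0 h0 gb) Nb.
Qed.

(** [abel_pos] for [m' + k] and [m' - k], whose primitives [m + P] and [m - P]
    are nonnegative. *)
Lemma abel_bound (k P m m' g : R -> R) (a b : R) : a <= b ->
  (forall x, a <= x <= b -> is_derive x 1 P (k x)) ->
  (forall x, a <= x <= b -> {for x, continuous k}) ->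
  (forall x, a <= x <= b -> is_derive x 1 m (m' x)) ->
  (forall x, a <= x <= b -> {for x, continuous m'}) ->
  P a = 0 ->
  (forall x, a <= x <= b -> `|P x| <= m x) ->
  measurable_fun `[a, b] g ->
  (forall x, a <= x <= b -> 0 <= g x) ->
  (forall x y, a <= x -> x <= y -> y <= b -> g y <= g x) ->
  `|\int[mu]_(x in `[a, b]) (k x * g x)| <=
    m a * g a + \int[mu]_(x in `[a, b]) (m' x * g x).
Proof.
move=> ab dP ck dm cm' Pa Pm mg g0 gni.
have iprod (q : R -> R) : (forall x, a <= x <= b -> {for x, continuous q}) ->
    mu.-integrable `[a, b] (EFin \o (fun t => q t * g t)).
  move=> cq; have [M M0 qM] := cont_bounded ab cq.
  apply: (@bounded_monotone_integrable _ _ _ (M * g a)).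
    apply: measurable_funM => //; apply: subspace_continuous_measurable_fun => //.
    by apply: continuous_in_subspaceT => x; rewrite inE/= in_itv/= => /cq.
  move=> z zab; rewrite normrM ler_pM ?qM// ger0_norm ?g0//.
  by case/andP: zab => az zb; exact: gni.
have aab : a <= a <= b by rewrite lexx.
have A (e : R) : e = 1 \/ e = -1 ->
   0 <= m a * g a + \int[mu]_(x in `[a, b]) ((m' x + e * k x) * g x).
  move=> ee; have := @abel_pos (fun x => m' x + e * k x) (fun x => m x + e * P x) g a b ab.
  rewrite /= Pa mulr0 addr0; apply => //.
  - by move=> x xab; have h1 := dP _ xab; have h2 := dm _ xab;
      apply: is_derive_eq; rewrite /GRing.scale/=; ring.
  - move=> x xab; apply: continuousD; first exact: cm'.
    by apply: continuousM; [exact: cvg_cst|exact: ck].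
  - move=> x xab; have := Pm _ xab; rewrite ler_norml => /andP[].
    by case: ee => ->; lra.
have split e : \int[mu]_(x in `[a, b]) ((m' x + e * k x) * g x) =
    \int[mu]_(x in `[a, b]) (m' x * g x) + e * \int[mu]_(x in `[a, b]) (k x * g x).
  under eq_Rintegral do rewrite mulrDl -mulrA.
  rewrite RintegralD//; last 2 first.
  - exact: iprod.
  - by apply: integrable_mull => //; exact: iprod.
  by rewrite RintegralZl//; exact: iprod.
have := A 1 (or_introl erefl); have := A (-1) (or_intror erefl).
rewrite !split mul1r mulN1r ler_norml => h1 h2; apply/andP; split; lra.
Qed.

End Abel.

(** * Tails of the variation of a function *)

Section Tail.
Context {R : realType}.
Notation mu := (@lebesgue_measure R).
Variables (f : R -> R) (kappa : R).
Hypothesis bvf : forall eps b : R, 0 < eps -> bounded_variation eps b f.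
Hypothesis f0 : f u @[u --> +oo] --> (0 : R).
Hypothesis k0 : 0 <= kappa.

Let v := tv f 1.

Let v_nd (x y : R) : 1 <= x -> x <= y -> v x <= v y.
Proof.
move=> x1 xy; rewrite /v (tvD bvf (s := x) ltr01 x1 xy) lerDl.
by rewrite tv_ge0.
Qed.

Let v1 : v 1 = 0. Proof. exact: tvxx. Qed.

Let v_ge0 (x : R) : 1 <= x -> 0 <= v x.
Proof. exact: tv_ge0. Qed.

Let w' (r : R) := kappa * r `^ (kappa - 1).

Let w'_ge0 r : 0 <= w' r.
Proof. by rewrite mulr_ge0 ?powR_ge0. Qed.

Let w'_cont (r : R) : 0 < r -> {for r, continuous w'}.
Proof.
by move=> r0; apply: continuousM; [exact: cvg_cst|exact: powR_cont].
Qed.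

Let w_diff (x y : R) : 0 < x -> x <= y -> \int[mu]_(r in `[x, y]) w' r = y `^ kappa - x `^ kappa.
Proof.
move=> x0 xy; apply: (@Rintegral_ftc _ (@powR R ^~ kappa)) => // z /andP[xz _];
  have z0 := lt_le_trans x0 xz.
  exact: is_derive1_powR.
exact: w'_cont.
Qed.

Let measurable_v (x y : R) : 1 <= x -> measurable_fun `[x, y] v.
Proof.
move=> x1; have := @nondecreasing_measurable _ `[x, y] (fun r => v (Num.max r 1)).
have m : measurable (`[x, y]%classic : set R) by [].
move=> /(_ m); have H : nondecreasing_fun (fun r => v (Num.max r 1)).
  move=> r s rs; apply: v_nd; first by rewrite le_max lexx orbT.
  by rewrite ge_max !le_max rs lexx orbT.
move=> /(_ H); apply: eq_measurable_fun => z; rewrite inE/= in_itv/= => /andP[xz _].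
by rewrite max_l// (le_trans x1).
Qed.

Let measurable_w' (D : set R) : measurable_fun D w'.
Proof.
by apply: measurable_funTS; apply: measurable_funM.
Qed.

Let integrable_w' (x y : R) : 0 < x -> mu.-integrable `[x, y] (EFin \o w').
Proof.
move=> x0; apply: cont_integrable => z /andP[xz _]; apply: w'_cont.
exact: lt_le_trans xz.
Qed.

Let integrable_w'v x y : 1 <= x -> mu.-integrable `[x, y] (EFin \o (fun r => w' r * v r)).
Proof.
move=> x1; have x0 : 0 < x := lt_le_trans ltr01 x1.
case: (leP x y) => [xy|yx]; last first.
  by rewrite set_itv_ge ?bnd_simp -?ltNge//; exact: integrable_set0.
have [|M M0 wM] := @cont_bounded _ w' x y xy.
  by move=> z /andP[xz _]; apply: w'_cont; exact: lt_le_trans xz.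
apply: (@bounded_monotone_integrable _ _ _ _ (M * v y)).
  by apply: measurable_funM; [exact: measurable_w'|exact: measurable_v].
move=> z /andP[xz zy]; have z1 := le_trans x1 xz.
by rewrite normrM ler_pM ?wM ?xz// ger0_norm ?v_ge0// v_nd.
Qed.

Let J x := \int[mu]_(r in `[1, x]) (w' r * v r).

Let Jdiff (x y : R) : 1 <= x -> x <= y -> J y - J x = \int[mu]_(r in `[x, y]) (w' r * v r).
Proof.
move=> x1 xy; rewrite /J (@Rintegral_cat _ _ 1 x y)//; first by rewrite addrC addKr.
exact: integrable_w'v.
Qed.

Let Jbound (x y : R) : 1 <= x -> x <= y ->
  v x * (y `^ kappa - x `^ kappa) <= J y - J x <= v y * (y `^ kappa - x `^ kappa).
Proof.
move=> x1 xy; have x0 : 0 < x := lt_le_trans ltr01 x1.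
rewrite Jdiff// -w_diff// -!RintegralZl//; try exact: integrable_w'.
apply/andP; split; apply: le_Rintegral => //; try exact: integrable_w'v;
  try (by apply: integrable_mull => //; exact: integrable_w').
  move=> z /=; rewrite in_itv/= => /andP[xz zy].
  by rewrite mulrC ler_wpM2l ?v_nd.
move=> z /=; rewrite in_itv/= => /andP[xz zy].
by rewrite [leRHS]mulrC ler_wpM2l ?v_nd// (le_trans x1).
Qed.

Let I b := b `^ kappa * v b - J b.

(** Integration by parts, with [I b] the boundary term minus the integral of
    [v] against the derivative [w'] of the power. *)
Lemma RS_integral_powR (b : R) : 1 < b ->
  RS_integral (fun r => r `^ kappa) (fun u => fine (total_variation 1 u f)) 1 b = I b.
Proof.
move=> b1; apply: RS_integralE => //.
have [|M M0 wM] := @cont_bounded _ w' 1 b (ltW b1).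
  by move=> z /andP[xz _]; apply: w'_cont; exact: lt_le_trans xz.
have := @RS_of_primitive _ (@powR R ^~ kappa) v J 1 b M (ltW b1) M0.
rewrite v1 mulr0 /J set_itv1 Rintegral_set1 !subr0; apply.
- by move=> x y x1 xy _; exact: v_nd.
- move=> x y x1 xy yb; have x0 : 0 < x := lt_le_trans ltr01 x1.
  rewrite -w_diff//; apply/andP; split; first exact: Rintegral_ge0.
  apply: (@le_trans _ _ (\int[mu]_(t in `[x, y]) M)).
    apply: le_Rintegral => //; first exact: integrable_w'.
      by apply: (@bounded_monotone_integrable _ _ _ _ `|M|) => //; exact: measurable_cst.
    move=> z /=; rewrite in_itv/= => /andP[xz zy].
    by rewrite (le_trans (ler_norm _))// wM// (le_trans x1)//= (le_trans zy).
  rewrite Rintegral_cst//= lebesgue_measure_itv/= lte_fin.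
  move: xy; rewrite le_eqVlt => /predU1P[->|xy].
    by rewrite ltxx/= mulr0 subrr mulr0.
  by rewrite xy/=.
- by move=> x y x1 xy yb; exact: Jbound.
Qed.

Let I_incr (x y : R) : 1 <= x -> x <= y -> x `^ kappa * (v y - v x) <= I y - I x.
Proof.
move=> x1 xy; have /andP[_] := Jbound x1 xy; rewrite /I.
move: (J x) (J y) (v x) (v y) (x `^ kappa) (y `^ kappa) => *; lra.
Qed.

Let I_nd (x y : R) : 1 <= x -> x <= y -> I x <= I y.
Proof.
move=> x1 xy; rewrite -subr_ge0; apply: le_trans (I_incr x1 xy).
by rewrite mulr_ge0 ?powR_ge0// subr_ge0 v_nd.
Qed.

Lemma variation_integral_powRP : exists l : \bar R,
  [/\ variation_integral (fun r => r `^ kappa) f 1 = l,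
     (I b)%:E @[b --> +oo] --> l,
     forall b, 1 <= b -> ((I b)%:E <= l)%E &
     forall C : R, (forall b, 1 < b -> I b <= C) -> (l <= C%:E)%E].
Proof.
have nd b c : 1 < b -> b <= c -> I b <= I c.
  by move=> b1 bc; apply: I_nd => //; exact: ltW.
have [l [lc l1 l2]] := nd_cvgy nd; exists l; split => //.
- apply/cvg_lim => //; apply: cvg_trans lc; apply: near_eq_cvg; near=> b.
  have rb : 1 < b by near: b; apply: nbhs_pinfty_gt; exact: num_real.
  by rewrite RS_integral_powR.
- move=> b b1; apply: (@le_trans _ _ (I (b + 1))%:E).
    by rewrite lee_fin I_nd// lerDl.
  by apply: l1; rewrite (le_lt_trans b1)// ltrDl.
- by move=> C HC; apply: l2 => b b1; rewrite lee_fin HC.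
Unshelve. all: by end_near. Qed.

Hypothesis fin : (variation_integral (fun r => r `^ kappa)%R f 1 < +oo)%E.

(** [V r] is the variation of [f] beyond [r], and [T a] the integral of
    [r^kappa |df|] beyond [a]. Integrated by parts, the latter bounds a
    boundary term [a^kappa * V a] together with the integral of [V] against the
    derivative of the power; this form of the assumption is what Abel summation
    consumes. *)
Lemma variation_tail : exists V T : R -> R,
  [/\ forall r s, 0 < r -> r <= s -> V r = tv f r s + V s,
      forall r, 0 < r -> `|f r| <= V r,
      forall r, 0 < r -> ((V r)%:E <= variation_integral (fun=> 1%R) f r)%E,
      T r @[r --> +oo] --> (0 : R) &
      forall a b, 1 <= a -> a <= b ->
        a `^ kappa * V a + \int[mu]_(r in `[a, b]) (w' r * V r) <= T a].
Proof.
have [l [lE lc l1 _]] := variation_integral_powRP.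
have lfin : l \is a fin_num.
  rewrite fin_real// -[(l < +oo)%E]/(l < +oo)%E -{2}lE fin andbT.
  by apply: lt_le_trans (l1 1 (lexx _)); rewrite ltNyr.
set W := fine l.
have IW b : 1 <= b -> I b <= W by move=> b1; rewrite -lee_fin fineK// l1.
have I1 : I 1 = 0 by rewrite /I v1 mulr0 /J set_itv1 Rintegral_set1 subrr.
have vW b : 1 <= b -> v b <= W.
  move=> b1; apply: le_trans (IW b b1).
  by have := I_incr (lexx 1) b1; rewrite powR1 mul1r v1 I1 !subr0.
pose S := [set v b | b in `[1, +oo[].
have S0 : S !=set0 by exists (v 1), 1 => //=; rewrite in_itv/= lexx.
have hS : has_sup S.
  split => //; exists W => y [b /=]; rewrite in_itv/= andbT => b1 <-; exact: vW.
pose V1 := sup S.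
have vV b : 1 <= b -> v b <= V1.
  by move=> b1; apply: sup_ubound; [case: hS|exists b => //=; rewrite in_itv/= b1].
have V1ub C : (forall b, 1 <= b -> v b <= C) -> V1 <= C.
  move=> HC; apply: ge_sup => // y [b /=]; rewrite in_itv/= andbT => b1 <-; exact: HC.
pose V r := if 1 <= r then V1 - v r else V1 + tv f r 1.
have VD r s : 0 < r -> r <= s -> V r = tv f r s + V s.
  move=> r0 rs; rewrite /V; case: (leP 1 r) => r1; case: (leP 1 s) => s1.
  - by rewrite /v (tvD bvf ltr01 r1 rs); ring.
  - by have := lt_le_trans s1 r1; rewrite ltNge rs.
  - by rewrite (tvD bvf r0 (ltW r1) s1) -/(v s); ring.
  - by rewrite (tvD bvf r0 rs (ltW s1)); ring.
have V_ge0 r : 0 <= V r.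
  rewrite /V; case: (leP 1 r) => r1; first by rewrite subr_ge0 vV.
  by rewrite addr_ge0 ?tv_ge0 ?(ltW r1)// (le_trans _ (vV 1 (lexx _))) ?v1.
have Vsmall e : 0 < e -> exists2 b, 1 <= b & V b < e.
  move=> e0; have [_ [b /= + <-]] := sup_adherent e0 hS; rewrite in_itv/= andbT => b1 vb.
  by exists b => //; rewrite /V b1; move: vb; rewrite -/V1; lra.
have V_ni r s : 0 < r -> r <= s -> V s <= V r.
  by move=> r0 rs; rewrite (VD _ _ r0 rs) lerDr tv_ge0.
exists V, (fun a => W - I a); split => //.
- move=> r r0; have c1 : (`|f b - f r|) @[b --> +oo] --> `|0 - f r|.
    by apply: cvg_norm; apply: cvgB => //; exact: cvg_cst.
  rewrite sub0r normrN in c1; apply: (cvgr_to_le c1); near=> b.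
  have rb : r <= b by near: b; apply: nbhs_pinfty_ge; exact: num_real.
  by rewrite (le_trans (tv_ge bvf r0 rb))// (VD _ _ r0 rb) lerDl.
- move=> r r0; have [H _] := variation_integral1P bvf r0.
  apply/lee_addgt0Pr => e e0; have [b b1 Vb] := Vsmall e e0.
  set s := Num.max r b; have rs : r <= s by rewrite le_max lexx.
  have bs : b <= s by rewrite le_max lexx orbT.
  rewrite (VD _ _ r0 rs) EFinD leeD ?H// lee_fin.
  by rewrite (le_trans _ (ltW Vb))// V_ni// (lt_le_trans ltr01).
- rewrite -(subrr W); apply: cvgB; first exact: cvg_cst.
  by have /fine_cvg : (I b)%:E @[b --> +oo] --> W%:E by rewrite fineK.
- move=> a b a1 ab; have b1 := le_trans a1 ab.
  have a0 : 0 < a := lt_le_trans ltr01 a1.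
  have -> : \int[mu]_(r in `[a, b]) (w' r * V r) =
      V1 * (b `^ kappa - a `^ kappa) - (J b - J a).
    rewrite Jdiff// -w_diff// -RintegralZl//; last exact: integrable_w'.
    rewrite -RintegralB//; last 2 first.
    - by apply: integrable_mull => //; exact: integrable_w'.
    - exact: integrable_w'v.
    apply: eq_Rintegral => z; rewrite inE/= in_itv/= => /andP[az _].
    by rewrite /V (le_trans a1 az); ring.
  have Vb : b `^ kappa * V b <= W - I b.
    have bk : 0 < b `^ kappa by rewrite powR_gt0// (lt_le_trans ltr01).
    rewrite /V b1 -ler_pdivlMl// lerBlDr; apply: V1ub => c c1.
    case: (leP b c) => bc; last first.
      rewrite (le_trans (v_nd c1 (ltW bc)))// lerDr mulr_ge0 ?invr_ge0 ?(ltW bk)//.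
      by rewrite subr_ge0 IW.
    rewrite -lerBlDr ler_pdivlMl//; apply: (le_trans (I_incr b1 bc)).
    by rewrite lerD2r IW.
  move: Vb; rewrite /V a1 b1 /I.
  move: (J a) (J b) (v a) (v b) (a `^ kappa) (b `^ kappa) => *; lra.
Unshelve. all: by end_near. Qed.

End Tail.

(** * The transform as an improper integral *)

Section HankelTransform.
Context {R : realType}.
Notation mu := (@lebesgue_measure R).
Notation Rp := (`](0 : R), +oo[%classic).

Lemma measurable_ni_Rp (g : R -> R) :
  (forall x y, 0 < x -> x <= y -> g y <= g x) -> measurable_fun Rp g.
Proof.
move=> gni; have mD : measurable Rp by exact: measurable_itv.
apply: (measurability (@RGenCInfty.G R)) => [|/= _ [_] [r] -> <-].
  exact: RGenCInfty.measurableE.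
apply: is_interval_measurable => s t/=.
rewrite !in_itv/= !andbT => -[s0 fs] [t0 ft] u /andP[su ut].
have u0 := lt_le_trans s0 su.
by rewrite !in_itv/= !andbT; split => //; rewrite (le_trans ft)// gni.
Qed.

Lemma integrable_cont_mono (q g : R -> R) (x y : R) : 0 < x ->
  (forall z, x <= z <= y -> {for z, continuous q}) -> measurable_fun Rp g ->
  (forall z, 0 < z -> 0 <= g z) ->
  (forall z w, 0 < z -> z <= w -> g w <= g z) ->
  mu.-integrable `[x, y] (EFin \o (fun r => q r * g r)).
Proof.
move=> x0 cq mg g0 gni; case: (leP x y) => [xy|yx]; last first.
  by rewrite set_itv_ge ?bnd_simp -?ltNge//; exact: integrable_set0.
have [M M0 qM] := cont_bounded xy cq.
apply: (@bounded_monotone_integrable _ _ _ _ (M * g x)).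
  apply: measurable_funM.
    apply: subspace_continuous_measurable_fun => //.
    by apply: continuous_in_subspaceT => z; rewrite inE/= in_itv/= => /cq.
  apply: measurable_funS mg => // z /=; rewrite !in_itv/= andbT => /andP[xz _].
  exact: lt_le_trans xz.
move=> z /andP[xz zy]; rewrite normrM ler_pM ?qM ?xz//.
by rewrite ger0_norm ?gni ?g0// (lt_le_trans x0).
Qed.

Variables (a lam : R).
Hypothesis a0 : 0 < a.
Hypothesis hlam : 0 <= 4 * lam + a.
Notation kap := (kap a lam).
Notation dim := (dim a lam).
Notation hK := (hK a lam).
Notation hPhi := (hPhi a lam).

Lemma nu_constE : nu_const lam a = (fine (gauss_moment a dim))^-1.
Proof. by []. Qed.

Lemma nu_const_gt0 : 0 < nu_const lam a.
Proof.
rewrite nu_constE invr_gt0 fine_gt0// gauss_moment_gt0 ?gauss_moment_lty ?dim_gt0//.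
Qed.

Definition hker (rho r : R) : R := hK (rho * r) * r `^ (dim - 1).

Definition hprim (rho r : R) : R := rho `^ (- dim) * hPhi (rho * r).

(** By homogeneity, the primitive of the kernel at frequency [rho] is a
    dilation of [hPhi]. *)
Lemma is_derive_hprim (rho r : R) : 0 < rho -> 0 < r ->
  is_derive r 1 (hprim rho) (hker rho r).
Proof.
move=> rho0 r0; have x0 : 0 < rho * r by rewrite mulr_gt0.
have h := is_derive_hPhi a0 hlam x0.
have h2 : is_derive r 1 (hPhi \o ( *%R rho)) (hK (rho * r) * (rho * r) `^ (dim - 1) * rho).
  apply: is_derive1_comp; apply: is_derive_eq; rewrite /GRing.scale/=.
  by rewrite mulr1.
rewrite /hprim; apply: is_derive_eq; rewrite /GRing.scale/= /hker.
rewrite powRM ?(ltW rho0) ?(ltW r0)//.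
have -> : rho `^ (- dim) * (hK (rho * r) * (rho `^ (dim - 1) * r `^ (dim - 1)) * rho) =
  hK (rho * r) * r `^ (dim - 1) * (rho `^ (- dim) * rho `^ (dim - 1) * rho `^ 1).
  by rewrite powRr1 ?(ltW rho0)//; ring.
rewrite -!powRDp//.
by rewrite (_ : - dim + (dim - 1) + 1 = 0) ?powRr0 ?mulr1//; ring.
Qed.

Lemma hker_cont (rho r : R) : 0 < rho -> 0 < r -> {for r, continuous (hker rho)}.
Proof.
move=> rho0 r0; apply: continuousM; last exact: powR_cont.
have x0 : 0 < rho * r by rewrite mulr_gt0.
have h := is_derive_hK a0 hlam x0.
have : is_derive r 1 (hK \o ( *%R rho)) (sp a (rho * r) * hL a lam (rho * r) * rho).
  apply: is_derive1_comp; apply: is_derive_eq; rewrite /GRing.scale/=.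
  by rewrite mulr1.
exact: is_derive_cont.
Qed.

Lemma measurable_hker2 : measurable_fun setT (fun z : R * R => hker z.1 z.2).
Proof.
apply: measurable_funM.
  apply: (measurableT_comp (measurable_hK a0 hlam)); exact: measurable_funM.
apply: (measurableT_comp (measurable_powR (dim - 1))); exact: measurable_snd.
Qed.

Lemma measurable_hker (rho : R) (D : set R) : measurable_fun D (hker rho).
Proof.
apply: measurable_funTS; apply: measurable_funM; last exact: measurable_powR.
by apply: (measurableT_comp (measurable_hK a0 hlam)); exact: measurable_funM.
Qed.

Lemma hker_le (rho r : R) : 0 < rho -> 0 < r -> `|hker rho r| <= r `^ (dim - 1).
Proof.
move=> rho0 r0; rewrite normrM [X in _ * X]ger0_norm ?powR_ge0//.
by rewrite ler_piMl ?powR_ge0// hK_le1// mulr_gt0.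
Qed.

(* V and T are used through the properties that variation_tail provides *)
Variables (f : R -> R) (V T : R -> R).
Hypothesis VD : forall r s, 0 < r -> r <= s -> `|f s - f r| <= V r - V s.
Hypothesis fV : forall r, 0 < r -> `|f r| <= V r.
Hypothesis T0 : T r @[r --> +oo] --> (0 : R).
Hypothesis VT : forall x y, 1 <= x -> x <= y ->
  x `^ kap * V x + \int[mu]_(r in `[x, y]) (kap * r `^ (kap - 1) * V r) <= T x.
Hypothesis f01 :
  (\int[mu]_(r in `]0%R, 1%R]) (r `^ (dim - 1) * `|f r|)%:E < +oo)%E.

(* f is the difference of the nonincreasing functions gp and gm, and V is
   their sum *)
Let gp r := (V r + f r) / 2.
Let gm r := (V r - f r) / 2.

Lemma V_ni x y : 0 < x -> x <= y -> V y <= V x.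
Proof. by move=> x0 xy; rewrite -subr_ge0 (le_trans _ (VD x0 xy)). Qed.

Lemma V_ge0 x : 0 < x -> 0 <= V x.
Proof. by move=> /fV; apply: le_trans. Qed.

Let gp_ni x y : 0 < x -> x <= y -> gp y <= gp x.
Proof. by move=> x0 xy; have := VD x0 xy; rewrite ler_norml /gp => /andP[]; lra. Qed.

Let gm_ni x y : 0 < x -> x <= y -> gm y <= gm x.
Proof. by move=> x0 xy; have := VD x0 xy; rewrite ler_norml /gm => /andP[]; lra. Qed.

Let gp_ge0 x : 0 < x -> 0 <= gp x.
Proof. by move=> /fV; rewrite ler_norml /gp => /andP[]; lra. Qed.

Let gm_ge0 x : 0 < x -> 0 <= gm x.
Proof. by move=> /fV; rewrite ler_norml /gm => /andP[]; lra. Qed.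

Lemma measurable_V : measurable_fun Rp V.
Proof. by apply: measurable_ni_Rp; exact: V_ni. Qed.

Lemma measurable_f : measurable_fun Rp f.
Proof.
have : measurable_fun Rp (fun r => gp r - gm r).
  by apply: measurable_funB; apply: measurable_ni_Rp; [exact: gp_ni|exact: gm_ni].
by apply: eq_measurable_fun => r _; rewrite /gp /gm; field.
Qed.

Let sub_Rp (x y : R) : 0 < x -> `[x, y] `<=` Rp.
Proof. by move=> x0 z /=; rewrite !in_itv/= andbT => /andP[xz _]; exact: lt_le_trans xz. Qed.

Let mcc (x y : R) (g : R -> R) : 0 < x -> measurable_fun Rp g -> measurable_fun `[x, y] g.
Proof. by move=> x0; apply: measurable_funS => //; exact: sub_Rp. Qed.

Lemma integrable_fk (rho x y : R) : 0 < rho -> 0 < x ->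
  mu.-integrable `[x, y] (EFin \o (fun r => f r * hker rho r)).
Proof.
move=> rho0 x0; case: (leP x y) => [xy|yx]; last first.
  by rewrite set_itv_ge ?bnd_simp -?ltNge//; exact: integrable_set0.
have [|M M0 kM] := @cont_bounded _ (hker rho) x y xy.
  by move=> z /andP[xz _]; apply: hker_cont => //; exact: lt_le_trans xz.
apply: (@bounded_monotone_integrable _ _ _ _ (V x * M)).
  by apply: measurable_funM; [apply: mcc => //; exact: measurable_f|exact: measurable_hker].
move=> z /andP[xz zy]; rewrite normrM ler_pM ?kM ?xz//.
by rewrite (le_trans (fV (lt_le_trans x0 xz)))// V_ni.
Qed.

Definition hint (rho x y : R) : R := \int[mu]_(r in `[x, y]) (f r * hker rho r).

Lemma hint_cat (rho x y z : R) : 0 < rho -> 0 < x -> x <= y -> y <= z ->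
  hint rho x z = hint rho x y + hint rho y z.
Proof. by move=> rho0 x0 xy yz; apply: Rintegral_cat => //; exact: integrable_fk. Qed.

Lemma hankel_integrand (rho x y : R) : 0 < rho -> 0 < x ->
  \int[mu]_(r in `[x, y]) (f r * besselj (2 * lam / a) (2 / a * (rho * r) `^ (a / 2))
     * nu_density lam a r) = nu_const lam a * hint rho x y.
Proof.
move=> rho0 x0; rewrite /hint -RintegralZl//; last exact: integrable_fk.
apply: eq_Rintegral => r; rewrite inE/= in_itv/= => /andP[xr _].
have r0 := lt_le_trans x0 xr.
by rewrite besselj_hK// ?mulr_gt0// /nu_density /hker; ring.
Qed.

Let M := sval (cid2 (hPhi_bound a0 hlam)).
Let M0 : 0 < M. Proof. by rewrite /M; case: cid2. Qed.
Let MP x : 0 < x -> `|hPhi x| <= M * x `^ kap.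
Proof. by rewrite /M; case: cid2 => /= m m0 H; exact: H. Qed.

(** Abel summation for the nonincreasing parts [gp] and [gm] of [f]. The
    primitive of the kernel has to vanish at [x], whence the factor [2] in
    front of its bound. *)
Lemma hint_tail (rho x y : R) : 0 < rho -> 0 < x -> x <= y ->
  `|hint rho x y| <= 2 * M * rho `^ (kap - dim) *
    (x `^ kap * V x + \int[mu]_(r in `[x, y]) (kap * r `^ (kap - 1) * V r)).
Proof.
move=> rho0 x0 xy.
pose c := 2 * M * rho `^ (kap - dim).
have c0 : 0 <= c by rewrite !mulr_ge0 ?powR_ge0 ?(ltW M0).
pose m r := c * r `^ kap; pose m' r := c * (kap * r `^ (kap - 1)).
have bound (g : R -> R) : measurable_fun Rp g -> (forall z, 0 < z -> 0 <= g z) ->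
   (forall z w, 0 < z -> z <= w -> g w <= g z) ->
   `|\int[mu]_(r in `[x, y]) (hker rho r * g r)| <=
     m x * g x + \int[mu]_(r in `[x, y]) (m' r * g r).
  move=> mg g0 gni.
  have pos z : x <= z <= y -> 0 < z by move=> /andP[xz _]; exact: lt_le_trans xz.
  apply: (@abel_bound _ (hker rho) (fun r => hprim rho r - hprim rho x) m m' g x y xy).
  - move=> z /pos z0; have h := is_derive_hprim rho0 z0.
    by apply: is_derive_eq; rewrite subr0.
  - by move=> z /pos z0; exact: hker_cont.
  - move=> z /pos z0; have h := is_derive1_powR kap z0.
    by apply: is_derive_eq.
  - move=> z /pos z0; apply: continuousM; first exact: cvg_cst.
    by apply: continuousM; [exact: cvg_cst|exact: powR_cont].
  - by rewrite subrr.
  - move=> z /andP[xz zy]; have z0 := lt_le_trans x0 xz.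
    have b w : 0 < w -> `|hprim rho w| <= M * rho `^ (kap - dim) * w `^ kap.
      move=> w0; rewrite /hprim normrM ger0_norm ?powR_ge0//.
      rewrite (le_trans (ler_wpM2l (powR_ge0 _ _) (MP (mulr_gt0 rho0 w0))))//.
      rewrite powRM ?(ltW rho0) ?(ltW w0)// powRDp//.
      by apply: le_of_eq; ring.
    rewrite (le_trans (ler_normB _ _))// (le_trans (lerD (b _ z0) (b _ x0)))//.
    have xk : x `^ kap <= z `^ kap.
      by rewrite ge0_ler_powR ?nnegrE ?(kap_ge0 hlam) ?(ltW x0) ?(ltW z0).
    have h0 : 0 <= M * rho `^ (kap - dim) by rewrite mulr_ge0 ?powR_ge0 ?ltW.
    have := ler_wpM2l h0 xk; rewrite /m /c; lra.
  - exact: mcc.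
  - by move=> z /pos; exact: g0.
  - by move=> z w xz zw _; apply: gni => //; exact: lt_le_trans xz.
have m'c z : x <= z <= y -> {for z, continuous m'}.
  move=> /andP[xz _]; apply: continuousM; first exact: cvg_cst.
  apply: continuousM; first exact: cvg_cst.
  by apply: powR_cont; exact: lt_le_trans xz.
have kc z : x <= z <= y -> {for z, continuous (hker rho)}.
  by move=> /andP[xz _]; apply: hker_cont => //; exact: lt_le_trans xz.
have mgp := measurable_ni_Rp gp_ni; have mgm := measurable_ni_Rp gm_ni.
have -> : hint rho x y = \int[mu]_(r in `[x, y]) (hker rho r * gp r) -
    \int[mu]_(r in `[x, y]) (hker rho r * gm r).
  rewrite -RintegralB//.
  - by apply: eq_Rintegral => r _; rewrite /gp /gm; field.
  - by apply: integrable_cont_mono.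
  - by apply: integrable_cont_mono.
rewrite (le_trans (ler_normB _ _))//.
rewrite (le_trans (lerD (bound _ mgp gp_ge0 gp_ni) (bound _ mgm gm_ge0 gm_ni)))//.
have -> : c * (x `^ kap * V x + \int[mu]_(r in `[x, y]) (kap * r `^ (kap - 1) * V r)) =
    m x * V x + \int[mu]_(r in `[x, y]) (m' r * gp r) + \int[mu]_(r in `[x, y]) (m' r * gm r).
  rewrite -[RHS]addrA -RintegralD//; last 2 first.
  - by apply: integrable_cont_mono.
  - by apply: integrable_cont_mono.
  rewrite mulrDr -RintegralZl//; last first.
    apply: integrable_cont_mono => //; [|exact: measurable_V|exact: V_ge0|exact: V_ni].
    move=> z /andP[xz _]; apply: continuousM; first exact: cvg_cst.
    by apply: powR_cont; exact: lt_le_trans xz.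
  rewrite /m mulrA; congr (_ + _); apply: eq_Rintegral => r _.
  by rewrite /m' /gp /gm; field.
have -> : m x * V x = m x * gp x + m x * gm x by rewrite /gp /gm; field.
by move: (\int[mu]_(r in `[x, y]) _) => *; lra.
Qed.

Let f1 (r : R) := (r `^ (dim - 1) * `|f r|).

Let mf1 : measurable_fun Rp f1.
Proof.
apply: measurable_funM; first by apply: measurable_funTS; exact: measurable_powR.
by apply: measurableT_comp => //; exact: measurable_f.
Qed.

Let sub01 : `]0%R, 1%R]%classic `<=` Rp.
Proof. by move=> z /=; rewrite !in_itv/= andbT => /andP[]. Qed.

Let f1_ge0 r : 0 <= f1 r. Proof. by rewrite mulr_ge0 ?powR_ge0. Qed.

Let integrable_f1 : mu.-integrable `]0%R, 1%R] (EFin \o f1).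
Proof.
apply/integrableP; split.
  by apply/measurable_EFinP; exact: measurable_funS sub01 mf1.
by under eq_integral => r _ do rewrite /= ger0_norm ?f1_ge0//.
Qed.

Definition near0 (x : R) : R := \int[mu]_(r in `]0%R, x]) f1 r.

(** Continuity of the integral in its upper end, for an integrable function. *)
Lemma near0_cvg0 : near0 x @[x --> 0^'+] --> (0 : R).
Proof.
pose g := f1 \_ `]0%R, 1%R].
have ig : mu.-integrable `[0%R, 1%R] (EFin \o g).
  rewrite -restrict_EFin; apply/integrable_restrict => //.
  have -> : `[0%R, 1%R] `&` `]0%R, 1%R] = (`]0%R, 1%R]%classic : set R).
    by apply: setIidr => z /=; rewrite !in_itv/= => /andP[/ltW -> ->].
  exact: integrable_f1.
have := parameterized_integral_cvg_left ltr01 ig.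
move=> /cvg_at_right_filter; apply: cvg_trans; apply: near_eq_cvg; near=> x.
have x0 : 0 < x by near: x; exact: nbhs_right_gt.
have x1 : x <= 1 by near: x; exact: nbhs_right_le.
have ig' : mu.-integrable `[0%R, x] (EFin \o g).
  apply: integrableS ig => // z /=; rewrite !in_itv/= => /andP[-> zx].
  exact: le_trans zx x1.
rewrite /parameterized_integral /near0 -Rintegral_itv_obnd_cbnd; last first.
  apply: integrableS ig' => // z /=; rewrite !in_itv/= => /andP[/ltW -> ->//].
apply: eq_Rintegral => z; rewrite inE/= in_itv/= => /andP[z0 zx].
by rewrite /g patchE mem_set//= in_itv/= z0 (le_trans zx).
Unshelve. all: by end_near. Qed.

Lemma near0_ge0 x : 0 <= near0 x.
Proof. by apply: Rintegral_ge0 => r _; exact: f1_ge0. Qed.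

Let integrable_f1' x : x <= 1 -> mu.-integrable `]0%R, x] (EFin \o f1).
Proof.
move=> x1; apply: integrableS integrable_f1 => // z /=; rewrite !in_itv/= => /andP[-> zx].
exact: le_trans zx x1.
Qed.

Let integrable_f1'' x y : 0 < x -> y <= 1 -> mu.-integrable `[x, y] (EFin \o f1).
Proof.
move=> x0 x1; apply: integrableS integrable_f1 => // z /=; rewrite !in_itv/= => /andP[xz zx].
by rewrite (lt_le_trans x0 xz) (le_trans zx x1).
Qed.

Lemma hint_near0 (rho x y : R) : 0 < rho -> 0 < x -> x <= y -> y <= 1 ->
  `|hint rho x y| <= near0 y.
Proof.
move=> rho0 x0 xy y1.
have ifk := integrable_fk y rho0 x0.
rewrite (le_trans (le_normr_Rintegral _ ifk))//.
apply: (@le_trans _ _ (\int[mu]_(r in `[x, y]) f1 r)).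
  apply: le_Rintegral => //; first exact: (integrable_norm ifk).
    exact: integrable_f1''.
  move=> r /=; rewrite in_itv/= => /andP[xr _]; have r0 := lt_le_trans x0 xr.
  by rewrite normrM mulrC ler_wpM2r// hker_le.
rewrite /near0 /Rintegral fine_le//; try exact: integrable_fin_num; last first.
  apply: ge0_subset_integral => //.
  - by have /integrableP[] := integrable_f1' y1.
  - by move=> z _; rewrite lee_fin f1_ge0.
  - by move=> z /=; rewrite !in_itv/= => /andP[xz ->]; rewrite (lt_le_trans x0 xz).
- by apply: integrable_fin_num => //; exact: integrable_f1'.
- by apply: integrable_fin_num => //; exact: integrable_f1''.
Qed.

Lemma hint_far (rho x y : R) : 0 < rho -> 1 <= x -> x <= y ->
  `|hint rho x y| <= 2 * M * rho `^ (kap - dim) * T x.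
Proof.
move=> rho0 x1 xy; rewrite (le_trans (hint_tail rho0 (lt_le_trans ltr01 x1) xy))//.
by rewrite ler_wpM2l ?VT// !mulr_ge0 ?powR_ge0 ?(ltW M0).
Qed.

Lemma hint_dom (rho x y : R) : 0 < rho -> 0 < x -> x <= 1 -> 1 <= y ->
  `|hint rho x y| <= near0 1 + 2 * M * T 1 * rho `^ (kap - dim).
Proof.
move=> rho0 x0 x1 y1; rewrite (hint_cat rho0 x0 x1 y1) (le_trans (ler_normD _ _))//.
by rewrite lerD ?hint_near0// mulrAC hint_far.
Qed.

(** Cauchy's criterion at both ends: [near0] controls the origin and [T]
    controls infinity. Bounds that hold for all large intervals are inherited
    by the limit. *)
Lemma hint_cvg (rho : R) : 0 < rho -> exists2 l : R,
  hint rho AB.1 AB.2 @[AB --> filter_prod 0^'+ (pinfty_nbhs R)] --> l &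
  forall x y C, 0 < x -> (forall s t, 0 < s -> s <= x -> y <= t -> `|hint rho s t| <= C) ->
    `|l| <= C.
Proof.
move=> rho0.
have /cauchy_cvgP cA : cauchy (hint rho A 1 @[A --> 0^'+]).
  apply: cauchy_exP => e e0.
  have H : \forall x \near 0^'+, near0 x < e by apply: (cvgr_lt _ near0_cvg0).
  have [x [/= xe [x0 x1]]] := @filter_ex _ (0 : R)^'+ _ _ (filterI H (filterI (nbhs_right_gt 0) (nbhs_right_le ltr01))).
  exists (hint rho x 1); near=> y.
  have y0 : 0 < y by near: y; exact: nbhs_right_gt.
  have yx : y <= x by near: y; exact: nbhs_right_le.
  rewrite /ball/= (hint_cat rho0 y0 yx x1) opprD addrCA subrr addr0 normrN.
  by rewrite (le_lt_trans _ xe)// hint_near0.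
have /cauchy_cvgP cB : cauchy (hint rho 1 B @[B --> +oo]).
  apply: cauchy_exP => e e0.
  pose c := 2 * M * rho `^ (kap - dim).
  have c0 : 0 < c by rewrite !mulr_gt0 ?powR_gt0.
  have H : \forall x \near +oo, T x < e / c by apply: (cvgr_lt _ T0); rewrite divr_gt0.
  have [x [/= xe x1]] := @filter_ex _ (pinfty_nbhs R) _ _ (filterI H (nbhs_pinfty_ge (num_real 1))).
  exists (hint rho 1 x); near=> y.
  have xy : x <= y by near: y; apply: nbhs_pinfty_ge; exact: num_real.
  rewrite /ball/= (hint_cat rho0 ltr01 x1 xy) opprD addNKr normrN.
  rewrite (le_lt_trans (hint_far rho0 x1 xy))// -/c.
  by rewrite mulrC -ltr_pdivlMr.
set l := lim (hint rho A 1 @[A --> 0^'+]) + lim (hint rho 1 B @[B --> +oo]).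
have lc : hint rho AB.1 AB.2 @[AB --> filter_prod 0^'+ (pinfty_nbhs R)] --> l.
  have c1 : (hint rho AB.1 1 + hint rho 1 AB.2) @[AB --> filter_prod 0^'+ (pinfty_nbhs R)] -->
     lim (hint rho A 1 @[A --> 0^'+]) + lim (hint rho 1 B @[B --> +oo]).
    apply: cvgD.
      by apply: (cvg_comp fst (fun A => hint rho A 1)) cA; exact: cvg_fst.
    by apply: (cvg_comp snd (fun A => hint rho 1 A)) cB; exact: cvg_snd.
  apply: cvg_trans c1; apply: near_eq_cvg.
  exists ([set A : R | 0 < A <= 1], [set B : R | 1 <= B]) => /=.
    split; last by apply: nbhs_pinfty_ge; exact: num_real.
    by near=> A; apply/andP; split; near: A; [exact: nbhs_right_gt|exact: nbhs_right_le].
  move=> [A B] /= [/andP[A0 A1] B1]; by rewrite -hint_cat.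
exists l => // x y C x0 H.
apply: (@cvgr_to_le _ (filter_prod (0 : R)^'+ (pinfty_nbhs R)) _ _ (fun AB => `|hint rho AB.1 AB.2|)).
  exact: (cvg_norm lc).
exists ([set A : R | 0 < A <= x], [set B : R | y <= B]) => /=.
  split; last by apply: nbhs_pinfty_ge; exact: num_real.
  by near=> A; apply/andP; split; near: A; [exact: nbhs_right_gt|exact: nbhs_right_le].
by move=> [A B] /= [/andP[A0 Ax] By]; exact: H.
Unshelve. all: by end_near. Qed.

(** The sequence of intervals from [1 / (n + 1)] to [n + 1] is what
    measurability and dominated convergence are applied to. *)
Lemma hankel_cvg (rho : R) : 0 < rho ->
  exists2 l : R, hankel lam a f rho = nu_const lam a * l &
  (hint rho n.+1%:R^-1 n.+1%:R @[n --> \oo] --> l) /\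
  forall x y C, 0 < x -> (forall s t, 0 < s -> s <= x -> y <= t -> `|hint rho s t| <= C) ->
    `|l| <= C.
Proof.
move=> rho0; have [l lc lb] := hint_cvg rho0; exists l; last first.
  split => //.
  have := @cvg_comp _ _ _ (fun n : nat => ((n.+1%:R^-1 : R), (n.+1%:R : R)))
    (fun AB => hint rho AB.1 AB.2) \oo (filter_prod 0^'+ (pinfty_nbhs R)) _ _ lc.
  apply => P [[A B] [/= HA HB] H]; near=> n; apply: (H (_, _)); split => /=; near: n.
    exact: (harmonic_at_right HA).
  exact: (natS_cvgy HB).
apply/cvg_lim => //.
have c1 : (nu_const lam a * hint rho AB.1 AB.2)
   @[AB --> filter_prod 0^'+ (pinfty_nbhs R)] --> nu_const lam a * l.
  by apply: cvgM lc; exact: cvg_cst.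
apply: cvg_trans c1; apply: near_eq_cvg.
exists ([set A : R | 0 < A], [set B : R | True]) => /=.
  by split; [exact: nbhs_right_gt|exact: filterT].
by move=> [A B] /= [A0 _]; rewrite hankel_integrand.
Unshelve. all: by end_near. Qed.

Lemma measurable_hint (x y : R) : 0 < x -> measurable_fun Rp (fun rho => hint rho x y).
Proof.
move=> x0.
have mRp : measurable Rp by exact: measurable_itv.
have mI : measurable (`[x, y]%classic : set R) by exact: measurable_itv.
have mg : measurable_fun (Rp `*` `[x, y]%classic) (fun z : R * R => f z.2 * hker z.1 z.2).
  apply: measurable_funM; last by apply: measurable_funTS; exact: measurable_hker2.
  apply: (measurable_comp (F := `[x, y]%classic)) (mcc x0 measurable_f) _ => //.
    by move=> _ [z [_ +] <-].
  exact: measurable_funTS.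
(* Tonelli's theorem for the positive and the negative part of the integrand *)
pose gp' (rho r : R) := (Num.max (f r * hker rho r) 0)%:E.
pose gm' (rho r : R) := (Num.max (- (f r * hker rho r)) 0)%:E.
have mp : measurable_fun Rp (fun rho => \int[mu]_(r in `[x, y]) gp' rho r)%E.
  apply: measurable_int_on => //; last by move=> *; rewrite lee_fin le_max lexx orbT.
  by apply/measurable_EFinP; apply: measurable_maxr.
have mm : measurable_fun Rp (fun rho => \int[mu]_(r in `[x, y]) gm' rho r)%E.
  apply: measurable_int_on => //; last by move=> *; rewrite lee_fin le_max lexx orbT.
  by apply/measurable_EFinP; apply: measurable_maxr => //; apply: measurable_funN.
have : measurable_fun Rp (fine \o (fun rho => \int[mu]_(r in `[x, y]) gp' rho r -
    \int[mu]_(r in `[x, y]) gm' rho r)%E).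
  by apply: measurableT_comp => //; exact: emeasurable_funB.
apply: eq_measurable_fun => rho _; rewrite /= /hint /Rintegral integralE.
by congr fine; congr (_ - _)%E; apply: eq_integral => r _;
  rewrite ?funeposE ?funenegE /gp' /gm' EFin_max.
Qed.

Lemma measurable_hankel : measurable_fun Rp (hankel lam a f).
Proof.
apply: (@measurable_fun_cvg _ _ _ _ (fun n rho => nu_const lam a * hint rho n.+1%:R^-1 n.+1%:R)).
- by move=> n; apply: measurable_funM => //; exact: measurable_hint.
- move=> rho; rewrite /= in_itv/= andbT => rho0.
  have [l -> [lc _]] := hankel_cvg rho0.
  by apply: cvgM lc; exact: cvg_cst.
Qed.

End HankelTransform.

(** * Weighted norms with respect to dr / r *)

Section HaarNorm.
Context {R : realType}.
Notation mu := (@lebesgue_measure R).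
Notation Rp := (`](0 : R), +oo[%classic).

(** The p-th power of the norm of [r^b g] in [L^p (dr / r)]; keeping the power
    avoids roots in the estimates. *)
Definition hnorm (p b : R) (g : R -> \bar R) : \bar R :=
  (\int[mu]_(r in Rp) (((r `^ b)%:E * g r) `^ p * (r^-1)%:E))%E.

Lemma hnorm_ge0 p b g : (0 <= hnorm p b g)%E.
Proof.
apply: integral_ge0 => r /=; rewrite in_itv/= andbT => r0.
by rewrite mule_ge0 ?poweR_ge0// lee_fin invr_ge0 ltW.
Qed.

Lemma le_hnorm p b (g h : R -> \bar R) : 0 <= p ->
  (forall r, 0 < r -> (0 <= g r)%E) -> (forall r, 0 < r -> (g r <= h r)%E) ->
  (hnorm p b g <= hnorm p b h)%E.
Proof.
move=> p0 g0 gh; apply: le_int_ge0 => r /=; rewrite in_itv/= andbT => r0.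
  by rewrite mule_ge0 ?poweR_ge0// lee_fin invr_ge0 ltW.
rewrite lee_wpmul2r ?lee_fin ?invr_ge0 ?(ltW r0)// poweR_le//.
  by rewrite mule_ge0 ?g0// lee_fin powR_ge0.
by rewrite lee_wpmul2l ?gh// lee_fin powR_ge0.
Qed.

Lemma hnormZ p b (c : R) (g : R -> \bar R) : 0 <= p -> 0 <= c ->
  measurable_fun Rp g -> (forall r, 0 < r -> (0 <= g r)%E) ->
  hnorm p b (fun r => c%:E * g r)%E = ((c `^ p)%:E * hnorm p b g)%E.
Proof.
move=> p0 c0 mg g0; rewrite /hnorm -ge0_integralZl//=.
- apply: eq_integral => r; rewrite inE/= in_itv/= andbT => r0.
  have bg0 : (0 <= (r `^ b)%:E * g r)%E by rewrite mule_ge0 ?g0 ?lee_fin ?powR_ge0.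
  by rewrite muleCA (@poweRM _ c%:E _ p) ?lee_fin// poweR_EFin muleA.
- apply: emeasurable_funM; last by apply/measurable_EFinP; exact: measurable_inv_Rp.
  apply: (measurableT_comp (measurable_poweR p)); apply: emeasurable_funM => //.
  by apply/measurable_EFinP; exact: measurable_powR_Rp.
- move=> r; rewrite in_itv/= andbT => r0.
  by rewrite mule_ge0 ?poweR_ge0// lee_fin invr_ge0 ltW.
- by rewrite lee_fin powR_ge0.
Qed.

(** Schur's test with the kernel [k x y = (x y)^b * L (x y)]: by invariance
    under dilations both its masses are the Mellin integral of [L] that is
    bounded by [A]. *)
Lemma hnorm_conv (p b d A : R) (L : R -> R) (g : R -> \bar R) :
  1 < p -> 0 < A -> measurable_fun setT L -> (forall y, 0 < y -> 0 <= L y) ->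
  measurable_fun Rp g -> (forall r, 0 < r -> (0 <= g r)%E) ->
  (\int[mu]_(y in Rp) (y `^ (b - 1) * L y)%:E <= A%:E)%E ->
  (hnorm p b (fun rho => \int[mu]_(r in Rp) ((r `^ (d - 1) * L (rho * r))%:E * g r))
    <= (A `^ p)%:E * hnorm p (d - b) g)%E.
Proof.
move=> p1 A0 mL L0 mg g0 LA.
pose k (x y : R) := (x * y) `^ b * L (x * y).
have mk : measurable_fun setT (fun z : R * R => k z.1 z.2).
  have mm : measurable_fun setT (fun z : R * R => z.1 * z.2) by exact: measurable_funM.
  apply: measurable_funM; last exact: (measurableT_comp mL).
  exact: (measurableT_comp (measurable_powR b)).
have kA x : 0 < x -> (\int[mu]_(y in Rp) (k x y / y)%:E <= A%:E)%E.
  move=> x0; pose h (y : R) := ((y `^ (b - 1) * L y)%:E)%E.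
  have := @int_scale _ x h x0.
  have mh : measurable_fun Rp h.
    apply/measurable_EFinP; apply: measurable_funM; first exact: measurable_powR_Rp.
    exact: measurable_funTS.
  have h0 y : 0 < y -> (0 <= h y)%E by move=> y0; rewrite lee_fin mulr_ge0 ?powR_ge0 ?L0.
  move=> /(_ mh h0) E.
  have -> : (\int[mu]_(y in Rp) (k x y / y)%:E = x%:E * \int[mu]_(y in Rp) h (x * y)%R)%E.
    rewrite -ge0_integralZl//=.
    - apply: eq_integral => y; rewrite inE/= in_itv/= andbT => y0.
      have xy0 : 0 < x * y by rewrite mulr_gt0.
      rewrite /h -EFinM; congr EFin; rewrite /k powRBp//.
      by rewrite powRr1 ?(ltW xy0)//; field; rewrite !gt_eqF.
    - apply: (measurable_comp (F := Rp)) mh _ => //.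
        by move=> y' [z /=]; rewrite !in_itv/= !andbT => z0 <-; rewrite mulr_gt0.
    - by move=> y; rewrite in_itv/= andbT => y0; rewrite h0// mulr_gt0.
    - by rewrite lee_fin ltW.
  rewrite E muleA -EFinM divff ?gt_eqF// mul1e; exact: LA.
(* the rest of the power of r, after (rho r)^b and the dr / r of the test *)
pose g' r := ((r `^ (d - b))%:E * g r)%E.
have := @schur_test _ k g' p A A p1 A0 mk.
have -> : A `^ (p - 1) * A = A `^ p.
  by rewrite powRB1// divfK// gt_eqF.
have mg' : measurable_fun Rp g'.
  by apply: emeasurable_funM => //; apply/measurable_EFinP; exact: measurable_powR_Rp.
move=> /(_ mg').
have k0 x y : 0 < x -> 0 < y -> 0 <= k x y.
  by move=> x0 y0; rewrite mulr_ge0 ?powR_ge0 ?L0 ?mulr_gt0.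
have g'0 r : 0 < r -> (0 <= g' r)%E by move=> r0; rewrite mule_ge0 ?g0 ?lee_fin ?powR_ge0.
move=> /(_ k0 g'0 kA).
have kA' y : 0 < y -> (\int[mu]_(x in Rp) (k x y / x)%:E <= A%:E)%E.
  by move=> y0; rewrite /k; under eq_integral do rewrite mulrC mulrC (mulrC _ y); exact: kA.
move=> /(_ kA'); apply: le_trans; apply: le_of_eq.
rewrite /hnorm; apply: eq_integral => rho; rewrite inE/= in_itv/= andbT => rho0.
congr (_ `^ _ * _)%E; rewrite -ge0_integralZl//=.
- apply: eq_integral => r; rewrite inE/= in_itv/= andbT => r0.
  rewrite muleA /g' muleA -!EFinM; congr (_%:E * _)%E.
  rewrite /k powRM ?(ltW rho0) ?(ltW r0)// !powRBp//.
  rewrite powRr1 ?(ltW r0)//.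
  have rb : r `^ b != 0 by rewrite gt_eqF ?powR_gt0.
  by field; rewrite rb gt_eqF.
- apply: emeasurable_funM => //; apply/measurable_EFinP; apply: measurable_funM.
    exact: measurable_powR_Rp.
  by apply: measurable_funTS; apply: measurableT_comp => //; exact: measurable_funM.
- move=> r; rewrite in_itv/= andbT => r0.
  by rewrite mule_ge0 ?g0// lee_fin mulr_ge0 ?powR_ge0 ?L0 ?mulr_gt0.
- by rewrite lee_fin powR_ge0.
Qed.

(** Hardy's inequality: in Schur's test, both masses are integrals of powers
    equal to [c0^b / b]. *)
Lemma hnorm_tail (p b c0 : R) (g : R -> \bar R) :
  1 < p -> 0 < b -> 0 < c0 ->
  measurable_fun Rp g -> (forall r, 0 < r -> (0 <= g r)%E) ->
  (hnorm p b (fun x => \int[mu]_(u in `[(x / c0)%R, +oo[) ((u^-1)%:E * g u))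
    <= ((c0 `^ b / b) `^ p)%:E * hnorm p b g)%E.
Proof.
move=> p1 b0 c00 mg g0.
pose A := c0 `^ b / b; have A0 : 0 < A by rewrite divr_gt0 ?powR_gt0.
pose k (x y : R) := if x / c0 <= y then x `^ b * y `^ (- b) else 0.
have mk : measurable_fun setT (fun z : R * R => k z.1 z.2).
  apply: measurable_fun_ifT => //.
    by apply: measurable_fun_ler => //; exact: measurable_funM.
  by apply: measurable_funM; [exact: (measurableT_comp (measurable_powR b))
    |exact: (measurableT_comp (measurable_powR (- b)))].
pose g' r := ((r `^ b)%:E * g r)%E.
have mg' : measurable_fun Rp g'.
  by apply: emeasurable_funM => //; apply/measurable_EFinP; exact: measurable_powR_Rp.
have k0 x y : 0 < x -> 0 < y -> 0 <= k x y.
  by move=> x0 y0; rewrite /k; case: ifP => // _; rewrite mulr_ge0 ?powR_ge0.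
have g'0 r : 0 < r -> (0 <= g' r)%E by move=> r0; rewrite mule_ge0 ?g0 ?lee_fin ?powR_ge0.
have tailE x : 0 < x -> `[(x / c0)%R, +oo[%classic = Rp `&` [set y | x / c0 <= y].
  move=> x0; apply/seteqP; split => y /=; rewrite !in_itv/= !andbT; last by case.
  by move=> xy; split => //; apply: lt_le_trans xy; rewrite divr_gt0.
have headE y : 0 < y -> `]0%R, (c0 * y)%R]%classic = Rp `&` [set x | x / c0 <= y].
  move=> y0; apply/seteqP; split => x /=; rewrite !in_itv/= !andbT ler_pdivrMr// (mulrC y).
    by move=> /andP.
  by case => -> ->.
have kA x : 0 < x -> (\int[mu]_(y in Rp) (k x y / y)%:E <= A%:E)%E.
  move=> x0; have xc : 0 < x / c0 by rewrite divr_gt0.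
  have := int_powy xc b0; rewrite tailE// integral_setI_if => E.
  have -> : (\int[mu]_(y in Rp) (k x y / y)%:E = \int[mu]_(y in Rp)
     ((x `^ b)%:E * (if (x / c0 <= y)%R then (y `^ (- b - 1))%:E else 0)))%E.
    apply: eq_integral => y; rewrite inE/= in_itv/= andbT => y0.
    rewrite /k; case: ifP => _; last by rewrite mul0r mule0.
    by rewrite -EFinM powRB1// mulrA.
  rewrite ge0_integralZl//=.
  - rewrite E -EFinM lee_fin /A powRM ?(ltW x0) ?invr_ge0 ?(ltW c00)//.
    rewrite -(powR_inv1 (ltW c00)) -powRrM mulN1r opprK powRN.
    have xb : x `^ b != 0 by rewrite gt_eqF ?powR_gt0.
    by rewrite !mulrA divff// mul1r.
  - apply: measurable_funTS; apply: measurable_fun_ifT => //.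
      by apply: measurable_fun_ler.
    by apply/measurable_EFinP; exact: measurable_powR.
  - by move=> y _; case: ifP => // _; rewrite lee_fin powR_ge0.
  - by rewrite lee_fin powR_ge0.
have kA' y : 0 < y -> (\int[mu]_(x in Rp) (k x y / x)%:E <= A%:E)%E.
  move=> y0; have yc : 0 < c0 * y by rewrite mulr_gt0.
  have := int_pow0 yc b0; rewrite headE// integral_setI_if => E.
  have -> : (\int[mu]_(x in Rp) (k x y / x)%:E = \int[mu]_(x in Rp)
     ((y `^ (- b))%:E * (if (x / c0 <= y)%R then (x `^ (b - 1))%:E else 0)))%E.
    apply: eq_integral => x; rewrite inE/= in_itv/= andbT => x0.
    rewrite /k; case: ifP => _; last by rewrite mul0r mule0.
    rewrite -EFinM powRB1//; congr EFin; ring.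
  rewrite ge0_integralZl//=.
  - rewrite E -EFinM lee_fin /A powRM ?(ltW y0) ?(ltW c00)// powRN.
    have xb : y `^ b != 0 by rewrite gt_eqF ?powR_gt0.
    by apply: le_of_eq; field; rewrite xb gt_eqF.
  - apply: measurable_funTS; apply: measurable_fun_ifT => //.
      by apply: measurable_fun_ler => //; exact: measurable_funM.
    by apply/measurable_EFinP; exact: measurable_powR.
  - by move=> x _; case: ifP => // _; rewrite lee_fin powR_ge0.
  - by rewrite lee_fin powR_ge0.
have := schur_test p1 A0 mk mg' k0 g'0 kA kA'.
have -> : A `^ (p - 1) * A = A `^ p.
  by rewrite powRB1// divfK// gt_eqF.
apply: le_trans; apply: le_of_eq.
rewrite /hnorm; apply: eq_integral => x; rewrite inE/= in_itv/= andbT => x0.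
congr (_ `^ _ * _)%E; rewrite tailE// integral_setI_if -ge0_integralZl//=.
- apply: eq_integral => y; rewrite inE/= in_itv/= andbT => y0.
  rewrite /k; case: ifP => _; last by rewrite mule0 mul0r mul0e.
  rewrite muleA /g' muleA -!EFinM powRN; congr (_%:E * _)%E.
  have yb : y `^ b != 0 by rewrite gt_eqF ?powR_gt0.
  by field; rewrite yb gt_eqF.
- apply: measurable_fun_if => //; first exact: measurable_fun_ler.
  apply: (measurable_funS (measurable_itv _)) (emeasurable_funM _ mg); last first.
    by apply/measurable_EFinP; exact: measurable_inv_Rp.
  by move=> z [].
- by move=> y; rewrite in_itv/= andbT => y0; case: ifP => // _; rewrite mule_ge0 ?g0// lee_fin invr_ge0 ltW.
- by rewrite lee_fin powR_ge0.
Qed.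

End HaarNorm.

(** * The upper bound *)

Section UpperBound.
Context {R : realType}.
Notation mu := (@lebesgue_measure R).
Notation Rp := (`](0 : R), +oo[%classic).

Variables (a lam : R).
Hypothesis a0 : 0 < a.
Hypothesis hlam : 0 <= 4 * lam + a.
Notation kap := (kap a lam).
Notation dim := (dim a lam).

(** Taking out [dr / r], the density [r^(dim - 1)] of the measure becomes
    [dim / p] in the exponent. *)
Lemma nu_normE (p c : R) (g : R -> R) : 0 < p -> measurable_fun Rp g ->
  nu_norm lam a p (fun r => r `^ c * g r) =
  (((nu_const lam a)%:E * hnorm p (c + dim / p) (fun r => `|g r|%:E)) `^ p^-1)%E.
Proof.
move=> p0 mg; rewrite /nu_norm; congr (_ `^ _)%E.
rewrite /hnorm -ge0_integralZl//=.
- apply: eq_integral => r; rewrite inE/= in_itv/= andbT => r0.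
  rewrite -!EFinM; congr EFin; rewrite normrM ger0_norm ?powR_ge0//.
  rewrite !powRM ?powR_ge0// -!powRrM /nu_density -[2 * lam + a]/dim powRBp//.
  rewrite powRr1 ?(ltW r0)// mulrDl divfK ?(gt_eqF p0)// (@powRD _ r (c * p)) ?(gt_eqF r0) ?implybT//.
  ring.
- apply: emeasurable_funM; last by apply/measurable_EFinP; exact: measurable_inv_Rp.
  apply/measurable_EFinP; apply: (measurableT_comp (measurable_powR p)).
  by apply: measurable_funM; [exact: measurable_powR_Rp|exact: measurableT_comp].
- move=> r; rewrite in_itv/= andbT => r0.
  by rewrite -EFinM lee_fin mulr_ge0 ?powR_ge0// invr_ge0 ltW.
- by rewrite lee_fin ltW// nu_const_gt0.
Qed.

(** Decay of the kernel as felt by a function of bounded variation: no decay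
    before the first oscillation, and [y^(kap - dim)] beyond, by
    [hint_tail]. *)
Definition hprof (y : R) : R := if y <= 1 then 1 else y `^ (kap - dim).

Lemma hprof_ge0 y : 0 <= hprof y.
Proof. by rewrite /hprof; case: ifP => // _; exact: powR_ge0. Qed.

Lemma measurable_hprof : measurable_fun setT hprof.
Proof.
by apply: measurable_fun_ifT => //; exact: measurable_fun_ler.
Qed.

Lemma hprof_moment (b : R) : 0 < b -> b < dim - kap ->
  (\int[mu]_(y in Rp) (y `^ (b - 1) * hprof y)%:E <= (b^-1 + (dim - kap - b)^-1)%:E)%E.
Proof.
move=> b0 bd; have c0 : 0 < dim - kap - b by rewrite subr_gt0.
rewrite (@integral_Rp_split _ 1)//; last 2 first.
- apply/measurable_EFinP; apply: measurable_funM; first exact: measurable_powR_Rp.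
  by apply: measurable_funTS; exact: measurable_hprof.
- by move=> y y0; rewrite lee_fin mulr_ge0 ?powR_ge0 ?hprof_ge0.
rewrite EFinD; apply: leeD.
  have -> : (b^-1)%:E = (\int[mu]_(t in `]0%R, 1%R]) (t `^ (b - 1))%:E)%E.
    by rewrite int_pow0// powR1 mul1r.
  apply: le_int_ge0 => y /=; rewrite in_itv/= => /andP[y0 y1].
    by rewrite lee_fin mulr_ge0 ?powR_ge0 ?hprof_ge0.
  by rewrite /hprof y1 mulr1.
have -> : ((dim - kap - b)^-1)%:E =
    (\int[mu]_(y in `[1%R, +oo[) (y `^ (- (dim - kap - b) - 1))%:E)%E.
  by rewrite int_powy// powR1 mul1r.
apply: le_int_ge0 => y /=; rewrite in_itv/= andbT => y1.
  by rewrite lee_fin mulr_ge0 ?powR_ge0 ?hprof_ge0.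
rewrite /hprof; case: ifPn => y1'.
  have -> : y = 1 by apply/eqP; rewrite eq_le y1 y1'.
  by rewrite !powR1 mulr1.
have y0 : 0 < y by exact: lt_le_trans y1.
rewrite -powRDp// (_ : b - 1 + (kap - dim) = - (dim - kap - b) - 1)//; ring.
Qed.

Variables (f V T : R -> R).
Hypothesis VD : forall r s, 0 < r -> r <= s -> `|f s - f r| <= V r - V s.
Hypothesis fV : forall r, 0 < r -> `|f r| <= V r.
Hypothesis T0 : T r @[r --> +oo] --> (0 : R).
Hypothesis VT : forall x y, 1 <= x -> x <= y ->
  x `^ kap * V x + \int[mu]_(r in `[x, y]) (kap * r `^ (kap - 1) * V r) <= T x.
Hypothesis f01 :
  (\int[mu]_(r in `]0%R, 1%R]) (r `^ (dim - 1) * `|f r|)%:E < +oo)%E.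
Notation hint := (hint a lam f).

Let M := sval (cid2 (hPhi_bound a0 hlam)).
Let M0 : 0 < M. Proof. by rewrite /M; case: cid2. Qed.

Definition upper_const : R := nu_const lam a * (1 + 2 * M * (dim + kap)).

Lemma upper_const_gt0 : 0 < upper_const.
Proof.
rewrite mulr_gt0 ?nu_const_gt0// ltr_wpDr// !mulr_ge0 ?(ltW M0)//.
by rewrite addr_ge0 ?(kap_ge0 hlam)// ltW// dim_gt0.
Qed.

Let mV := measurable_V VD.

Let mWr (rho : R) : measurable_fun Rp
  (fun r => ((r `^ (dim - 1) * hprof (rho * r))%:E * (V r)%:E)%E).
Proof.
apply/measurable_EFinP; apply: measurable_funM => //.
apply: measurable_funM; first exact: measurable_powR_Rp.
by apply: measurable_funTS; apply: (measurableT_comp measurable_hprof); exact: measurable_funM.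
Qed.

Let Wr_ge0 (rho r : R) : 0 < r ->
  (0 <= (r `^ (dim - 1) * hprof (rho * r))%:E * (V r)%:E)%E.
Proof.
by move=> r0; rewrite -EFinM lee_fin !mulr_ge0 ?powR_ge0 ?hprof_ge0 ?(V_ge0 fV).
Qed.

(** Cut the integral at [x = 1 / rho]. Before the cut the kernel is at most
    [1]. Beyond, [hint_tail] leaves an integral of [V] and the boundary term
    [x^kap * V x]; since [V] decreases, the latter is at most an integral of
    [V] before the cut. *)
Lemma hankel_le_conv (rho : R) : 0 < rho ->
  (`|hankel lam a f rho|%:E <= upper_const%:E *
    \int[mu]_(r in Rp) ((r `^ (dim - 1) * hprof (rho * r))%:E * (V r)%:E))%E.
Proof.
move=> rho0; set W := (\int[mu]_(r in Rp) _)%E.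
have sub (D : set R) (g : R -> R) : measurable D -> D `<=` Rp -> (forall r, D r -> 0 <= g r) ->
    (forall r, D r -> g r <= r `^ (dim - 1) * hprof (rho * r) * V r) ->
    (\int[mu]_(r in D) (g r)%:E <= W)%E.
  move=> mD DR g0 gW.
  apply: (@le_trans _ _ (\int[mu]_(r in D) ((r `^ (dim - 1) * hprof (rho * r))%:E * (V r)%:E))%E).
    apply: le_int_ge0 => r Dr; first by rewrite lee_fin g0.
    by rewrite -EFinM lee_fin gW.
  apply: ge0_subset_integral => //; first exact: mWr.
  by move=> r; rewrite /= in_itv/= andbT; exact: Wr_ge0.
have W0 : (0 <= W)%E by apply: integral_ge0 => r; rewrite /= in_itv/= andbT; exact: Wr_ge0.
have [Wy|Wy] := eqVneq W +oo%E.
  by rewrite Wy gt0_muley ?leey// lte_fin upper_const_gt0.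
have Wfin : W \is a fin_num by rewrite ge0_fin_numE// ltey.
have [w wE] : exists w : R, W = w%:E by exists (fine W); rewrite fineK.
rewrite wE in sub W0 *; rewrite -EFinM lee_fin.
have [l -> [_ lb]] := hankel_cvg a0 hlam VD fV T0 VT f01 rho0.
rewrite normrM ger0_norm ?(ltW (nu_const_gt0 a0 hlam))// /upper_const -[X in _ <= X]mulrA.
rewrite ler_pM2l ?(nu_const_gt0 a0 hlam)//.
(* the cut between the two regimes of hprof *)
pose x := rho^-1; have x0 : 0 < x by rewrite invr_gt0.
have rx : rho * x = 1 by rewrite divff// gt_eqF.
apply: (lb x x _ x0) => s t s0 sx xt.
rewrite (hint_cat (f := f) a0 hlam VD fV rho0 s0 sx xt) mulrC (le_trans (ler_normD _ _))//.
have ccRp (u v : R) : 0 < u -> `[u, v] `<=` Rp.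
  by move=> u0 z /=; rewrite !in_itv/= andbT => /andP[uz _]; exact: lt_le_trans uz.
have hnear : `|hint rho s x| <= w.
  have ifk := integrable_fk a0 hlam VD fV x rho0 s0.
  rewrite (le_trans (le_normr_Rintegral _ ifk))// -lee_fin fineK; last first.
    exact/integrable_fin_num/(integrable_norm ifk).
  apply: sub => //; first exact: ccRp.
  move=> r /=; rewrite in_itv/= => /andP[sr rx'].
  have r0 := lt_le_trans s0 sr.
  have h1 : hprof (rho * r) = 1 by rewrite /hprof -rx ler_pM2l// rx'.
  by rewrite h1 mulr1 normrM mulrC ler_pM// ?hker_le// fV.
have hx : x `^ dim * V x <= dim * w.
  have d0 := dim_gt0 a0 hlam.
  have := @int_pow0 _ x dim x0 d0 => E.
  have : ((x `^ dim / dim * V x)%:E <= w%:E)%E.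
    rewrite EFinM -E muleC -ge0_integralZl//=; last 3 first.
    - exact: measurable_pow.
    - by move=> r _; rewrite lee_fin powR_ge0.
    - by rewrite lee_fin (V_ge0 fV).
    under eq_integral do rewrite -EFinM.
    apply: sub => //.
    - by move=> z /=; rewrite !in_itv/= andbT => /andP[].
    - by move=> r _; rewrite mulr_ge0 ?powR_ge0 ?(V_ge0 fV).
    - move=> r /=; rewrite in_itv/= => /andP[r0 rx'].
      have h1 : hprof (rho * r) = 1 by rewrite /hprof -rx ler_pM2l// rx'.
      by rewrite h1 mulr1 mulrC ler_wpM2l ?powR_ge0 ?(V_ni VD).
  by rewrite lee_fin [_ / _ * _]mulrAC ler_pdivrMr// (mulrC dim).
have kd := kap_lt_dim a0 hlam.
have hint' : rho `^ (kap - dim) * \int[mu]_(r in `[x, t]) (kap * r `^ (kap - 1) * V r) <= kap * w.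
  have k0 := kap_ge0 hlam.
  have i1 : mu.-integrable `[x, t] (EFin \o (fun r => kap * r `^ (kap - 1) * V r)).
    apply: integrable_cont_mono => //; [|exact: (V_ge0 fV)|exact: (V_ni VD)].
    move=> z /andP[xz _]; apply: continuousM; first exact: cvg_cst.
    by apply: powR_cont; exact: lt_le_trans xz.
  rewrite -RintegralZl// -lee_fin fineK; last first.
    by apply: integrable_fin_num => //; apply: (integrableZl _ _ i1).
  have [->|k1] := eqVneq kap 0.
    under eq_integral do rewrite !(mul0r, mulr0).
    by rewrite integral0 mul0r.
  have kp : 0 < kap by rewrite lt_neqAle eq_sym k1 k0.
  rewrite mulrC EFinM -lee_pdivrMr//.
  rewrite -ge0_integralZr//=; last 3 first.
  - apply/measurable_EFinP; apply: measurable_funM => //.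
    apply: measurable_funS (ccRp x t x0) _ => //.
    apply: measurable_funM => //; apply: measurable_funM => //; exact: measurable_powR_Rp.
  - move=> r /=; rewrite in_itv/= => /andP[xr _]; have r0 := lt_le_trans x0 xr.
    by rewrite lee_fin !mulr_ge0 ?powR_ge0 ?(V_ge0 fV).
  - by rewrite lee_fin invr_ge0.
  under eq_integral do rewrite -EFinM.
  apply: sub => //; first exact: ccRp.
    move=> r /=; rewrite in_itv/= => /andP[xr _]; have r0 := lt_le_trans x0 xr.
    by rewrite !mulr_ge0 ?powR_ge0 ?(V_ge0 fV) ?invr_ge0.
  move=> r /=; rewrite in_itv/= => /andP[xr _]; have r0 := lt_le_trans x0 xr.
  have rr : 1 <= rho * r by rewrite -rx ler_pM2l.
  have -> : hprof (rho * r) = (rho * r) `^ (kap - dim).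
    rewrite /hprof; case: ifP => // r1.
    have -> : rho * r = 1 by apply/eqP; rewrite eq_le r1 rr.
    by rewrite powR1.
  rewrite powRM ?(ltW rho0) ?(ltW r0)//.
  have -> : r `^ (kap - 1) = r `^ (dim - 1) * r `^ (kap - dim).
    by rewrite -powRDp//; congr powR; ring.
  by apply: le_of_eq; field.
have hfar : `|hint rho x t| <= 2 * M * (dim * w + kap * w).
  rewrite (le_trans (hint_tail a0 hlam VD fV rho0 x0 xt))// -/M -mulrA.
  have h2 : 0 <= 2 * M by rewrite mulr_ge0 ?(ltW M0).
  rewrite ler_wpM2l// mulrDr lerD//.
  rewrite mulrA (_ : rho `^ (kap - dim) * x `^ kap = x `^ dim)//.
  have -> : rho = x^-1 by rewrite invrK.
  rewrite -(powR_inv1 (ltW x0)) -powRrM -powRDp//; congr powR; ring.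
rewrite (le_trans (lerD hnear hfar))//; apply: le_of_eq; ring.
Qed.

(** The transform is bounded by a multiplicative convolution of [V] with
    [hprof], which is bounded on the weighted space because the Mellin integral
    of [hprof] at [b] converges. General monotonicity bounds [V] by tails of
    [f], to which Hardy's inequality applies. *)
Lemma upper_bound (p b C c0 : R) : 1 < p -> 0 < b -> b < dim - kap -> 0 < C -> 1 < c0 ->
  (forall r, 0 < r -> ((V r)%:E <= C%:E *
     \int[mu]_(u in `[(r / c0)%R, +oo[) (`|f u| / u)%:E)%E) ->
  (hnorm p b (fun rho => `|hankel lam a f rho|%:E) <=
   ((upper_const * (b^-1 + (dim - kap - b)^-1) * C * (c0 `^ (dim - b) / (dim - b))) `^ p)%:E *
    hnorm p (dim - b) (fun r => `|f r|%:E))%E.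
Proof.
move=> p1 b0 bd C0 c1 GM; have p0 : 0 <= p by lra.
have c00 : 0 < c0 by lra.
have U0 := upper_const_gt0.
have k0 := kap_ge0 hlam.
have db : 0 < dim - b by move: k0 bd; lra.
set A := b^-1 + (dim - kap - b)^-1.
have A0 : 0 < A by rewrite addr_gt0 ?invr_gt0// subr_gt0.
have mf := measurable_f VD.
have mfa : measurable_fun Rp (fun r => `|f r|%:E).
  by apply/measurable_EFinP; exact: measurableT_comp.
set B := c0 `^ (dim - b) / (dim - b).
have B0 : 0 < B by rewrite divr_gt0 ?powR_gt0.
have s1 : (hnorm p b (fun rho => `|hankel lam a f rho|%:E) <=
   hnorm p b (fun rho => \int[mu]_(r in Rp) ((r `^ (dim - 1) * hprof (rho * r))%:E *
     (upper_const%:E * (V r)%:E))))%E.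
  apply: le_hnorm => // rho rho0.
  apply: (le_trans (hankel_le_conv rho0)); rewrite -ge0_integralZl//=; last 3 first.
  - exact: mWr.
  - by move=> r; rewrite in_itv/= andbT; exact: Wr_ge0.
  - by rewrite lee_fin ltW.
  by apply: le_of_eq; apply: eq_integral => r _; rewrite muleCA.
apply: (le_trans s1).
have mV' : measurable_fun Rp (fun r => (V r)%:E) by exact/measurable_EFinP.
have UV0 r : 0 < r -> (0 <= upper_const%:E * (V r)%:E)%E.
  by move=> r0; rewrite -EFinM lee_fin mulr_ge0 ?(V_ge0 fV)// ltW.
apply: (le_trans (@hnorm_conv _ p b dim A hprof _ p1 A0 measurable_hprof _ _ UV0 _)).
- by move=> y _; exact: hprof_ge0.
- exact: measurable_funeM.
- exact: hprof_moment.
rewrite hnormZ ?(ltW U0)//; last by move=> r r0; rewrite lee_fin (V_ge0 fV).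
have s2 : (hnorm p (dim - b) (fun r => (V r)%:E) <=
   hnorm p (dim - b) (fun x => \int[mu]_(u in `[(x / c0)%R, +oo[)
      ((u^-1)%:E * (C%:E * `|f u|%:E))))%E.
  apply: le_hnorm => //; first by move=> r r0; rewrite lee_fin (V_ge0 fV).
  move=> r r0; apply: (le_trans (GM r r0)); rewrite -ge0_integralZl//=.
  - apply: le_of_eq; apply: eq_integral => u _.
    by rewrite -!EFinM; congr EFin; ring.
  - apply/measurable_EFinP.
    apply: (@measurable_funS _ _ _ _ Rp) => //.
      by move=> z /=; rewrite !in_itv/= !andbT; apply: lt_le_trans; rewrite divr_gt0.
    by apply: measurable_funM; [exact: measurableT_comp|exact: measurable_inv_Rp].
  - move=> u; rewrite /= in_itv/= andbT => ru; rewrite lee_fin divr_ge0//.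
    by apply: le_trans ru; rewrite divr_ge0 ?ltW.
  - by rewrite lee_fin ltW.
have s3 := @hnorm_tail _ p (dim - b) c0 (fun u => C%:E * `|f u|%:E)%E p1 db c00.
have s4 := le_trans s2 (s3 _ _).
rewrite hnormZ// ?(ltW C0)// in s4.
have c' := powR_ge0 A p; have c'' := powR_ge0 upper_const p.
apply: (le_trans (lee_wpmul2l _ (lee_wpmul2l _ (s4 _ _)))); rewrite ?lee_fin//.
- exact: measurable_funeM.
- by move=> r r0; rewrite -EFinM lee_fin mulr_ge0 ?(ltW C0).
rewrite !muleA -!EFinM lee_wpmul2r ?hnorm_ge0// lee_fin.
have UA := mulr_gt0 U0 A0; have UAC := mulr_gt0 UA C0.
rewrite -/B (powRM _ (ltW UAC) (ltW B0)) (powRM _ (ltW UA) (ltW C0)).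
rewrite (powRM _ (ltW U0) (ltW A0)).
by apply: le_of_eq; ring.
Qed.

End UpperBound.

(** * Gaussian averages and the lower bound *)

Section GaussTransform.
Context {R : realType}.
Notation mu := (@lebesgue_measure R).
Notation Rp := (`](0 : R), +oo[%classic).

Variables (a lam : R).
Hypothesis a0 : 0 < a.
Hypothesis hlam : 0 <= 4 * lam + a.
Notation kap := (kap a lam).
Notation dim := (dim a lam).
Notation hK := (hK a lam).
Notation gauss := (gauss a).
Let o := 2 * lam / a.
Let d0 : 0 < dim. Proof. exact: dim_gt0. Qed.
Let order_ge_o : - 2^-1 <= o. Proof. exact: order_ge. Qed.
Let I0 : R := fine (gauss_moment a dim).

Let I0_gt0 : 0 < I0.
Proof. by rewrite /I0 fine_gt0// gauss_moment_gt0//= gauss_moment_lty. Qed.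

Let moment (k : nat) : gauss_moment a (a * k%:R + dim) =
  (a ^+ k * (\prod_(i < k) (o + 1 + i%:R)) * I0)%:E.
Proof.
elim: k => [|k ih].
  by rewrite mulr0 add0r expr0 big_ord0 !mul1r /I0 fineK// gauss_moment_fin.
have -> : a * k.+1%:R + dim = a * k%:R + dim + a by rewrite -natr1; ring.
have c0 : 0 < a * k%:R + dim by rewrite ltr_wpDl// mulr_ge0// ltW.
rewrite gauss_moment_rec// ih -EFinM; congr EFin.
rewrite exprS big_ord_recr/= /dim /o; field.
by rewrite gt_eqF.
Qed.

(** Absolute value of the k-th term in the expansion of [gker]. *)
Let pos (x r : R) (k : nat) (rho : R) : R :=
  `|bcoef o k| * (hz a (rho * r)) ^+ k * (gauss (x * rho) * rho `^ (dim - 1)).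

Let pos_ge0 x r k rho : 0 <= pos x r k rho.
Proof.
rewrite !mulr_ge0 ?gauss_ge0 ?powR_ge0// exprn_ge0// /hz divr_ge0 ?powR_ge0//.
by rewrite exprn_ge0// ltW.
Qed.

Let mpos x r k (D : set R) : measurable_fun D (pos x r k).
Proof.
apply: measurable_funTS; apply: measurable_funM.
  apply: measurable_funM => //; apply: measurable_funX.
  rewrite /hz; apply: measurable_funM => //.
  by apply: (measurableT_comp (measurable_powR a)); exact: measurable_funM.
apply: measurable_funM; last exact: measurable_powR.
by apply: (measurableT_comp (@measurable_gauss _ a setT)); exact: measurable_funM.
Qed.

(** The moments of the Gaussian cancel the denominators of the Bessel
    coefficients, except for the factorial. *)
Let pos_int (x r : R) k : 0 < x -> 0 < r ->
  (\int[mu]_(rho in Rp) (pos x r k rho)%:E =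
    (x `^ (- dim) * I0 * exp_coeff ((r / x) `^ a / a) k)%:E)%E.
Proof.
move=> x0 r0.
pose c := `|bcoef o k| * (r `^ a / a ^+ 2) ^+ k * x `^ (- (a * k%:R + dim - 1)).
have c0 : 0 <= c.
  rewrite !mulr_ge0 ?powR_ge0// exprn_ge0// divr_ge0 ?powR_ge0// exprn_ge0// ltW//.
pose h (t : R) := (gauss t * t `^ (a * k%:R + dim - 1))%:E.
have h0 t : 0 < t -> (0 <= h t)%E by move=> _; exact: gauss_pow_ge0.
have hx0 t : Rp t -> (0 <= h (x * t)%R)%E.
  by rewrite /= in_itv/= andbT => t0; rewrite h0// mulr_gt0.
have mhx : measurable_fun Rp (fun t => h (x * t)).
  apply/measurable_EFinP; apply: measurable_funTS; apply: measurable_funM.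
    by apply: (measurableT_comp (@measurable_gauss _ a setT)); exact: measurable_funM.
  by apply: (measurableT_comp (measurable_powR _)); exact: measurable_funM.
have -> : (\int[mu]_(rho in Rp) (pos x r k rho)%:E = c%:E * \int[mu]_(rho in Rp) h (x * rho)%R)%E.
  have := @ge0_integralZl _ _ _ mu Rp (measurable_itv _) _ mhx c%:E hx0.
  rewrite lee_fin => /(_ c0) <-.
  apply: eq_integral => rho; rewrite inE/= in_itv/= andbT => rho0.
    rewrite /h -EFinM; congr EFin; rewrite /pos /c /hz.
    rewrite !powRM ?(ltW x0) ?(ltW rho0) ?(ltW r0)// !exprMn.
    have E (t : R) : 0 < t -> t `^ (a * k%:R + dim - 1) = (t `^ a) ^+ k * t `^ (dim - 1).
      move=> t0; have -> : a * k%:R + dim - 1 = a * k%:R + (dim - 1) by ring.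
      by rewrite (@powRD _ t (a * k%:R)) ?(gt_eqF t0) ?implybT// powRrM powR_mulrn ?powR_ge0.
    rewrite powRN (E rho)//.
    have xx : x `^ (a * k%:R + dim - 1) != 0 by rewrite gt_eqF ?powR_gt0.
    by rewrite exprVn; field; rewrite xx expf_neq0// expf_neq0// gt_eqF.
rewrite (int_scale x0) //; last exact: measurable_gauss_pow.
rewrite -/(gauss_moment a (a * k%:R + dim)) moment -!EFinM; congr EFin.
have P0 := bprod_gt0 order_ge_o k.
have xd : x `^ (- (a * k%:R + dim - 1)) = x `^ (- dim) / (x `^ a) ^+ k * x.
  have -> : - (a * k%:R + dim - 1) = - dim + - (a * k%:R) + 1 by ring.
  rewrite powRDp// powRr1 ?(ltW x0)//.
  rewrite powRDp// [X in _ * X * _]powRN powRrM powR_mulrn ?powR_ge0//.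
have bE : `|bcoef o k| = (k`!%:R * \prod_(i < k) (o + 1 + i%:R))^-1.
  rewrite /bcoef normrM normrX normrN1 expr1n mul1r ger0_norm// invr_ge0.
  by rewrite mulr_ge0// ltW.
rewrite /c bE xd /exp_coeff/= powRM ?(ltW r0) ?invr_ge0 ?(ltW x0)//.
rewrite powRN -(powR_inv1 (ltW x0)) -powRrM mulN1r [x `^ (- a)]powRN (powR_inv1 (ltW x0)).
rewrite !exprMn !exprVn -exprM mulnC exprM.
have f0 : k`!%:R != 0 :> R by rewrite pnatr_eq0 -lt0n fact_gt0.
have xa : (x `^ a) ^+ k != 0 by rewrite expf_neq0// gt_eqF ?powR_gt0.
have ak : a ^+ k != 0 by rewrite expf_neq0// gt_eqF.
have xd0 : x `^ dim != 0 by rewrite gt_eqF ?powR_gt0.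
rewrite expr2; field.
by rewrite xd0 xa ak f0 (gt_eqF x0) (gt_eqF P0).
Qed.

Definition gker (x r rho : R) : R := hK (rho * r) * (gauss (x * rho) * rho `^ (dim - 1)).

Lemma measurable_gker (x r : R) (D : set R) : measurable_fun D (gker x r).
Proof.
apply: measurable_funTS; apply: measurable_funM.
  by apply: (measurableT_comp (measurable_hK a0 hlam)); exact: measurable_funM.
apply: measurable_funM; last exact: measurable_powR.
by apply: (measurableT_comp (@measurable_gauss _ a setT)); exact: measurable_funM.
Qed.

(** The Gaussian is an eigenfunction of the transform: integrate the power
    series of the kernel term by term. The absolute values of the terms have
    integrals that sum up to an exponential, which provides the dominating
    function. *)
Lemma gauss_transform (x r : R) : 0 < x -> 0 < r ->
  (\int[mu]_(rho in Rp) (gker x r rho)%:E =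
    (x `^ (- dim) * fine (gauss_moment a dim) * gauss (r / x))%:E)%E.
Proof.
move=> x0 r0; rewrite -/I0; set A := x `^ (- dim) * I0; set y := (r / x) `^ a / a.
have A0 : 0 <= A by rewrite mulr_ge0 ?powR_ge0 ?ltW.
pose t k rho := (-1) ^+ k * pos x r k rho.
pose s n rho : \bar R := (\sum_(0 <= k < n) (t k rho)%:E)%E.
have mt k : measurable_fun Rp (fun rho => (t k rho)%:E).
  by apply/measurable_EFinP; apply: measurable_funM => //; exact: mpos.
pose G rho : \bar R := (\sum_(0 <= k <oo) (pos x r k rho)%:E)%E.
have p0 k rho : (0 <= (pos x r k rho)%:E)%E by rewrite lee_fin pos_ge0.
have mp k : measurable_fun Rp (fun rho => (pos x r k rho)%:E).
  by apply/measurable_EFinP; exact: mpos.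
have mG : measurable_fun Rp G by apply: ge0_emeasurable_sum.
have G0 rho : (0 <= G rho)%E by apply: nneseries_ge0 => k _ _.
have expc (z : R) : A * series (exp_coeff z) n @[n --> \oo] --> A * expR z.
  by apply: cvgM; [exact: cvg_cst|exact: is_cvg_series_exp_coeff].
have iG : mu.-integrable Rp G.
  apply/integrableP; split => //.
  under eq_integral do rewrite gee0_abs//.
  rewrite integral_nneseries//.
  have -> : (\sum_(0 <= k <oo) \int[mu]_(rho in Rp) (pos x r k rho)%:E = (A * expR y)%:E)%E.
    apply/cvg_lim => //.
    have := cvg_seq_EFin (expc y); apply: cvg_trans; apply: near_eq_cvg; near=> n.
    rewrite /= /series/= mulr_sumr -sumEFin; apply: eq_bigr => k _.
    by rewrite pos_int.
  exact: ltry.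
have tp k rho : `|t k rho| = pos x r k rho.
  by rewrite normrM normrX normrN1 expr1n mul1r ger0_norm.
have it k : mu.-integrable Rp (fun rho => (t k rho)%:E).
  apply/integrableP; split; first exact: mt.
  under eq_integral do rewrite /= tp.
  by rewrite pos_int// ltry.
have sg : forall rho : R, Rp rho -> s n rho @[n --> \oo] --> (gker x r rho)%:E.
  move=> rho _.
  have := @expbounded_cvg _ _ (hz a (rho * r)) (expbounded_bcoef order_ge_o).
  rewrite -/(bfun o _) => cb.
  have : (series (fun k => bcoef o k * hz a (rho * r) ^+ k) n * (gauss (x * rho) * rho `^ (dim - 1)))
     @[n --> \oo] --> gker x r rho.
    by apply: cvgM; [exact: cb|exact: cvg_cst].
  move=> /cvg_seq_EFin; apply: cvg_trans; apply: near_eq_cvg; near=> n.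
  rewrite /= /s /series/= mulr_suml -sumEFin; apply: eq_bigr => k _.
  have bE : bcoef o k = (-1) ^+ k * `|bcoef o k|.
    rewrite /bcoef normrM normrX normrN1 expr1n mul1r.
    by rewrite ger0_norm// invr_ge0 mulr_ge0// ltW// (bprod_gt0 order_ge_o).
  by rewrite /t /pos {1}bE; congr EFin; rewrite !mulrA.
have sG n rho : (`|s n rho| <= G rho)%E.
  rewrite (le_trans (lee_abs_sum _ _ _))//.
  apply: le_trans (nneseries_lim_ge n _) => //.
  by apply: lee_sum => k _; rewrite /= tp.
have ms n : measurable_fun Rp (s n) by apply: emeasurable_sum.
have mk : measurable_fun Rp (fun rho => (gker x r rho)%:E).
  by apply/measurable_EFinP; exact: measurable_gker.
have [_ cI] := dominated_on (measurable_itv _) ms mk sg iG (fun n rho _ => sG n rho).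
apply: (cvg_unique _ cI) => //.
have := cvg_seq_EFin (expc (- y)); rewrite (_ : expR (- y) = gauss (r / x))//.
apply: cvg_trans; apply: near_eq_cvg; near=> n.
rewrite /= integral_sum// /series/= mulr_sumr -sumEFin; apply: eq_bigr => k _.
under eq_integral do rewrite EFinM.
rewrite integralZl//; last first.
  apply/integrableP; split; first exact: mp.
  by under eq_integral do rewrite gee0_abs//; rewrite pos_int// ltry.
rewrite pos_int// -EFinM; congr EFin; rewrite /exp_coeff/= (exprNn y) /A /y.
by ring.
Unshelve. all: by end_near. Qed.

Lemma gauss_scaled (x c : R) : 0 < x ->
  (\int[mu]_(t in Rp) (gauss (x * t) * t `^ (c - 1))%:E = (x `^ (- c))%:E * gauss_moment a c)%E.
Proof.
move=> x0; pose h (t : R) := (gauss t * t `^ (c - 1))%:E.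
have mhx : measurable_fun Rp (fun t => h (x * t)).
  apply/measurable_EFinP; apply: measurable_funTS; apply: measurable_funM.
    by apply: (measurableT_comp (@measurable_gauss _ a setT)); exact: measurable_funM.
  by apply: (measurableT_comp (measurable_powR _)); exact: measurable_funM.
have hx0 t : Rp t -> (0 <= h (x * t)%R)%E by move=> _; exact: gauss_pow_ge0.
have -> : (\int[mu]_(t in Rp) (gauss (x * t) * t `^ (c - 1))%:E
   = (x `^ (1 - c))%:E * \int[mu]_(t in Rp) h (x * t)%R)%E.
  have := @ge0_integralZl _ _ _ mu Rp (measurable_itv _) _ mhx (x `^ (1 - c))%:E hx0.
  rewrite lee_fin powR_ge0 => /(_ isT) <-.
  apply: eq_integral => t; rewrite inE/= in_itv/= andbT => t0.
  rewrite /h -EFinM powRM ?(ltW x0) ?(ltW t0)//; congr EFin.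
  have -> : x `^ (1 - c) * (gauss (x * t) * (x `^ (c - 1) * t `^ (c - 1))) =
    gauss (x * t) * t `^ (c - 1) * (x `^ (1 - c) * x `^ (c - 1)) by ring.
  rewrite -powRDp// (_ : 1 - c + (c - 1) = 0) ?powRr0 ?mulr1//; ring.
rewrite (int_scale x0); [|exact: measurable_gauss_pow|by move=> t _; exact: gauss_pow_ge0].
rewrite muleA -EFinM; congr (_%:E * _)%E.
rewrite -(powR_inv1 (ltW x0)) -powRDp//; congr powR; ring.
Qed.

Lemma measurable_gauss_scaled (x c : R) (D : set R) :
  measurable_fun D (fun t => gauss (x * t) * t `^ c).
Proof.
apply: measurable_funTS; apply: measurable_funM; last exact: measurable_powR.
by apply: (measurableT_comp (@measurable_gauss _ a setT)); exact: measurable_funM.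
Qed.

Lemma integrable_gauss_scaled (x c : R) : 0 < x -> 0 < c ->
  mu.-integrable Rp (EFin \o (fun t => gauss (x * t) * t `^ (c - 1))).
Proof.
move=> x0 c0; apply/integrableP; split.
  by apply/measurable_EFinP; exact: measurable_gauss_scaled.
under eq_integral do rewrite /= ger0_norm ?mulr_ge0 ?gauss_ge0 ?powR_ge0//.
rewrite gauss_scaled// -[gauss_moment a c]fineK ?gauss_moment_fin// -EFinM ltry.
exact: isT.
Qed.

Variables (f V T : R -> R).
Hypothesis VD : forall r s, 0 < r -> r <= s -> `|f s - f r| <= V r - V s.
Hypothesis fV : forall r, 0 < r -> `|f r| <= V r.
Hypothesis T0 : T r @[r --> +oo] --> (0 : R).
Hypothesis VT : forall x y, 1 <= x -> x <= y ->
  x `^ kap * V x + \int[mu]_(r in `[x, y]) (kap * r `^ (kap - 1) * V r) <= T x.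
Hypothesis f01 :
  (\int[mu]_(r in `]0%R, 1%R]) (r `^ (dim - 1) * `|f r|)%:E < +oo)%E.
Hypothesis f_ge0 : forall r, 0 < r -> 0 <= f r.
Hypothesis f_cvg0 : f r @[r --> +oo] --> (0 : R).
Notation hint := (hint a lam f).

Let mf := measurable_f VD.

Let P (x u w : R) : \bar R := (\int[mu]_(r in `[u, w]) (f r * (gauss (r / x) * r `^ (dim - 1)))%:E)%E.

Let ccRp (u w : R) : 0 < u -> `[u, w] `<=` Rp.
Proof. by move=> u0 z /=; rewrite !in_itv/= andbT => /andP[uz _]; exact: lt_le_trans uz. Qed.

(** Fubini's theorem and [gauss_transform]: the transform of the Gaussian is
    moved onto [f]. Over [u, w] the double integral converges absolutely. *)
Lemma gauss_pairing (x u w : R) : 0 < x -> 0 < u -> u <= w ->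
  (\int[mu]_(rho in Rp) (hint rho u w * (gauss (x * rho) * rho `^ (dim - 1)))%:E =
   (x `^ (- dim) * I0)%:E * P x u w)%E.
Proof.
move=> x0 u0 uw.
pose h (rho r : R) : \bar R := (f r * hker a lam rho r * (gauss (x * rho) * rho `^ (dim - 1)))%:E.
have mI : measurable (`[u, w]%classic : set R) by exact: measurable_itv.
have mRp : measurable Rp by exact: measurable_itv.
have mh : measurable_fun (Rp `*` `[u, w]%classic) (fun z : R * R => h z.1 z.2).
  have mRI : measurable (Rp `*` `[u, w]%classic) by exact: measurableX.
  apply/measurable_EFinP; apply: measurable_funM; last first.
    apply: measurable_funTS.
    apply: (@measurableT_comp _ _ _ _ _ _ (fun t => gauss (x * t) * t `^ (dim - 1))) => //.
    exact: measurable_gauss_scaled.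
  apply: measurable_funM; last by apply: measurable_funTS; exact: measurable_hker2.
  apply: (measurable_comp (F := Rp)) mf _ => //.
    by move=> y [z [_ /= zI] <-]; exact: (ccRp u0 zI).
  exact: measurable_funTS.
have [|M M0 kM] := @cont_bounded _ (fun r => r `^ (dim - 1)) u w uw.
  by move=> z /andP[uz _]; apply: powR_cont; exact: lt_le_trans uz.
have fin : (\int[mu]_(rho in Rp) \int[mu]_(r in `[u, w]) `|h rho r| < +oo)%E.
  have : mu.-integrable Rp (fun rho => (V u * M * (w - u))%:E *
      (gauss (x * rho) * rho `^ (dim - 1))%:E)%E.
    by apply: integrableZl => //; exact: (integrable_gauss_scaled x0 d0).
  move=> /integrableP[_].
  apply: le_lt_trans; apply: le_int_ge0 => rho; rewrite /= in_itv/= andbT => rho0.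
    by apply: integral_ge0 => r _.
  apply: (@le_trans _ _ (\int[mu]_(r in `[u, w]) cst (V u * M * (gauss (x * rho) * rho `^ (dim - 1)))%:E r)%E).
    apply: le_int_ge0 => // r /=; rewrite in_itv/= => /andP[ur rw].
    have r0 := lt_le_trans u0 ur.
    rewrite lee_fin normrM [X in _ * X <= _]ger0_norm ?mulr_ge0 ?gauss_ge0 ?powR_ge0//.
    rewrite ler_wpM2r ?mulr_ge0 ?gauss_ge0 ?powR_ge0// normrM ler_pM//.
      by rewrite (le_trans (fV r0))// (V_ni VD).
    rewrite (le_trans (hker_le a0 hlam rho0 r0))//.
    by rewrite (le_trans (ler_norm _))// kM// ur rw.
  rewrite (integral_cst mu mI)/= lebesgue_measure_itv/= lte_fin.
  have [->|uw'] := eqVneq u w; first by rewrite ltxx mule0.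
  rewrite lt_neqAle uw' uw/= -EFinB -!EFinM lee_fin.
  by apply: le_trans (ler_norm _); apply: le_of_eq; ring.
have -> : (\int[mu]_(rho in Rp) (hint rho u w * (gauss (x * rho) * rho `^ (dim - 1)))%:E =
    \int[mu]_(rho in Rp) \int[mu]_(r in `[u, w]) h rho r)%E.
  apply: eq_integral => rho; rewrite inE/= in_itv/= andbT => rho0.
  have ifk := integrable_fk a0 hlam VD fV w rho0 u0.
  rewrite /h; under [RHS]eq_integral do rewrite EFinM.
  by rewrite integralZr// EFinM /hint /Rintegral fineK//; exact: integrable_fin_num.
rewrite fubini_on// /P.
have mP : measurable_fun `[u, w] (fun r => f r * (gauss (r / x) * r `^ (dim - 1))).
  apply: measurable_funM; first exact: measurable_funS (ccRp u0) mf.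
  have -> : (fun r => gauss (r / x) * r `^ (dim - 1)) =
      (fun r => gauss (x^-1 * r) * r `^ (dim - 1)).
    by apply/funext => r; rewrite (mulrC r).
  exact: measurable_gauss_scaled.
rewrite -ge0_integralZl//=; last 3 first.
- exact/measurable_EFinP.
- move=> r /= /(ccRp u0); rewrite /= in_itv/= andbT => r0.
  by rewrite lee_fin !mulr_ge0 ?gauss_ge0 ?powR_ge0 ?f_ge0.
- by rewrite lee_fin mulr_ge0 ?powR_ge0 ?(ltW I0_gt0).
apply: eq_integral => r; rewrite inE => /= /(ccRp u0); rewrite /= in_itv/= andbT => r0.
rewrite /h; transitivity ((\int[mu]_(rho in Rp) ((f r * r `^ (dim - 1))%:E * (gker x r rho)%:E))%E).
  by apply: eq_integral => rho _; rewrite -EFinM /gker /hker; congr EFin; ring.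
rewrite integralZl//; last first.
  apply: le_integrable (integrable_gauss_scaled x0 d0) => //.
    by apply/measurable_EFinP; exact: measurable_gker.
  move=> rho; rewrite /= in_itv/= andbT => rho0; rewrite lee_fin.
  by rewrite /gker normrM ler_piMl// hK_le1// mulr_gt0.
rewrite gauss_transform// -!EFinM -/I0; congr EFin; ring.
Qed.

Let Pf (x r : R) : R := f r * (gauss (r / x) * r `^ (dim - 1)).

Let mPf x : measurable_fun Rp (fun r => (Pf x r)%:E).
Proof.
apply/measurable_EFinP; apply: measurable_funM => //.
have -> : (fun r => gauss (r / x) * r `^ (dim - 1)) =
    (fun r => gauss (x^-1 * r) * r `^ (dim - 1)).
  by apply/funext => r; rewrite (mulrC r).
exact: measurable_gauss_scaled.
Qed.

Let Pf_ge0 x r : 0 < r -> 0 <= Pf x r.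
Proof. by move=> r0; rewrite !mulr_ge0 ?f_ge0 ?gauss_ge0 ?powR_ge0. Qed.

Let near_fin (w : R) : 1 <= w ->
  (\int[mu]_(r in `]0%R, w]) (f r * r `^ (dim - 1))%:E < +oo)%E.
Proof.
move=> w1; have w0 : 0 < w by exact: lt_le_trans w1.
have h0 r : 0 < r -> 0 <= f r * r `^ (dim - 1) by move=> r0; rewrite mulr_ge0 ?f_ge0 ?powR_ge0.
have := int_pow0 w0 d0 => E.
apply: (@le_lt_trans _ _ (\int[mu]_(r in `]0%R, 1%R]) (r `^ (dim - 1) * `|f r|)%:E +
   (V 1)%:E * (w `^ dim / dim)%:E)%E); last by rewrite lte_add_pinfty// -EFinM ltry.
rewrite -E.
have mr : measurable_fun Rp (fun r => r `^ (dim - 1) * `|f r|).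
  by apply: measurable_funM; [exact: measurable_powR_Rp|exact: measurableT_comp].
have sub : `]0%R, w]%classic `<=` Rp by move=> z; rewrite /= !in_itv/= andbT => /andP[].
have V1 : 0 <= V 1 by exact: (V_ge0 fV).
rewrite -ge0_integralZl//=; last 2 first.
- exact: measurable_pow.
- by move=> r _; rewrite lee_fin powR_ge0.
have -> : `]0%R, 1%R]%classic = `]0%R, w]%classic `&` [set r | r <= 1].
  apply/seteqP; split => r /=; rewrite !in_itv/=.
    by move=> /andP[r0 r1]; rewrite r0 r1 (le_trans r1).
  by case => /andP[-> _] ->.
rewrite integral_setI_if.
rewrite -ge0_integralD//=; last 4 first.
- by move=> r _; case: ifP => // _; rewrite lee_fin mulr_ge0 ?powR_ge0.
- apply: measurable_fun_if => //; first exact: measurable_fun_ler.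
  apply/measurable_EFinP; apply: measurable_funS mr => //.
  by move=> z [/sub].
- by move=> r _; rewrite mule_ge0 ?lee_fin ?powR_ge0.
- by apply: measurable_funeM; exact: measurable_pow.
apply: le_int_ge0 => r /=; rewrite in_itv/= => /andP[r0 rw].
  by rewrite lee_fin h0.
case: ifPn => [r1|]; last rewrite -ltNge => r1.
  rewrite ger0_norm ?f_ge0// -EFinM -EFinD lee_fin [f r * _]mulrC lerDl.
  by rewrite mulr_ge0 ?powR_ge0.
rewrite add0e -EFinM lee_fin ler_wpM2r ?powR_ge0//.
by rewrite (le_trans (ler_norm _))// (le_trans (fV r0))// (V_ni VD)// ltW.
Qed.

(** Up to a constant, the left-hand side is an average of [f] at scale [z], and
    [f] vanishes at infinity. *)
Let dilation_small (x e : R) : 0 < x -> 0 < e -> exists2 z : R, x <= z &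
  forall u w, 0 < u -> ((z `^ (- dim))%:E * P z u w <= e%:E)%E.
Proof.
(* beyond w the function is at most e', which accounts for e / 2; the rest is
   a fixed mass, divided by a power of z *)
move=> x0 e0; pose e' := e / (2 * I0).
have e'0 : 0 < e' by rewrite divr_gt0// mulr_gt0.
have H : \forall r \near +oo, f r < e' by apply: (cvgr_lt _ f_cvg0).
have [w0 [/= w0P]] := H; rewrite /= => w0H.
pose w := Num.max (w0 + 1) 1.
have w1 : 1 <= w by rewrite le_max lexx orbT.
have wp : 0 < w by exact: lt_le_trans w1.
have fw r : w <= r -> f r <= e'.
  move=> wr; apply/ltW/w0H; apply: lt_le_trans wr.
  by rewrite lt_max ltrDl ltr01.
set m := (\int[mu]_(r in `]0%R, w]) (f r * r `^ (dim - 1))%:E)%E.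
have m0 : (0 <= m)%E.
  apply: integral_ge0 => r; rewrite /= in_itv/= => /andP[r0 _].
  by rewrite lee_fin mulr_ge0 ?f_ge0 ?powR_ge0.
have mfin : m \is a fin_num by rewrite ge0_fin_numE// near_fin.
have hz : \forall z \near +oo, (fine m + 1) * z `^ (- dim) < e / 2.
  apply: (cvgr_lt ((fine m + 1) * 0)); last by rewrite mulr0 divr_gt0.
  by apply: cvgM; [exact: cvg_cst|exact: powRN_cvgy].
have [z [/= zm xz]] := @filter_ex _ (pinfty_nbhs R) _ _ (filterI hz (nbhs_pinfty_ge (num_real x))).
exists z => // u v u0.
have z0 := lt_le_trans x0 xz.
have zi : 0 < z^-1 by rewrite invr_gt0.
have : (P z u v <= m + (e' * (z `^ dim * I0))%:E)%E.
  apply: (@le_trans _ _ (\int[mu]_(r in Rp) (Pf z r)%:E)%E).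
    apply: ge0_subset_integral => //; [exact: mPf| |exact: ccRp].
    by move=> r; rewrite /= in_itv/= andbT => r0; rewrite lee_fin Pf_ge0.
  rewrite (integral_Rp_split wp (mPf z)); last by move=> r r0; rewrite lee_fin Pf_ge0.
  apply: leeD.
    apply: le_int_ge0 => r; rewrite /= in_itv/= => /andP[r0 _]; rewrite lee_fin ?Pf_ge0//.
    by rewrite /Pf ler_wpM2l ?f_ge0// ler_piMl ?powR_ge0 ?gauss_le1.
  have -> : (e' * (z `^ dim * I0))%:E =
      (e'%:E * \int[mu]_(r in Rp) (gauss (z^-1 * r) * r `^ (dim - 1))%:E)%E.
    rewrite gauss_scaled// -[gauss_moment a dim]fineK ?gauss_moment_fin// -!EFinM.
    by rewrite -(powR_inv1 (ltW z0)) -powRrM mulN1r opprK.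
  rewrite ge0_integralZl_EFin; first last.
  - exact: ltW.
  - by move=> r _; rewrite mulr_ge0 ?gauss_ge0 ?powR_ge0.
  - exact: measurable_gauss_scaled.
  - exact: measurable_itv.
  have sub : `[w, +oo[%classic `<=` Rp.
    by move=> r; rewrite /= !in_itv/= !andbT; exact: lt_le_trans.
  have G0 (r : R) : 0 <= e' * (gauss (z^-1 * r) * r `^ (dim - 1)).
    by apply: mulr_ge0; [exact: ltW|rewrite mulr_ge0 ?gauss_ge0 ?powR_ge0].
  apply: (@le_trans _ _ (\int[mu]_(r in `[w, +oo[) (e' * (gauss (z^-1 * r) * r `^ (dim - 1)))%:E)%E).
    apply: le_int_ge0 => r wr; have := sub _ wr; rewrite /= in_itv/= andbT => r0.
      by rewrite lee_fin Pf_ge0.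
    rewrite lee_fin /Pf (mulrC r z^-1) ler_wpM2r ?mulr_ge0 ?gauss_ge0 ?powR_ge0//.
    by apply: fw; move: wr; rewrite /= in_itv/= andbT.
  apply: ge0_subset_integral.
  - exact: measurable_itv.
  - exact: measurable_itv.
  - by apply/measurable_EFinP; apply: measurable_funM => //; exact: measurable_gauss_scaled.
  - by move=> r _; rewrite lee_fin G0.
  - exact: sub.
have zd : z `^ (- dim) * z `^ dim = 1.
  by rewrite -powRDp// addNr powRr0.
move=> /(lee_wpmul2l _) => /(_ (z `^ (- dim))%:E).
rewrite lee_fin powR_ge0 => /(_ isT) h; apply: (le_trans h).
rewrite -(fineK mfin) -EFinD -EFinM lee_fin mulrDr.
have -> : z `^ (- dim) * (e' * (z `^ dim * I0)) = e / 2.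
  transitivity (z `^ (- dim) * z `^ dim * (e' * I0)); first by ring.
  by rewrite zd mul1r /e'; field; rewrite gt_eqF.
have := powR_ge0 z (- dim); move: zm; move: (z `^ (- dim)) (fine m) => q n; lra.
Qed.

Let M := sval (cid2 (hPhi_bound a0 hlam)).
Let M0 : 0 < M. Proof. by rewrite /M; case: cid2. Qed.

Let T1_ge0 : 0 <= T 1.
Proof.
have := VT (lexx 1) (lexx 1); apply: le_trans.
rewrite powR1 mul1r addr_ge0 ?(V_ge0 fV)//.
apply: Rintegral_ge0 => r; rewrite /= in_itv/= => /andP[r1 _].
have r0 := lt_le_trans ltr01 r1.
by rewrite !mulr_ge0 ?powR_ge0 ?(kap_ge0 hlam) ?(V_ge0 fV).
Qed.

(** The truncated transforms are only known to be bounded by a multiple of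
    [rho^(kap - dim)] near the origin, which is not integrable against
    [rho^(dim - 1)] if [kap = 0]. A difference of two Gaussians vanishes like
    [rho^a] at the origin and so restores integrability; the contribution of
    the second one is made small by [dilation_small]. *)
Let phi (x z rho : R) : R := gauss (x * rho) - gauss (z * rho).

Let phi_ge0 x z rho : 0 < x -> x <= z -> 0 < rho -> 0 <= phi x z rho.
Proof.
move=> x0 xz rho0; rewrite subr_ge0 gauss_antitone ?mulr_ge0 ?(ltW x0) ?(ltW rho0)//.
by rewrite ler_pM2r.
Qed.

Let phi_le x z rho : phi x z rho <= gauss (x * rho).
Proof. by rewrite gerBl gauss_ge0. Qed.

Let phi_small x z rho : 0 < x -> x <= z -> 0 < rho ->
  phi x z rho <= z `^ a / a * (gauss (x * rho) * rho `^ a).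
Proof.
move=> x0 xz rho0; have z0 := lt_le_trans x0 xz.
apply: (@le_trans _ _ (gauss (x * rho) * (1 - gauss (z * rho)))).
  rewrite mulrBr mulr1 lerD2l lerN2 ler_piMl ?gauss_ge0 ?gauss_le1//.
have -> : z `^ a / a * (gauss (x * rho) * rho `^ a) =
    gauss (x * rho) * ((z * rho) `^ a / a).
  by rewrite powRM ?(ltW z0) ?(ltW rho0)//; ring.
rewrite ler_wpM2l ?gauss_ge0// lerBlDr -lerBlDl /gauss.
by rewrite (le_trans _ (expR_ge1Dx _))// opprK.
Qed.

Let hint_weight_bound (x z rho : R) n : 0 < x -> x <= z -> 0 < rho ->
  `|hint rho n.+1%:R^-1 n.+1%:R * (phi x z rho * rho `^ (dim - 1))| <=
  near0 a lam f 1 * (gauss (x * rho) * rho `^ (dim - 1)) +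
  2 * M * T 1 * (z `^ a / a) * (gauss (x * rho) * rho `^ (kap + a - 1)).
Proof.
move=> x0 xz rho0; have p0 := phi_ge0 x0 xz rho0.
have n1 : (1 : R) <= n.+1%:R by rewrite ler1n.
have n0 : (0 : R) < n.+1%:R by rewrite ltr0n.
have := hint_dom a0 hlam VD fV VT f01 rho0 (x := n.+1%:R^-1) (y := n.+1%:R).
rewrite invr_gt0 n0 invf_le1// n1 => /(_ isT isT isT); rewrite -/M => hb.
rewrite normrM [X in _ * X](ger0_norm (mulr_ge0 p0 (powR_ge0 _ _))).
apply: (le_trans (ler_wpM2r (mulr_ge0 p0 (powR_ge0 _ _)) hb)).
rewrite mulrDl lerD//.
  by rewrite ler_wpM2l ?near0_ge0// ler_wpM2r ?powR_ge0.
rewrite -!mulrA ler_wpM2l// ler_wpM2l ?(ltW M0)// ler_wpM2l//.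
have -> : kap + a - 1 = (kap - dim) + (a + (dim - 1)) by ring.
rewrite (@powRD _ rho (kap - dim) (a + (dim - 1))) ?(gt_eqF rho0) ?implybT//.
rewrite (@powRD _ rho a (dim - 1)) ?(gt_eqF rho0) ?implybT//.
have := ler_wpM2r (mulr_ge0 (powR_ge0 rho (kap - dim)) (powR_ge0 rho (dim - 1))) (phi_small x0 xz rho0).
move: (rho `^ (kap - dim)) (rho `^ a) (rho `^ (dim - 1)) (phi x z rho) (z `^ a) (gauss _).
move=> A B C D E F H; rewrite (_ : A * (D * C) = D * (A * C)); last by ring.
apply: (le_trans H); apply: le_of_eq; ring.
Qed.

Let hint_bounded (u w : R) : 0 < u -> exists2 B : R, 0 <= B &
  forall rho : R, 0 < rho -> `|hint rho u w| <= B.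
Proof.
move=> u0; have mV := measurable_V VD.
have iV : mu.-integrable `[u, w] (EFin \o (fun r => r `^ (dim - 1) * V r)).
  apply: integrable_cont_mono => //; [|exact: (V_ge0 fV)|exact: (V_ni VD)].
  by move=> z /andP[uz _]; apply: powR_cont; exact: lt_le_trans uz.
exists (\int[mu]_(r in `[u, w]) (r `^ (dim - 1) * V r)).
  apply: Rintegral_ge0 => r /(ccRp u0); rewrite /= in_itv/= andbT => r0.
  by rewrite mulr_ge0 ?powR_ge0 ?(V_ge0 fV).
move=> rho rho0; have ifk := integrable_fk a0 hlam VD fV w rho0 u0.
rewrite (le_trans (le_normr_Rintegral _ ifk))//.
apply: le_Rintegral => //; first exact: (integrable_norm ifk).
move=> r /(ccRp u0); rewrite /= in_itv/= andbT => r0.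
by rewrite normrM mulrC ler_pM// ?hker_le// fV.
Qed.

Let integrable_hint_gauss (x u w : R) : 0 < x -> 0 < u ->
  mu.-integrable Rp (EFin \o (fun rho => hint rho u w * (gauss (x * rho) * rho `^ (dim - 1)))).
Proof.
move=> x0 u0; have [B B0 hB] := hint_bounded w u0.
have iG : mu.-integrable Rp (fun rho => B%:E * (gauss (x * rho) * rho `^ (dim - 1))%:E)%E.
  by apply: integrableZl => //; exact: (integrable_gauss_scaled x0 d0).
apply: le_integrable iG => //.
  apply/measurable_EFinP; apply: measurable_funM; last exact: measurable_gauss_scaled.
  exact: (measurable_hint a0 hlam VD).
move=> rho; rewrite /= in_itv/= andbT => rho0.
rewrite lee_fin normrM [X in _ <= X]normrM (ger0_norm B0) ler_wpM2r//.
exact: hB.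
Qed.

Let P_ge0 x u w : 0 < u -> (0 <= P x u w)%E.
Proof.
move=> u0; apply: integral_ge0 => r /(ccRp u0); rewrite /= in_itv/= andbT => r0.
by rewrite lee_fin Pf_ge0.
Qed.

Let P_fin x u w : 0 < u -> P x u w \is a fin_num.
Proof.
move=> u0; rewrite ge0_fin_numE ?P_ge0//.
have iV : mu.-integrable `[u, w] (EFin \o (fun r => r `^ (dim - 1) * V r)).
  apply: integrable_cont_mono => //; [|exact: (measurable_V VD)|exact: (V_ge0 fV)|exact: (V_ni VD)].
  by move=> z /andP[uz _]; apply: powR_cont; exact: lt_le_trans uz.
have /integrableP[_] := iV; apply: le_lt_trans.
apply: le_int_ge0 => r /(ccRp u0); rewrite /= in_itv/= andbT => r0.
  by rewrite lee_fin Pf_ge0.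
rewrite lee_fin (le_trans _ (ler_norm _))// mulrC ler_pM ?mulr_ge0 ?gauss_ge0 ?powR_ge0 ?f_ge0//.
  by rewrite ler_piMl ?powR_ge0 ?gauss_le1.
by rewrite (le_trans (ler_norm _))// fV.
Qed.

Let ncI : nu_const lam a * I0 = 1.
Proof. by rewrite nu_constE mulVf// gt_eqF. Qed.

(** Dominated convergence in [gauss_pairing]. *)
Let pairing_limit (x z : R) : 0 < x -> x <= z ->
  (((x `^ (- dim))%:E * P x n.+1%:R^-1 n.+1%:R -
     (z `^ (- dim))%:E * P z n.+1%:R^-1 n.+1%:R)%E) @[n --> \oo] -->
  (\int[mu]_(rho in Rp) (hankel lam a f rho * (phi x z rho * rho `^ (dim - 1)))%:E)%E.
Proof.
move=> x0 xz; have z0 := lt_le_trans x0 xz.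
have nc0 := nu_const_gt0 a0 hlam.
have mRp : measurable Rp by exact: measurable_itv.
have mphi : measurable_fun Rp (fun rho => phi x z rho * rho `^ (dim - 1)).
  have -> : (fun rho => phi x z rho * rho `^ (dim - 1)) =
    (fun rho => gauss (x * rho) * rho `^ (dim - 1) - gauss (z * rho) * rho `^ (dim - 1)).
    by apply/funext => rho; rewrite /phi mulrBl.
  by apply: measurable_funB; exact: measurable_gauss_scaled.
pose s (n : nat) rho := (nu_const lam a * hint rho n.+1%:R^-1 n.+1%:R *
  (phi x z rho * rho `^ (dim - 1)))%:E.
pose G rho := ((nu_const lam a * near0 a lam f 1)%:E * (gauss (x * rho) * rho `^ (dim - 1))%:E +
  (nu_const lam a * (2 * M * T 1 * (z `^ a / a)))%:E * (gauss (x * rho) * rho `^ (kap + a - 1))%:E)%E.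
have ka : 0 < kap + a by rewrite ltr_wpDl// (kap_ge0 hlam).
have iG : mu.-integrable Rp G.
  apply: integrableD => //; apply: integrableZl => //.
    exact: (integrable_gauss_scaled x0 d0).
  exact: (integrable_gauss_scaled x0 ka).
have ms n : measurable_fun Rp (s n).
  apply/measurable_EFinP; apply: measurable_funM => //; apply: measurable_funM => //.
  exact: (measurable_hint a0 hlam VD).
have mg : measurable_fun Rp (fun rho => (hankel lam a f rho * (phi x z rho * rho `^ (dim - 1)))%:E).
  apply/measurable_EFinP; apply: measurable_funM => //.
  exact: (measurable_hankel a0 hlam VD fV T0 VT f01).
have sc rho : Rp rho -> s n rho @[n --> \oo] --> (hankel lam a f rho * (phi x z rho * rho `^ (dim - 1)))%:E.
  rewrite /= in_itv/= andbT => rho0; apply: cvg_seq_EFin.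
  have [l -> [lc _]] := hankel_cvg a0 hlam VD fV T0 VT f01 rho0.
  apply: cvgM; last exact: cvg_cst.
  by apply: cvgM; [exact: cvg_cst|exact: lc].
have sG n rho : Rp rho -> (`|s n rho| <= G rho)%E.
  rewrite /= in_itv/= andbT => rho0.
  rewrite /s /G -!EFinM -EFinD lee_fin -mulrA normrM (ger0_norm (ltW nc0)) -!mulrA -mulrDr.
  rewrite ler_wpM2l ?(ltW nc0)// (le_trans (hint_weight_bound n x0 xz rho0))// -!mulrA//.
have [_ cI] := dominated_on mRp ms mg sc iG sG.
apply: cvg_trans cI; apply: near_eq_cvg; near=> n.
have n0 : (0 : R) < n.+1%:R^-1 by rewrite invr_gt0 ltr0n.
have nn : (n.+1%:R^-1 : R) <= n.+1%:R.
  by rewrite (@le_trans _ _ 1)// ?invf_le1 ?ler1n// ltr0n.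
rewrite /=; set u := (n.+1%:R^-1 : R) in n0 nn *; set w := (n.+1%:R : R) in nn *.
transitivity ((nu_const lam a)%:E * (\int[mu]_(rho in Rp) (hint rho u w * (gauss (x * rho) * rho `^ (dim - 1)))%:E -
  \int[mu]_(rho in Rp) (hint rho u w * (gauss (z * rho) * rho `^ (dim - 1)))%:E))%E.
  rewrite -integralB//; last 2 first.
  - exact: (integrable_hint_gauss w x0 n0).
  - exact: (integrable_hint_gauss w z0 n0).
  rewrite -integralZl//; last first.
    by apply: integrableB => //; [exact: (integrable_hint_gauss w x0 n0)|exact: (integrable_hint_gauss w z0 n0)].
  apply: eq_integral => rho _; rewrite /s -EFinB -EFinM; congr EFin.
  by rewrite /phi -/u -/w; ring.
rewrite gauss_pairing// gauss_pairing//.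
have [p ->] : exists p : R, P x u w = p%:E by exists (fine (P x u w)); rewrite fineK// P_fin.
have [q ->] : exists q : R, P z u w = q%:E by exists (fine (P z u w)); rewrite fineK// P_fin.
rewrite -!(EFinM, EFinB); congr EFin.
transitivity ((nu_const lam a * I0) * (x `^ (- dim) * p - z `^ (- dim) * q)); first by ring.
by rewrite ncI mul1r.
Unshelve. all: by end_near. Qed.

(** In [pairing_limit] the Gaussian average at scale [z] is made arbitrarily
    small, and the weight [phi] is at most the first Gaussian. *)
Lemma hankel_gauss_ge (x : R) : 0 < x ->
  ((x `^ (- dim))%:E * \int[mu]_(r in Rp) (f r * (gauss (r / x) * r `^ (dim - 1)))%:E <=
   \int[mu]_(rho in Rp) ((rho `^ (dim - 1) * gauss (x * rho))%:E * `|hankel lam a f rho|%:E))%E.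
Proof.
move=> x0; set B := (X in (_ <= X)%E).
have mRp : measurable Rp by exact: measurable_itv.
have mF := measurable_hankel a0 hlam VD fV T0 VT f01.
have n0 n : (0 : R) < n.+1%:R^-1 by rewrite invr_gt0 ltr0n.
have bound (z : R) : x <= z ->
    (\int[mu]_(rho in Rp) (hankel lam a f rho * (phi x z rho * rho `^ (dim - 1)))%:E <= B)%E.
  move=> xz; rewrite integralE.
  apply: (@le_trans _ _ (\int[mu]_(rho in Rp) ((fun rho =>
      (hankel lam a f rho * (phi x z rho * rho `^ (dim - 1)))%:E)^\+ rho))%E).
    by rewrite -[leRHS]sube0 leeB// integral_ge0.
  apply: le_int_ge0 => // rho; rewrite /= in_itv/= andbT => rho0.
  have p0 := phi_ge0 x0 xz rho0.
  rewrite funeposE -EFinM -EFin_max lee_fin ge_max; apply/andP; split; last first.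
    by rewrite !mulr_ge0 ?powR_ge0 ?gauss_ge0.
  rewrite (le_trans (ler_norm _))// normrM mulrC ler_wpM2r//.
  rewrite ger0_norm ?mulr_ge0 ?powR_ge0// mulrC ler_wpM2l ?powR_ge0//.
have key (e : R) m : 0 < e -> ((x `^ (- dim))%:E * P x m.+1%:R^-1 m.+1%:R <= B + e%:E)%E.
  move=> e0; have [z xz Hz] := dilation_small x0 e0.
  have cI := pairing_limit x0 xz.
  apply: (@le_trans _ _ (\int[mu]_(rho in Rp) (hankel lam a f rho * (phi x z rho * rho `^ (dim - 1)))%:E + e%:E)%E); last by rewrite leeD2r// bound.
  rewrite -leeBlDr//.
  apply: (cvge_to_ge cI); near=> n.
  have mn : (m <= n)%N by near: n; exact: nbhs_infty_ge.
  apply: leeB; last exact: Hz.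
  rewrite lee_wpmul2l ?lee_fin ?powR_ge0//.
  apply: ge0_subset_integral => //.
  - by apply: measurable_funS (mPf x) => //; exact: ccRp.
  - by move=> r /(ccRp (n0 n)); rewrite /= in_itv/= andbT => r0; rewrite lee_fin Pf_ge0.
  - move=> r /=; rewrite !in_itv/= => /andP[mr rm]; apply/andP; split.
      by rewrite (le_trans _ mr)// lef_pV2 ?posrE ?ltr0n// ler_nat ltnS.
    by rewrite (le_trans rm)// ler_nat ltnS.
have Pf0 (r : R) : 0 < r -> (0 <= (Pf x r)%:E)%E by move=> r0; rewrite lee_fin Pf_ge0.
have c1 := cvgeZl (isT : ((x `^ (- dim))%:E \is a fin_num)%E) (cvg_Rp (mPf x) Pf0).
apply: (cvge_to_le c1).
near=> n; apply/lee_addgt0Pr => e e0; exact: key.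
Unshelve. all: by end_near. Qed.

Definition gauss_avg (s : R) : \bar R :=
  (\int[mu]_(rho in Rp) ((rho `^ (dim - 1) * gauss (s * rho))%:E * `|hankel lam a f rho|%:E))%E.

Lemma gauss_avg_ge0 s : (0 <= gauss_avg s)%E.
Proof.
apply: integral_ge0 => rho _; rewrite mule_ge0// lee_fin.
by rewrite mulr_ge0 ?powR_ge0 ?gauss_ge0.
Qed.

Lemma measurable_gauss_avg : measurable_fun Rp gauss_avg.
Proof.
have mF := measurable_hankel a0 hlam VD fV T0 VT f01.
have mRp : measurable Rp by exact: measurable_itv.
apply: measurable_int_on => //; last first.
  move=> s rho _ _; rewrite mule_ge0// lee_fin.
  by rewrite mulr_ge0 ?powR_ge0 ?gauss_ge0.
have mRR : measurable (Rp `*` Rp) by exact: measurableX.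
apply/measurable_EFinP; apply: measurable_funM; last first.
  apply: (measurable_comp (F := Rp)) (measurable_abs mF) _.
  - exact: measurable_itv.
  - by move=> y [z [_ /= +] <-].
  - by apply: measurable_funTS.
apply: measurable_funTS; apply: measurable_funM.
  by apply: (measurableT_comp (measurable_powR _)).
by apply: (measurableT_comp (@measurable_gauss _ a setT)); exact: measurable_funM.
Qed.

(** Integrate [hankel_gauss_ge] in [ds / s] over [s >= y] and exchange the
    integrals. As [f] is nonnegative, only [s >= r] may be kept; there
    [gauss (r / s)] is at least [gauss 1], and the integral of [s^(- dim - 1)]
    leaves [f r / r]. *)
Lemma tail_le_gauss_avg (y : R) : 0 < y ->
  ((gauss 1 / dim)%:E * \int[mu]_(r in `[y, +oo[) (f r / r)%:E <=
   \int[mu]_(s in `[y, +oo[) ((s^-1)%:E * gauss_avg s))%E.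
Proof.
move=> y0; pose D := `[y, +oo[%classic : set R.
have mD : measurable D by exact: measurable_itv.
have DRp : D `<=` Rp by move=> r; rewrite /D /= !in_itv/= !andbT; exact: lt_le_trans.
have Dgt0 r : D r -> 0 < r by move=> /DRp; rewrite /= in_itv/= andbT.
pose h (s r : R) : R := s `^ (- dim - 1) * (f r * (gauss (r * s `^ (- 1)) * r `^ (dim - 1))).
have h0 s r : D r -> 0 <= h s r.
  by move=> /Dgt0 r0; rewrite mulr_ge0 ?powR_ge0// !mulr_ge0 ?f_ge0 ?gauss_ge0 ?powR_ge0.
have mDD : measurable (D `*` D) by exact: measurableX.
have mf' : measurable_fun (D `*` D) (fun z : R * R => f z.2).
  apply: (measurable_comp (F := Rp)) mf _ => //; first by move=> w [z [_ /= /DRp +] <-].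
  exact: measurable_funTS.
have mh : measurable_fun (D `*` D) (fun z : R * R => (h z.1 z.2)%:E).
  apply/measurable_EFinP; apply: measurable_funM.
    by apply: measurable_funTS; apply: (measurableT_comp (measurable_powR _)).
  apply: measurable_funM => //.
  apply: measurable_funTS; apply: measurable_funM; last first.
    by apply: (measurableT_comp (measurable_powR _)).
  apply: (measurableT_comp (@measurable_gauss _ a setT)); apply: measurable_funM => //.
  by apply: (measurableT_comp (measurable_powR _)).
have msec (s : R) : D s -> measurable_fun D (h s).
  move=> Ds; apply: measurable_funM => //; apply: measurable_funM.
    exact: measurable_funS DRp mf.
  apply: measurable_funTS; apply: measurable_funM; last exact: measurable_powR.
  by apply: (measurableT_comp (@measurable_gauss _ a setT)); exact: measurable_funM.
apply: (@le_trans _ _ (\int[mu]_(s in D) \int[mu]_(r in D) (h s r)%:E)%E); last first.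
  apply: le_int_ge0 => s Ds; first by apply: integral_ge0 => r Dr; rewrite lee_fin h0.
  have s0 := Dgt0 _ Ds.
  apply: (@le_trans _ _ ((s^-1)%:E * ((s `^ (- dim))%:E * \int[mu]_(r in Rp) (Pf s r)%:E)))%E; last first.
    by rewrite lee_wpmul2l ?lee_fin ?invr_ge0 ?(ltW s0)// hankel_gauss_ge.
  apply: (@le_trans _ _ ((s^-1)%:E * ((s `^ (- dim))%:E * \int[mu]_(r in D) (Pf s r)%:E)))%E; last first.
    rewrite !lee_wpmul2l ?lee_fin ?powR_ge0 ?invr_ge0 ?(ltW s0)//.
    apply: ge0_subset_integral => //; first exact: mPf.
    by move=> r; rewrite /= in_itv/= andbT => r0; rewrite lee_fin Pf_ge0.
  rewrite muleA -EFinM (ge0_integralZl_EFin mD); first last.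
  - by rewrite mulr_ge0 ?powR_ge0 ?invr_ge0 ?(ltW s0).
  - by move=> r /Dgt0 r0; exact: Pf_ge0.
  - by have /measurable_EFinP := mPf s; exact: measurable_funS.
  apply: le_of_eq; apply: eq_integral => r _.
  rewrite /h /Pf powR_inv1 ?(ltW s0)//; congr (_ * _)%:E.
  rewrite powRDp// mulrC.
  by rewrite powR_inv1 ?(ltW s0).
rewrite (tonelli_on mD mD mh); last by move=> s r _ Dr; rewrite lee_fin h0.
have mfr : measurable_fun D (fun r => f r / r).
  by apply: measurable_funS DRp _ => //; apply: measurable_funM => //; exact: measurable_inv_Rp.
rewrite (ge0_integralZl_EFin mD mfr); first last.
- by rewrite divr_ge0 ?gauss_ge0 ?(ltW d0).
- by move=> r /Dgt0 r0; rewrite divr_ge0 ?f_ge0 ?(ltW r0).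
apply: le_int_ge0 => r Dr; have r0 := Dgt0 _ Dr.
  by rewrite lee_fin mulr_ge0 ?divr_ge0 ?gauss_ge0 ?f_ge0 ?(ltW d0) ?(ltW r0).
have yr : y <= r by move: Dr; rewrite /D /= in_itv/= andbT.
pose c := f r * (gauss 1 * r `^ (dim - 1)).
have c0 : 0 <= c by rewrite !mulr_ge0 ?f_ge0 ?gauss_ge0 ?powR_ge0.
have -> : (gauss 1 / dim * (f r / r))%:E = (\int[mu]_(s in `[r, +oo[) (c * s `^ (- dim - 1))%:E)%E.
  rewrite -(ge0_integralZl_EFin (measurable_itv _) _ _ c0); last first.
  - by move=> s _; exact: powR_ge0.
  - by apply: measurable_funTS; exact: measurable_powR.
  - rewrite int_powy// -EFinM; congr EFin; rewrite /c powRBp//.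
    rewrite powRr1 ?(ltW r0)// powRN; field.
    by rewrite !gt_eqF ?powR_gt0.
have sub : `[r, +oo[%classic `<=` D.
  by move=> s; rewrite /D /= !in_itv/= !andbT; exact: le_trans.
apply: (@le_trans _ _ (\int[mu]_(s in `[r, +oo[) (h s r)%:E)%E).
  apply: le_int_ge0 => s rs; have s0 := Dgt0 _ (sub _ rs).
    by rewrite lee_fin mulr_ge0 ?powR_ge0.
  rewrite lee_fin /h mulrC ler_wpM2l ?powR_ge0// /c ler_wpM2l ?f_ge0//.
  rewrite ler_wpM2r ?powR_ge0// gauss_antitone ?mulr_ge0 ?powR_ge0 ?(ltW r0)//.
  rewrite powR_inv1 ?(ltW s0)// ler_pdivrMr// mul1r.
  by move: rs; rewrite /= in_itv/= andbT.
apply: ge0_subset_integral => //.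
- apply/measurable_EFinP; apply: measurable_funM.
    by apply: measurable_funTS; exact: measurable_powR.
  apply: measurable_funM => //; apply: measurable_funM => //.
  apply: measurable_funTS; apply: (measurableT_comp (@measurable_gauss _ a setT)).
  by apply: measurable_funM => //; exact: measurable_powR.
- by move=> s _; rewrite lee_fin h0.
Qed.

(** General monotonicity bounds [f] by its tails, [tail_le_gauss_avg] bounds
    these by tails of Gaussian averages of the transform, and the two averaging
    operators are bounded by Hardy's inequality and by [hnorm_conv]. *)
Lemma lower_bound (p b C c0 : R) : 1 < p -> 0 < b -> 0 < C -> 1 < c0 ->
  (forall r, 0 < r -> ((V r)%:E <= C%:E *
     \int[mu]_(u in `[(r / c0)%R, +oo[) (`|f u| / u)%:E)%E) ->
  (hnorm p b (fun r => `|f r|%:E) <=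
   ((c0 `^ b / b * (C * dim / gauss 1) * fine (gauss_moment a b)) `^ p)%:E *
    hnorm p (dim - b) (fun rho => `|hankel lam a f rho|%:E))%E.
Proof.
move=> p1 b0 C0 c1 GM; have p0 : 0 <= p by lra.
have c00 : 0 < c0 by lra.
have E0 := gauss_gt0 a 1.
set A := fine (gauss_moment a b).
have A0 : 0 < A by rewrite fine_gt0// gauss_moment_gt0 ?gauss_moment_lty.
set B := c0 `^ b / b; have B0 : 0 < B by rewrite divr_gt0 ?powR_gt0.
set K := C * dim / gauss 1; have K0 : 0 < K by rewrite divr_gt0 ?mulr_gt0.
have ga0 r : 0 < r -> (0 <= K%:E * gauss_avg r)%E.
  by move=> _; rewrite mule_ge0 ?gauss_avg_ge0// lee_fin ltW.
have s1 : (hnorm p b (fun r => `|f r|%:E) <= hnorm p b (fun x =>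
    \int[mu]_(u in `[(x / c0)%R, +oo[) ((u^-1)%:E * (K%:E * gauss_avg u))))%E.
  apply: le_hnorm => // r r0.
  have rc : 0 < r / c0 by rewrite divr_gt0.
  have DRp : `[(r / c0)%R, +oo[%classic `<=` Rp.
    by move=> u; rewrite /= !in_itv/= !andbT; exact: lt_le_trans.
  apply: (@le_trans _ _ (V r)%:E); first by rewrite lee_fin fV.
  apply: (le_trans (GM r r0)).
  have -> : (\int[mu]_(u in `[(r / c0)%R, +oo[) (`|f u| / u)%:E =
      \int[mu]_(u in `[(r / c0)%R, +oo[) (f u / u)%:E)%E.
    apply: eq_integral => u; rewrite inE => /DRp; rewrite /= in_itv/= andbT => u0.
    by rewrite ger0_norm// f_ge0.
  have t := tail_le_gauss_avg rc.
  apply: (@le_trans _ _ (K%:E * \int[mu]_(u in `[(r / c0)%R, +oo[) ((u^-1)%:E * gauss_avg u))%E).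
    apply: le_trans (lee_wpmul2l _ t); last by rewrite lee_fin ltW.
    rewrite muleA -EFinM (_ : K * (gauss 1 / dim) = C)//.
    by rewrite /K; field; rewrite !gt_eqF.
  have mg : measurable_fun `[(r / c0)%R, +oo[ (fun u => ((u^-1)%:E * gauss_avg u)%E).
    apply: measurable_funS DRp _ => //; apply: emeasurable_funM.
      by apply/measurable_EFinP; exact: measurable_inv_Rp.
    exact: measurable_gauss_avg.
  rewrite -ge0_integralZl//=; last 2 first.
  - move=> u /DRp; rewrite /= in_itv/= andbT => u0.
    by rewrite mule_ge0 ?gauss_avg_ge0// lee_fin invr_ge0 ltW.
  - by rewrite lee_fin ltW.
  by apply: le_of_eq; apply: eq_integral => u _; rewrite muleCA.
apply: (le_trans s1).
have mKg : measurable_fun Rp (fun u => (K%:E * gauss_avg u)%E).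
  by apply: measurable_funeM; exact: measurable_gauss_avg.
apply: (le_trans (hnorm_tail p1 b0 c00 mKg ga0)); rewrite -/B.
rewrite hnormZ ?(ltW K0)//; [|exact: measurable_gauss_avg|by move=> *; exact: gauss_avg_ge0].
have mF : measurable_fun Rp (fun rho => `|hankel lam a f rho|%:E).
  apply/measurable_EFinP; apply: measurable_abs.
  exact: (measurable_hankel a0 hlam VD fV T0 VT f01).
have s2 : (hnorm p b gauss_avg <= (A `^ p)%:E *
    hnorm p (dim - b) (fun rho => `|hankel lam a f rho|%:E))%E.
  apply: (@hnorm_conv _ p b dim A gauss) => //.
  - exact: measurable_gauss.
  - by move=> *; exact: gauss_ge0.
  - under eq_integral do rewrite mulrC.
    by rewrite /A fineK// gauss_moment_fin.
have Bp := powR_ge0 B p; have Kp := powR_ge0 K p.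
apply: (le_trans (lee_wpmul2l _ (lee_wpmul2l _ s2))); rewrite ?lee_fin//.
rewrite !muleA -!EFinM lee_wpmul2r ?hnorm_ge0// lee_fin.
have BK := mulr_gt0 B0 K0.
rewrite (powRM _ (ltW BK) (ltW A0)) (powRM _ (ltW B0) (ltW K0)).
by apply: le_of_eq; ring.
Qed.

End GaussTransform.

(** * Primitives of powers times the kernel *)

Section TruncatedPower.
Context {R : realType}.
Notation mu := (@lebesgue_measure R).
Notation Rp := (`](0 : R), +oo[%classic).

Variables (a lam : R).
Hypothesis a0 : 0 < a.
Hypothesis hlam : 0 <= 4 * lam + a.
Notation kap := (kap a lam).
Notation dim := (dim a lam).
Notation hK := (hK a lam).
Notation hL := (hL a lam).
Notation hPhi := (hPhi a lam).
Notation hu := (hu a lam).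
Notation hv := (hv a lam).
Notation sp := (sp a).
Let k0 : 0 <= kap. Proof. exact: kap_ge0. Qed.
Let d0 : 0 < dim. Proof. exact: dim_gt0. Qed.

(** Primitive of [x^(a m + dim - 1) * hK x] that vanishes at the origin. One
    step is two integrations by parts, through [hK] and [hPhi]; they lower the
    power by exactly [a], so that multiples of [a] lead back to [hPhi]. *)
Fixpoint hX (m : nat) (x : R) : R :=
  if m is n.+1 then
    x `^ (a * n.+1%:R) * hPhi x +
    a * n.+1%:R * (x `^ (a * n%:R + dim) * hK x - (a * n%:R + dim) * hX n x)
  else hPhi x.

Let am0 (m : nat) : 0 <= a * m%:R.
Proof. by rewrite mulr_ge0// ltW. Qed.

Let am0' (m : nat) : 0 < a * m.+1%:R.
Proof. by rewrite mulr_gt0. Qed.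

Let amd (m : nat) : 0 < a * m%:R + dim.
Proof. by rewrite ltr_wpDl. Qed.

Lemma is_derive_hX m (x : R) : 0 < x ->
  is_derive x 1 (hX m) (x `^ (a * m%:R + dim - 1) * hK x).
Proof.
move=> x0; elim: m => [|m ih].
  have := is_derive_hPhi a0 hlam x0.
  by rewrite mulr0 add0r mulrC.
have hP := is_derive_hPhi a0 hlam x0.
have hk := is_derive_hK a0 hlam x0.
have h1 := is_derive1_powR (a * m.+1%:R) x0.
have h2 := is_derive1_powR (a * m%:R + dim) x0.
rewrite /hX -/hX.
apply: is_derive_eq; rewrite /GRing.scale/= /hPhi /hv /sp.
have pD (s t : R) : x `^ (s + t) = x `^ s * x `^ t.
  by rewrite powRD// (gt_eqF x0) implybT.
have p1 (s : R) : x `^ (s - 1) = x `^ s / x.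
  by rewrite powRBp// powRr1// ltW.
have := dimE a lam; move: dim kap (hK x) (hL x) => D k A B DE.
have -> : x `^ (a * m.+1%:R + D - 1) = x `^ (a * m.+1%:R) * x `^ D / x by rewrite p1 pD.
rewrite !p1 !pD.
have -> : x `^ (a * m.+1%:R) = x `^ (a * m%:R) * (x `^ (a / 2) * x `^ (a / 2)).
  by rewrite -!pD; congr powR; rewrite -natr1; field.
have -> : x `^ D = x `^ k * x `^ k * x `^ (a / 2).
  by rewrite -!pD; congr powR; rewrite DE; ring.
by rewrite -natr1; field; rewrite gt_eqF.
Qed.

Lemma hX_cont m (x : R) : 0 < x -> {for x, continuous (hX m)}.
Proof. by move=> x0; exact: is_derive_cont (is_derive_hX m x0). Qed.

Lemma hX_cvg0 m : hX m x @[x --> 0^'+] --> (0 : R).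
Proof.
have cP : hPhi x @[x --> 0^'+] --> (0 : R).
  have cL := cvg_norm (hL_cvg0 a0 hlam); rewrite normr0 in cL.
  apply: (@squeeze_cvgr _ _ _ _ (fun x => - `|hL x|) (fun x => `|hL x|)).
  - near=> x; have x0 : 0 < x by near: x; exact: nbhs_right_gt.
    have x1 : x <= 1 by near: x; exact: nbhs_right_le.
    rewrite -ler_norml /hPhi /hv normrN mulrA normrM ger0_norm ?mulr_ge0 ?powR_ge0//.
    have xk : x `^ kap <= 1.
      have -> : (1 : R) = 1 `^ kap by rewrite powR1.
      by rewrite ge0_ler_powR ?nnegrE ?(ltW x0).
    by rewrite ler_piMl// mulr_ile1 ?powR_ge0.
  - by have := cvgN (cL _); rewrite oppr0; apply.
  - exact: cL.
elim: m => [|m ih] //=.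
have c1 := powR_cvg0 (am0' m); have c2 := powR_cvg0 (amd m).
rewrite [X in _ --> X](_ : 0 = 0 * 0 + a * m.+1%:R * (0 * 1 - (a * m%:R + dim) * 0)); last by ring.
apply: cvgD; first exact: cvgM.
apply: cvgM; first exact: cvg_cst.
apply: cvgB; first by apply: cvgM => //; exact: (hK_cvg0 a0 hlam).
by apply: cvgM => //; exact: cvg_cst.
Unshelve. all: by end_near. Qed.

(** Near the origin the kernel is at least [1/2]. *)
Lemma hX_ge_near0 m : exists2 delta : R, 0 < delta &
  forall y, 0 < y -> y <= delta ->
    y `^ (a * m%:R + dim) / (2 * (a * m%:R + dim)) <= hX m y.
Proof.
have H : \forall x \near 0^'+, 2^-1 < hK x.
  by apply: (cvgr_gt _ (hK_cvg0 a0 hlam)); rewrite invf_lt1// ltr1n.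
have [e /= e0 He] := H.
have e2 : 0 < e / 2 by rewrite divr_gt0.
exists (e / 2) => // y y0 ye.
set s := a * m%:R + dim; have s0 : 0 < s := amd m.
pose g x := hX m x - x `^ s / (2 * s).
suff : 0 <= g y by rewrite subr_ge0.
have Kh t : 0 < t -> t <= y -> 2^-1 <= hK t.
  move=> t0 ty; apply/ltW/He => //=.
  by rewrite sub0r normrN gtr0_norm//; move: t0 ty ye e0; lra.
have gD (t : R) : 0 < t -> is_derive t 1 g (t `^ (s - 1) * (hK t - 2^-1)).
  move=> t0; have h1 := is_derive_hX m t0; have h2 := is_derive1_powR s t0.
  apply: is_derive_eq; rewrite /GRing.scale/= -/s.
  by field; rewrite gt_eqF.
have g0 : g x @[x --> 0^'+] --> (0 : R).
  rewrite [X in _ --> X](_ : 0 = 0 - 0 / (2 * s)); last by rewrite mul0r subr0.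
  apply: cvgB; first exact: hX_cvg0.
  by apply: cvgM; [exact: powR_cvg0|exact: cvg_cst].
apply: (cvgr_to_le g0); near=> x.
have x0 : 0 < x by near: x; exact: nbhs_right_gt.
have xy : x <= y by near: x; exact: nbhs_right_le.
apply: (deriv_ge0_le (f := g) (df := fun t => t `^ (s - 1) * (hK t - 2^-1)) xy).
- by move=> t /andP[xt _]; apply: gD; exact: lt_le_trans xt.
- move=> t /andP[xt ty]; rewrite mulr_ge0 ?powR_ge0// subr_ge0 Kh//.
  exact: lt_le_trans xt.
Unshelve. all: by end_near. Qed.

Let hX_bound m (x0 Q : R) : 1 <= x0 -> 0 <= Q ->
  (forall x, x0 <= x -> `|hu x| <= Q) ->
  exists2 C : R, 0 <= C & forall x, x0 <= x -> `|hX m x| <= C * x `^ (a * m%:R + kap).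
Proof.
move=> x1 Q0 uQ; have [M M0 HM] := hPhi_bound a0 hlam.
elim: m => [|m [C C0 ih]].
  exists M; first exact: ltW.
  move=> x xx; rewrite mulr0 add0r; apply: HM.
  by rewrite (lt_le_trans _ xx)// (lt_le_trans _ x1).
pose n := a * m.+1%:R; pose e := a * m%:R + dim.
have n0 : 0 <= n := am0 m.+1.
have e0 : 0 <= e := ltW (amd m).
have eC : 0 <= e * C by rewrite mulr_ge0.
exists (M + n * (Q + e * C)).
  by rewrite addr_ge0 ?(ltW M0)// mulr_ge0// addr_ge0.
move=> x xx; have x1' := le_trans x1 xx; have x0' : 0 < x := lt_le_trans ltr01 x1'.
have mono (s t : R) : s <= t -> x `^ s <= x `^ t by move=> st; rewrite ler_powR.
set Y := x `^ (n + kap).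
have b1 : `|x `^ n * hPhi x| <= M * Y.
  rewrite normrM ger0_norm ?powR_ge0// /Y powRD ?(gt_eqF x0') ?implybT//.
  by rewrite mulrCA ler_wpM2l ?powR_ge0// HM.
have b2 : `|x `^ e * hK x| <= Q * Y.
  have -> : x `^ e * hK x = x `^ (e - kap) * hu x.
    by rewrite /hu mulrA -powRD ?(gt_eqF x0') ?implybT// subrK.
  rewrite normrM ger0_norm ?powR_ge0// mulrC ler_pM ?powR_ge0 ?uQ//.
  apply: mono; rewrite /e /n -natr1; have := dimE a lam.
  by move: dim kap (m%:R : R) => D k z ->; move: a0; lra.
have b3 : `|e * hX m x| <= e * C * Y.
  rewrite normrM (ger0_norm e0) -mulrA ler_wpM2l// (le_trans (ih x xx))//.
  by rewrite ler_wpM2l// mono// lerD2r /n -natr1; move: a0; lra.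
have -> : hX m.+1 x = x `^ n * hPhi x + n * (x `^ e * hK x - e * hX m x) by [].
move: (x `^ n * hPhi x) (x `^ e * hK x) (e * hX m x) b1 b2 b3 => A B D b1 b2 b3.
rewrite (le_trans (ler_normD _ _))// mulrDl lerD// normrM (ger0_norm n0).
rewrite -mulrA ler_wpM2l// (le_trans (ler_normB _ _))// mulrDl lerD//.
Qed.

Let young_small (p eps w : R) : 1 < p -> 0 < eps -> 0 <= w ->
  w <= eps + eps `^ (1 - p) * w `^ p.
Proof.
move=> p1 e0 w0; have [we|ew] := leP w eps.
  by rewrite ler_wpDr// mulr_ge0 ?powR_ge0.
have w0' : 0 < w := lt_trans e0 ew.
rewrite ler_wpDl ?(ltW e0)//.
have -> : w `^ p = w `^ (p - 1) * w.
  by rewrite powRB ?(gt_eqF w0') ?implybT// powRr1 ?(ltW w0')// divfK// gt_eqF.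
have h : eps `^ (p - 1) <= w `^ (p - 1).
  by rewrite ge0_ler_powR ?nnegrE ?subr_ge0 ?(ltW e0) ?(ltW w0') ?(ltW ew) ?ltW.
rewrite mulrA ler_peMl//; apply: (le_trans _ (ler_wpM2l (powR_ge0 _ _) h)).
rewrite -powRDp// (_ : 1 - p + (p - 1) = 0) ?powRr0//; ring.
Qed.

(** The factor normalizes the size of [hX] at infinity. *)
Definition hW (m : nat) (x : R) : R := x `^ (- (a * m%:R + kap)) * hX m x.

Let is_derive_hW m (x : R) : 0 < x ->
  is_derive x 1 (hW m) (sp x * hu x - (a * m%:R + kap) * hW m x / x).
Proof.
move=> x0; have h1 := is_derive_hX m x0.
have h2 := is_derive1_powR (- (a * m%:R + kap)) x0.
apply: is_derive_eq; rewrite /GRing.scale/= /hW /hu /sp.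
have p1 (s : R) : x `^ (s - 1) = x `^ s / x.
  by rewrite powRBp// powRr1// ltW.
rewrite !p1; have := dimE a lam.
move: dim kap (hK x) (hX m x) => D k A B DE.
have -> : x `^ (a / 2) = x `^ (- (a * m%:R + k)) * x `^ (a * m%:R + D) / x `^ k.
  rewrite -powRDp// -powRBp//.
  by congr powR; rewrite DE; ring.
by field; rewrite !gt_eqF ?powR_gt0.
Qed.

Let norm_le_sq (x c : R) : x ^+ 2 <= c -> `|x| <= 1 + c.
Proof.
move=> h; have h0 := sqr_ge0 x; have h1 := sqr_ge0 (`|x| - 1).
have h2 : `|x| ^+ 2 = x ^+ 2 by rewrite real_normK ?num_real.
by move: h1; rewrite sqrrB1 h2 mulr2n; move: (normr_ge0 x) => n0; lra.
Qed.

(** In the derivative of [(2 hW hu + hu hv) x^(- a/2)] the rotation produces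
    [(hu^2 + hv^2 + 2 hW hv) / x] as main term. If [|hW|^p / x] were
    integrable, then by Young's inequality the term in [hW] would only take
    away a fixed fraction of the lower bound [c] for [hu^2 + hv^2] and a
    convergent integral; a bounded function would then grow like a
    logarithm. *)
Lemma hW_diverges m (p : R) : 1 < p -> exists2 x0 : R, 1 <= x0 &
  (\int[mu]_(x in `[x0, +oo[) (`|hW m x| `^ p / x)%:E = +oo)%E.
Proof.
move=> p1; have [x0 [c [Q' [x1 c0 amp]]]] := kernel_amplitude a0 hlam.
exists x0 => //; have x00 : 0 < x0 := lt_le_trans ltr01 x1.
pose Q := 1 + Q'.
have Q1 : 1 <= Q.
  rewrite lerDl; have /andP[h1 h2] := amp x0 (lexx _).
  by move: h1 h2 c0; lra.
have Q0 : 0 < Q := lt_le_trans ltr01 Q1.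
have uQ x : x0 <= x -> `|hu x| <= Q.
  move=> /amp /andP[_ h]; apply: norm_le_sq; apply: le_trans h.
  by rewrite lerDl sqr_ge0.
have vQ x : x0 <= x -> `|hv x| <= Q.
  move=> /amp /andP[_ h]; apply: norm_le_sq; apply: le_trans h.
  by rewrite lerDr sqr_ge0.
have [W W0 HW] := hX_bound m x1 (ltW Q0) uQ.
pose N := a * m%:R; have N0 : 0 <= N := am0 m.
have wW x : x0 <= x -> `|hW m x| <= W.
  move=> xx; have x0' : 0 < x := lt_le_trans x00 xx.
  rewrite /hW normrM ger0_norm ?powR_ge0//.
  rewrite (le_trans (ler_wpM2l (powR_ge0 _ _) (HW x xx)))// mulrCA.
  by rewrite -powRD ?(gt_eqF x0') ?implybT// addNr powRr0 mulr1.
pose b := a / 2; have b0 : 0 < b by rewrite divr_gt0.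
pose Z x := 2 * hW m x * hu x + hu x * hv x.
pose Z1 := 2 * W * Q + Q * Q.
have Z1_ge0 : 0 <= Z1 by rewrite addr_ge0 ?mulr_ge0 ?(ltW Q0).
have ZB x : x0 <= x -> `|Z x| <= Z1.
  move=> xx; rewrite (le_trans (ler_normD _ _))// lerD//.
    rewrite (normrM (2 * hW m x)) (normrM 2) (ger0_norm (ler0n R 2)).
    by rewrite ler_pM ?mulr_ge0 ?uQ// ler_wpM2l ?wW.
  by rewrite (normrM (hu x)) ler_pM ?uQ ?vQ.
(* subtracting E1 / b makes the lower-order term of H' nonnegative *)
pose E1 := 2 * N * W * Q + b * Z1.
have NWQ : 0 <= 2 * N * W * Q by exact: (mulr_ge0 (mulr_ge0 (mulr_ge0 (ler0n R 2) N0) W0) (ltW Q0)).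
have bZ1 : 0 <= b * Z1 by exact: mulr_ge0 (ltW b0) Z1_ge0.
have E10 : 0 <= E1 by exact: addr_ge0.
pose H x := (Z x - E1 / b) * x `^ (- b).
pose H' x := (hu x ^+ 2 + hv x ^+ 2 + 2 * hW m x * hv x) / x +
  x `^ (- b - 1) * (E1 - 2 * N * hW m x * hu x - b * Z x).
have HD (x : R) : 0 < x -> is_derive x 1 H (H' x).
  move=> xp; have h1 := is_derive_hW m xp; have h2 := is_derive_hu a0 hlam xp.
  have h3 := is_derive_hv a0 hlam xp; have h4 := is_derive1_powR (- b) xp.
  apply: is_derive_eq; rewrite /GRing.scale/= /H' /Z /N /sp -/b.
  have p1' (s : R) : x `^ (s - 1) = x `^ s / x.
    by rewrite powRBp// powRr1// ltW.
  rewrite !p1' powRN.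
  by field; rewrite !gt_eqF ?powR_gt0.
have cW (x : R) : 0 < x -> {for x, continuous (hW m)} by move=> xp; exact: is_derive_cont (is_derive_hW m xp).
have cu (x : R) : 0 < x -> {for x, continuous hu} by move=> xp; exact: is_derive_cont (is_derive_hu a0 hlam xp).
have cv (x : R) : 0 < x -> {for x, continuous hv} by move=> xp; exact: is_derive_cont (is_derive_hv a0 hlam xp).
have HC (x : R) : 0 < x -> {for x, continuous H'}.
  move=> xp; have cx : {for x, continuous (fun x : R => x^-1)} by apply: continuousV => //; rewrite gt_eqF.
  have cp := @powR_cont _ (- b - 1) x xp.
  have c2 : {for x, continuous (fun=> 2 : R)} by exact: cvg_cst.
  have c1 : {for x, continuous (fun=> E1 : R)} by exact: cvg_cst.
  have c3 : {for x, continuous (fun=> 2 * N : R)} by exact: cvg_cst.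
  have c4 : {for x, continuous (fun=> b : R)} by exact: cvg_cst.
  have w' := cW _ xp; have u' := cu _ xp; have v' := cv _ xp.
  have wu : {for x, continuous (fun x => 2 * N * hW m x * hu x)} by do 2 apply: continuousM => //.
  have wv : {for x, continuous (fun x => 2 * hW m x * hv x)} by do 2 apply: continuousM => //.
  have uu : {for x, continuous (fun x => hu x ^+ 2)} by apply: continuousM.
  have vv : {for x, continuous (fun x => hv x ^+ 2)} by apply: continuousM.
  have ZZ : {for x, continuous Z}.
    by apply: continuousD; [do 2 apply: continuousM => //|apply: continuousM].
  apply: continuousD; apply: continuousM => //.
    by apply: continuousD => //; apply: continuousD.
  by apply: continuousB; [apply: continuousB|apply: continuousM].
(* with this value, 2 * hW * hv costs at most c / 2 besides |hW|^p *)
pose eps := c / (4 * Q); have eps0 : 0 < eps by rewrite divr_gt0// mulr_gt0.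
pose K := 2 * Q * eps `^ (1 - p).
have K0 : 0 <= K by rewrite mulr_ge0 ?powR_ge0 ?mulr_ge0 ?(ltW Q0).
pose q x := `|hW m x| `^ p / x.
have qpos (x : R) : 0 < x -> 0 <= q x by move=> xp; rewrite divr_ge0 ?powR_ge0 ?ltW.
have low (x : R) : x0 <= x -> c / 2 / x <= H' x + K * q x.
  move=> xx; have xp : 0 < x := lt_le_trans x00 xx.
  have Ep : 0 <= x `^ (- b - 1) * (E1 - 2 * N * hW m x * hu x - b * Z x).
    apply: mulr_ge0; first exact: powR_ge0.
    have h1 : 2 * N * hW m x * hu x <= 2 * N * W * Q.
      have N2 : 0 <= 2 * N := mulr_ge0 (ler0n R 2) N0.
      rewrite (le_trans (ler_norm _))// (normrM (2 * N * hW m x)) (normrM (2 * N)) (ger0_norm N2).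
      apply: ler_pM; [exact: mulr_ge0 N2 (normr_ge0 _)|exact: normr_ge0| |exact: uQ].
      by rewrite ler_wpM2l ?wW.
    have h2 : b * Z x <= b * Z1.
      by rewrite ler_wpM2l ?(ltW b0)// (le_trans (ler_norm _))// ZB.
    by move: h1 h2; rewrite /E1; move: (2 * N * hW m x * hu x) (b * Z x) => A B; lra.
  have /andP[cl _] := amp x xx.
  have wv : - (2 * Q * `|hW m x|) <= 2 * hW m x * hv x.
    rewrite lerNl (le_trans (ler_norm _))// normrN (normrM (2 * hW m x)) (normrM 2).
    rewrite (ger0_norm (ler0n R 2)) -(mulrA 2 Q) (mulrC Q) mulrA.
    by apply: ler_wpM2l; [exact: mulr_ge0 (ler0n R 2) (normr_ge0 _)|exact: vQ].
  have y := ler_wpM2l (ltW Q0) (young_small p1 eps0 (normr_ge0 (hW m x))).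
  have Qe : Q * eps = c / 4 by rewrite /eps; field; rewrite gt_eqF.
  rewrite /H' /q /K.
  apply: (@le_trans _ _ ((hu x ^+ 2 + hv x ^+ 2 + 2 * hW m x * hv x) / x +
     2 * Q * eps `^ (1 - p) * (`|hW m x| `^ p / x))); last by rewrite lerD2r lerDl.
  rewrite mulrA -mulrDl ler_pM2r ?invr_gt0//.
  move: y; rewrite mulrDr Qe mulrA; move: cl wv; clear.
  move: (hu x ^+ 2 + hv x ^+ 2) (2 * hW m x * hv x) (`|hW m x|) (`|hW m x| `^ p) (eps `^ (1 - p)) => A B D E F.
  by rewrite -!mulrA; move: (Q * D) (Q * (F * E)) => G I; lra.
have HB (x : R) : x0 <= x -> `|H x| <= Z1 + E1 / b.
  move=> xx; have xp : 0 < x := lt_le_trans x00 xx.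
  have E1b : 0 <= E1 / b by rewrite divr_ge0 ?(ltW b0).
  rewrite normrM (ger0_norm (powR_ge0 _ _)).
  rewrite -[leRHS]mulr1 ler_pM ?powR_ge0//.
    by rewrite (le_trans (ler_normB _ _))// (ger0_norm E1b) lerD2r ZB.
  rewrite -(@powRr0 _ x) ler_powR ?(le_trans x1)//.
  by rewrite oppr_le0 ltW.
have sub : `[x0, +oo[%classic `<=` Rp.
  by move=> x; rewrite /= !in_itv/= !andbT; exact: lt_le_trans.
have mW : measurable_fun Rp (hW m).
  by apply: open_continuous_measurable_fun => // x; rewrite inE/= in_itv/= andbT; exact: cW.
have mq : measurable_fun Rp q.
  apply: measurable_funM; last exact: measurable_inv_Rp.
  by apply: (measurableT_comp (measurable_powR p)); exact: measurable_abs.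
set S := (\int[mu]_(x in _) _)%E.
have S0 : (0 <= S)%E.
  by apply: integral_ge0 => x /sub; rewrite /= in_itv/= andbT => xp; rewrite lee_fin qpos.
apply: contrapT => Sy; have Sfin : S \is a fin_num by rewrite ge0_fin_numE// ltey; apply/eqP.
pose B := Z1 + E1 / b; pose s := fine S.
pose A := (2 * B + K * s) / (c / 2) + 1.
have B0 : 0 <= B by exact: addr_ge0 Z1_ge0 (divr_ge0 E10 (ltW b0)).
have s0 : 0 <= s by rewrite fine_ge0.
have A0 : 0 <= A.
  have h : 0 <= 2 * B + K * s := addr_ge0 (mulr_ge0 (ler0n R 2) B0) (mulr_ge0 K0 s0).
  by rewrite addr_ge0// divr_ge0// ltW// divr_gt0.
(* the integral of dx / x from x0 to T is A *)
pose T := x0 * expR A; have T0 : x0 <= T by rewrite ler_peMr ?(ltW x00)// -expR0 ler_expR.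
have subT : `[x0, T] `<=` Rp.
  by move=> x; rewrite /= !in_itv/= andbT => /andP[xx _]; exact: lt_le_trans xx.
have iH : mu.-integrable `[x0, T] (EFin \o H').
  by apply: cont_integrable => x /andP[xx _]; apply: HC; exact: lt_le_trans xx.
have iq : mu.-integrable `[x0, T] (EFin \o q).
  apply: (@bounded_monotone_integrable _ _ _ _ (W `^ p)); first exact: measurable_funS subT mq.
  move=> x /andP[xx _]; have xp := lt_le_trans x00 xx.
  rewrite ger0_norm ?qpos// -[leRHS]mulr1 ler_pM ?powR_ge0 ?invr_ge0 ?(ltW xp)//.
    rewrite ge0_ler_powR ?nnegrE ?wW//; lra.
  by rewrite invf_le1// (le_trans x1).
have iKq : mu.-integrable `[x0, T] (EFin \o (fun x => K * q x)).
  by apply: integrable_mull.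
have intlog : \int[mu]_(x in `[x0, T]) (c / 2 / x) = c / 2 * A.
  have F (x : R) : x0 <= x <= T -> is_derive x 1 (fun x => c / 2 * ln x) (c / 2 / x).
    move=> /andP[xx _]; have xp := lt_le_trans x00 xx.
    have := is_derive1_ln xp => h; apply: is_derive_eq; rewrite /GRing.scale/=.
    by rewrite mulrC.
  rewrite (Rintegral_ftc T0 F); last first.
    move=> x /andP[xx _]; have xp := lt_le_trans x00 xx.
    by apply: continuousM; [exact: cvg_cst|apply: continuousV => //; rewrite gt_eqF].
  by rewrite -mulrBr /T lnM ?posrE ?expR_gt0// expRK; congr (_ * _); ring.
have : c / 2 * A <= (H T - H x0) + K * s.
  have ftcH : \int[mu]_(x in `[x0, T]) H' x = H T - H x0.
    apply: Rintegral_ftc => // x /andP[xx _]; [apply: HD|apply: HC]; exact: lt_le_trans xx.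
  rewrite -intlog -ftcH.
  apply: (@le_trans _ _ (\int[mu]_(x in `[x0, T]) (H' x + K * q x))).
    apply: le_Rintegral => //.
    - apply: cont_integrable => x /andP[xx _]; have xp := lt_le_trans x00 xx.
      by apply: continuousM; [exact: cvg_cst|apply: continuousV => //; rewrite gt_eqF].
    - have -> : EFin \o (fun x => H' x + K * q x) =
        (fun x => (EFin \o H') x + (EFin \o (fun x => (K * q x)%R)) x)%E by [].
      exact: integrableD.
    - by move=> x; rewrite /= in_itv/= => /andP[xx _]; exact: low.
  rewrite RintegralD// lerD2l RintegralZl// ler_wpM2l//.
  apply: fine_le => //; first exact: integrable_fin_num.
  apply: ge0_subset_integral => //.
  - by apply/measurable_EFinP; exact: measurable_funS sub mq.
  - by move=> x /sub; rewrite /= in_itv/= andbT => xp; rewrite lee_fin qpos.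
  - by move=> x; rewrite /= !in_itv/= andbT => /andP[].
have cA : c / 2 * A = 2 * B + K * s + c / 2.
  by rewrite /A; field; rewrite gt_eqF.
have h1 := HB T T0; have h2 := HB x0 (lexx _).
rewrite cA; move: h1 h2; rewrite -/B !ler_norml => /andP[_ h1] /andP[h2 _].
by move: h1 h2 c0; move: (H T) (H x0) (K * s) => u v w; lra.
Qed.

End TruncatedPower.

(** * Truncated powers as test functions *)

Section TestFunction.
Context {R : realType}.
Notation mu := (@lebesgue_measure R).
Notation Rp := (`](0 : R), +oo[%classic).

Variables N t : R.
Hypothesis N0 : 0 < N.
Hypothesis t0 : 0 < t.

Definition tpow (r : R) : R := if r <= t then (r / t) `^ N else 0.

Lemma tpow_ge0 r : 0 <= tpow r.
Proof. by rewrite /tpow; case: ifP => // _; exact: powR_ge0. Qed.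

Let tpow_nd (r s : R) : 0 < r -> r <= s -> s <= t -> tpow r <= tpow s.
Proof.
move=> r0 rs st; rewrite /tpow st (le_trans rs st).
have rt : 0 <= r / t by rewrite divr_ge0 ?ltW.
have rst : r / t <= s / t by rewrite ler_pM2r ?invr_gt0.
by rewrite ge0_ler_powR ?nnegrE ?(ltW N0)// (le_trans rt).
Qed.

Let tpow_t : tpow t = 1.
Proof. by rewrite /tpow lexx divff ?gt_eqF// powR1. Qed.

Lemma tpow_le1 (r : R) : 0 < r -> tpow r <= 1.
Proof.
move=> r0; case: (leP r t) => rt; first by rewrite -tpow_t tpow_nd.
by rewrite /tpow ifF ?ler01//; apply/negbTE; rewrite -ltNge.
Qed.

Let tpow_gt (r : R) : t < r -> tpow r = 0.
Proof. by move=> tr; rewrite /tpow leNgt tr. Qed.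

Let tpow_ni (r s : R) : t <= r -> r <= s -> tpow s <= tpow r.
Proof.
move=> tr rs; move: rs; rewrite le_eqVlt => /predU1P[->//|rs].
by rewrite (tpow_gt (le_lt_trans tr rs)) tpow_ge0.
Qed.

Let tv_ni (g : R -> R) (x y : R) : {in `[x, y]%R &, {homo g : m n /~ (n <= m)%R}} ->
  (total_variation x y g <= (g x - g y)%:E)%E.
Proof.
move=> gni; apply: ge_ereal_sup => _ [_ [s xs <-] <-].
by rewrite (nonincreasing_variation gni xs).
Qed.

Let tpow_in_ni x y : t <= x -> {in `[x, y]%R &, {homo tpow : m n /~ (n <= m)%R}}.
Proof.
move=> tx m n; rewrite !in_itv/= => /andP[xm _] /andP[xn _] nm.
by apply: tpow_ni => //; exact: le_trans tx xm.
Qed.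

Let tpow_tv_le2 (x y : R) : 0 < x -> x <= y -> (total_variation x y tpow <= 2%:E)%E.
Proof.
move=> x0 xy.
have up z : x <= z -> z <= t -> (total_variation x z tpow <= 1%:E)%E.
  move=> xz zt; rewrite nondecreasing_total_variation//.
    rewrite lee_fin; have := tpow_le1 (lt_le_trans x0 xz); have := tpow_ge0 x; lra.
  move=> n m; rewrite !in_itv/= => /andP[xn _] /andP[_ mz] nm.
  by apply: tpow_nd => //; [exact: lt_le_trans xn|exact: le_trans zt].
have dn z : t <= z -> (total_variation z y tpow <= 1%:E)%E.
  move=> tz; rewrite (le_trans (tv_ni (@tpow_in_ni z y tz)))// lee_fin.
  by have := tpow_le1 (lt_le_trans t0 tz); have := tpow_ge0 y; lra.
have l12 : (1%:E <= 2%:E :> \bar R)%E by rewrite lee_fin ler1n.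
case: (leP y t) => yt; first exact: le_trans (up y xy yt) l12.
case: (leP t x) => tx; first exact: le_trans (dn x tx) l12.
rewrite (total_variationD tpow (ltW tx) (ltW yt)).
have -> : (2%:E = 1%:E + 1%:E :> \bar R)%E by rewrite -EFinD.
by apply: leeD; [exact: up (ltW tx) (lexx _)|exact: dn (lexx _)].
Qed.

Lemma tpow_bv eps b : 0 < eps -> bounded_variation eps b tpow.
Proof.
move=> e0; case: (leP eps b) => eb.
  apply/bounded_variationP => //; rewrite ge0_fin_numE ?total_variation_ge0//.
  by apply: le_lt_trans (tpow_tv_le2 e0 eb) _; exact: ltry.
exists (tpow eps - tpow b) => _ [s xs <-].
rewrite (@nonincreasing_variation _ _ _ _ s)// => m n.
by rewrite !in_itv/= => /andP[en nb]; have := lt_le_trans eb (le_trans en nb); rewrite ltxx.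
Qed.

Let tv_gt (x y : R) : t < x -> x <= y -> tv tpow x y = 0.
Proof.
move=> tx xy; apply/eqP; rewrite eq_le tv_ge0// andbT /tv.
have x0 := lt_trans t0 tx.
rewrite -lee_fin fineK; last exact: tv_fin tpow_bv _ _ x0 xy.
rewrite (le_trans (tv_ni (@tpow_in_ni x y (ltW tx))))//.
by rewrite !tpow_gt ?subrr// (lt_le_trans tx xy).
Qed.

Lemma tpow_cvg0 : tpow u @[u --> +oo] --> (0 : R).
Proof.
apply: cvg_near_cst; near=> u; apply: tpow_gt; near: u.
by apply: nbhs_pinfty_gt; exact: num_real.
Unshelve. all: by end_near. Qed.

Definition tpow_GM : R := 2 * N / (1 - 2 `^ (- N)).

Let twoN : 0 < 1 - (2 : R) `^ (- N).
Proof.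
rewrite subr_gt0 powRN invf_lt1 ?powR_gt0//.
have := @gt0_ltr_powR R N N0 1 2; rewrite powR1; apply; by rewrite ?nnegrE ?ler01 ?ler0n ?ltr1n.
Qed.

Lemma tpow_GM_gt0 : 0 < tpow_GM.
Proof. by rewrite /tpow_GM divr_gt0// mulr_gt0. Qed.

(** The variation beyond [r] is at most [2], and zero for [r > t]; for [r <= t]
    the integral on the right contains the interval from [t / 2] to [t], where
    it has a value independent of [t]. The constants being the same for all
    [t], the whole family may be used. *)
Lemma tpow_GM_with : GM_with tpow_GM 2 tpow.
Proof.
split; [exact: tpow_GM_gt0|by rewrite ltr1n|exact: tpow_bv|exact: tpow_cvg0|].
move=> r r0; have [_ vi] := variation_integral1P tpow_bv r0.
case: (leP r t) => rt; last first.
  apply: (@le_trans _ _ 0%:E).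
    by apply: vi => b rb; rewrite tv_gt.
  rewrite mule_ge0 ?lee_fin ?(ltW tpow_GM_gt0)//; apply: integral_ge0 => u /=.
  rewrite in_itv/= andbT => ru; rewrite lee_fin divr_ge0//.
  by apply: le_trans ru; rewrite divr_ge0// ltW.
apply: (@le_trans _ _ 2%:E).
  apply: vi => b rb; rewrite -lee_fin /tv fineK; last exact: tv_fin tpow_bv _ _ r0 rb.
  exact: tpow_tv_le2.
have t20 : 0 < t / 2 by rewrite divr_gt0.
have t2t : t / 2 <= t by rewrite ler_pdivrMr// ler_pMr// ler1n.
have h : (((1 - 2 `^ (- N)) / N)%:E <= \int[mu]_(u in `[(r / 2)%R, +oo[) (`|tpow u| / u)%:E)%E.
  apply: (@le_trans _ _ (\int[mu]_(u in `[(t / 2)%R, t]) (t `^ (- N) * u `^ (N - 1))%:E)%E).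
    rewrite -ge0_integralZl_EFin ?powR_ge0//; last 2 first.
    - by apply: measurable_funTS; exact: measurable_powR.
    - by move=> u _; exact: powR_ge0.
    rewrite int_pow ?gt_eqF// -EFinM lee_fin powRM ?invr_ge0 ?(ltW t0)//.
    have -> : (2^-1 : R) `^ N = 2 `^ (- N).
      by rewrite -powR_inv1// -powRrM mulN1r.
    have tN : t `^ N != 0 by rewrite gt_eqF ?powR_gt0.
    rewrite (powRN t); apply: le_of_eq.
    by field; rewrite tN gt_eqF.
  apply: (@le_trans _ _ (\int[mu]_(u in `[(t / 2)%R, t]) (`|tpow u| / u)%:E)%E).
    apply: le_int_ge0 => u /=; rewrite in_itv/= => /andP[tu ut].
      by rewrite lee_fin mulr_ge0 ?powR_ge0.
    have u0 := lt_le_trans t20 tu.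
    rewrite lee_fin ger0_norm ?tpow_ge0// /tpow ut powRM ?invr_ge0 ?(ltW u0) ?(ltW t0)//.
    rewrite -powR_inv1 ?(ltW t0)// -powRrM mulN1r.
    rewrite powRB1//.
    by apply: le_of_eq; ring.
  have sub : `[(r / 2)%R, +oo[%classic `<=` Rp.
    by move=> u /=; rewrite !in_itv/= !andbT; apply: lt_le_trans; rewrite divr_gt0.
  apply: ge0_subset_integral => //.
  - apply: measurable_funS sub _ => //; apply/measurable_EFinP; apply: measurable_funM.
      apply: measurable_abs; apply: measurable_funTS; apply: measurable_fun_ifT => //.
        exact: measurable_fun_ler.
      by apply: (measurableT_comp (measurable_powR N)); exact: measurable_funM.
    exact: measurable_inv_Rp.
  - by move=> u /sub; rewrite /= in_itv/= andbT => u0; rewrite lee_fin divr_ge0// ltW.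
  - move=> u /=; rewrite !in_itv/= andbT => /andP[tu _].
    by apply: le_trans tu; rewrite ler_pM2r ?invr_gt0.
apply: le_trans (lee_wpmul2l _ h); last by rewrite lee_fin ltW// tpow_GM_gt0.
by rewrite -EFinM lee_fin /tpow_GM; apply: le_of_eq; field; rewrite !gt_eqF.
Qed.

Lemma measurable_tpow : measurable_fun setT tpow.
Proof.
apply: measurable_fun_ifT => //; first exact: measurable_fun_ler.
by apply: (measurableT_comp (measurable_powR N)); exact: measurable_funM.
Qed.

Lemma tpow_near_origin (d : R) : 0 < d ->
  (\int[mu]_(r in `]0%R, 1%R]) (r `^ (d - 1) * `|tpow r|)%:E < +oo)%E.
Proof.
move=> d0; apply: (@le_lt_trans _ _ (\int[mu]_(r in `]0%R, 1%R]) (r `^ (d - 1))%:E)%E).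
  apply: le_int_ge0 => r /=; rewrite in_itv/= => /andP[r0 _].
    by rewrite lee_fin mulr_ge0 ?powR_ge0.
  by rewrite lee_fin ler_piMr ?powR_ge0// ger0_norm ?tpow_ge0 ?tpow_le1.
by rewrite int_pow0// ltry.
Qed.

(** Nothing varies beyond [1] if [t < 1]. *)
Lemma tpow_variation (k : R) : 0 <= k -> t < 1 ->
  (variation_integral (fun r => (r `^ k)%R) tpow 1 < +oo)%E.
Proof.
move=> k0 t1; have [l [-> _ _ lC]] := variation_integral_powRP tpow_bv k0.
apply: (@le_lt_trans _ _ 0%:E); last exact: ltry.
apply: lC => b b1; rewrite (tv_gt t1 (ltW b1)) mulr0 sub0r oppr_le0.
apply: Rintegral_ge0 => r /=; rewrite in_itv/= => /andP[r1 _].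
by rewrite !mulr_ge0 ?powR_ge0 ?tv_ge0.
Qed.

Lemma hnorm_tpow (p b : R) : 0 < p -> 0 < b + N ->
  hnorm p b (fun r => `|tpow r|%:E) = (t `^ (b * p) / ((b + N) * p))%:E.
Proof.
move=> p0 bN; have s0 : 0 < (b + N) * p by rewrite mulr_gt0.
rewrite /hnorm (_ : (\int[mu]_(r in Rp) _)%E = (\int[mu]_(r in Rp) (if (r <= t)%R then
    (t `^ (- (N * p)) * r `^ ((b + N) * p - 1))%:E else 0))%E); last first.
  apply: eq_integral => r; rewrite inE/= in_itv/= andbT => r0.
  rewrite ger0_norm ?tpow_ge0// /tpow; case: ifPn => rt; last first.
    by rewrite mulr0 powR0 ?gt_eqF// mul0e.
  rewrite -EFinM; congr EFin.
  rewrite (@powRM _ r) ?invr_ge0 ?(ltW r0) ?(ltW t0)// !powRM ?mulr_ge0 ?powR_ge0//.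
  rewrite -!powRrM powRB1//.
  rewrite (mulrDl b) powRDp//.
  by rewrite -(powR_inv1 (ltW t0)) -powRrM mulN1r; ring.
rewrite -integral_setI_if (_ : Rp `&` _ = `]0%R, t]%classic); last first.
  apply/seteqP; split => r /=; rewrite !in_itv/= andbT; first by case=> -> ->.
  by move=> /andP[-> ->].
rewrite -ge0_integralZl_EFin ?powR_ge0//; last 2 first.
- by apply: measurable_funTS; exact: measurable_powR.
- by move=> r _; exact: powR_ge0.
rewrite int_pow0// -EFinM mulrA -powRDp//.
congr (_ `^ _ / _)%:E; ring.
Qed.

End TestFunction.

(** * Transforms of truncated powers *)

Section Necessity.
Context {R : realType}.
Notation mu := (@lebesgue_measure R).
Notation Rp := (`](0 : R), +oo[%classic).

Variables (a lam : R).
Hypothesis a0 : 0 < a.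
Hypothesis hlam : 0 <= 4 * lam + a.
Notation kap := (kap a lam).
Notation dim := (dim a lam).
Notation hX := (hX a lam).
Let d0 : 0 < dim. Proof. exact: dim_gt0. Qed.

Lemma variation_majorant (f : R -> R) :
  (forall eps b : R, 0 < eps -> bounded_variation eps b f) ->
  f u @[u --> +oo] --> (0 : R) ->
  (variation_integral (fun r => (r `^ kap)%R) f 1 < +oo)%E ->
  exists V T : R -> R, [/\
    forall r s, 0 < r -> r <= s -> `|f s - f r| <= V r - V s,
    forall r, 0 < r -> `|f r| <= V r,
    forall r, 0 < r -> ((V r)%:E <= variation_integral (fun=> 1%R) f r)%E,
    T r @[r --> +oo] --> (0 : R) &
    forall x y, 1 <= x -> x <= y ->
      x `^ kap * V x + \int[mu]_(r in `[x, y]) (kap * r `^ (kap - 1) * V r) <= T x].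
Proof.
move=> bv f0 fin; have [V [T [VE fV Vvi T0 VT]]] := variation_tail bv f0 (kap_ge0 hlam) fin.
exists V, T; split => // r s r0 rs.
by rewrite (VE r s r0 rs) addrK tv_ge.
Qed.

(** Profile of the transform of a truncated power: by homogeneity the
    truncation point only dilates and scales it, see [hankel_tpow]. *)
Definition hG (m : nat) (y : R) : R := y `^ (- (a * m%:R + dim)) * hX m y.

Lemma measurable_hG m : measurable_fun Rp (hG m).
Proof.
apply: measurable_funM; first exact: measurable_powR_Rp.
apply: open_continuous_measurable_fun => // x; rewrite inE/= in_itv/= andbT.
exact: hX_cont.
Qed.

Lemma hankel_tpow (m : nat) (t rho : R) : (0 < m)%N -> 0 < t -> t < 1 -> 0 < rho ->
  hankel lam a (tpow (a * m%:R) t) rho = nu_const lam a * (t `^ dim * hG m (t * rho)).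
Proof.
move=> m0 t0 t1 rho0; set N := a * m%:R; pose f := tpow N t.
have N0 : 0 < N by rewrite mulr_gt0// ltr0n.
have vik := tpow_variation N0 t0 (kap_ge0 hlam) t1.
have [V [T [VD fV _ T0 VT]]] := variation_majorant (tpow_bv N0 t0) (tpow_cvg0 N t) vik.
have [l -> [lc _]] := hankel_cvg a0 hlam VD fV T0 VT (tpow_near_origin N0 t0 d0) rho0.
congr (_ * _); apply: (cvg_unique _ lc) => //.
pose c := t `^ (- N) * rho `^ (- (N + dim)).
have hE (u w : R) : 0 < u -> u <= t -> t <= w ->
    hint a lam f rho u w = c * (hX m (rho * t) - hX m (rho * u)).
  move=> u0 ut tw; pose k r := t `^ (- N) * (r `^ (N + dim - 1) * hK a lam (rho * r)).
  have -> : hint a lam f rho u w = \int[mu]_(r in `[u, t]) k r.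
    rewrite /hint /Rintegral; congr fine.
    have -> : `[u, t]%classic = `[u, w]%classic `&` [set r | r <= t].
      apply/seteqP; split => r /=; rewrite !in_itv/=.
        by move=> /andP[ur rt]; rewrite ur rt (le_trans rt).
      by case => /andP[-> _] ->.
    rewrite integral_setI_if; apply: eq_integral => r; rewrite inE/= in_itv/= => /andP[ur _].
    have r0 := lt_le_trans u0 ur.
    rewrite /f /tpow; case: ifP => _; last by rewrite mul0r.
    congr EFin; rewrite /k /hker powRM ?invr_ge0 ?(ltW r0) ?(ltW t0)//.
    rewrite -(powR_inv1 (ltW t0)) -powRrM mulN1r (_ : N + dim - 1 = N + (dim - 1)); last by ring.
    rewrite (@powRD _ r N) ?(gt_eqF r0) ?implybT//.
    by ring.
  rewrite mulrBr; apply: (@Rintegral_ftc _ (fun r => c * hX m (rho * r)) k _ _ ut).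
    move=> r /andP[ur _]; have r0 := lt_le_trans u0 ur.
    have rr : 0 < rho * r by rewrite mulr_gt0.
    have h1 := is_derive_hX a0 hlam m rr.
    have h2 : is_derive r 1 (hX m \o ( *%R rho)) ((rho * r) `^ (a * m%:R + dim - 1) * hK a lam (rho * r) * rho).
      apply: is_derive1_comp; apply: is_derive_eq; rewrite /GRing.scale/=.
      by rewrite mulr1.
    apply: is_derive_eq; rewrite /GRing.scale/= -/N /k /c powRM ?(ltW rho0) ?(ltW r0)//.
    transitivity (t `^ (- N) * (r `^ (N + dim - 1) * hK a lam (rho * r)) *
        (rho `^ (- (N + dim)) * rho `^ (N + dim - 1) * rho `^ 1)).
      by rewrite (powRr1 (ltW rho0)); ring.
    rewrite -!powRDp//.
    by rewrite (_ : - (N + dim) + (N + dim - 1) + 1 = 0) ?powRr0 ?mulr1//; ring.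
  move=> r /andP[ur _]; have r0 := lt_le_trans u0 ur.
  have rr : 0 < rho * r by rewrite mulr_gt0.
  apply: continuousM; first exact: cvg_cst.
  apply: continuousM; first exact: powR_cont.
  have h := is_derive_hK a0 hlam rr.
  have : is_derive r 1 (hK a lam \o ( *%R rho)) (sp a (rho * r) * hL a lam (rho * r) * rho).
    apply: is_derive1_comp; apply: is_derive_eq; rewrite /GRing.scale/=.
    by rewrite mulr1.
  exact: is_derive_cont.
have tr0 : 0 < t * rho by rewrite mulr_gt0.
have -> : t `^ dim * hG m (t * rho) = c * (hX m (rho * t) - 0).
  rewrite subr0 /hG (mulrC rho) -/N /c powRM ?(ltW t0) ?(ltW rho0)//.
  transitivity (t `^ dim * t `^ (- (N + dim)) * rho `^ (- (N + dim)) * hX m (t * rho)); first by ring.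
  by rewrite -powRDp// (_ : dim - (N + dim) = - N)//; ring.
have cX : (c * (hX m (rho * t) - hX m (rho * n.+1%:R^-1))) @[n --> \oo] --> c * (hX m (rho * t) - 0).
  apply: cvgM; first exact: cvg_cst.
  apply: cvgB; first exact: cvg_cst.
  apply: (cvg_comp (fun n : nat => rho * n.+1%:R^-1) (hX m) _ (hX_cvg0 a0 hlam m)).
  move=> P [e /= e0 HP]; have H : \forall x \near (0 : R)^'+, P (rho * x).
    near=> x; have x0 : 0 < x by near: x; exact: nbhs_right_gt.
    apply: HP; last by rewrite mulr_gt0.
    rewrite /= sub0r normrN gtr0_norm ?mulr_gt0// mulrC -ltr_pdivlMr//.
    by near: x; apply: nbhs_right_lt; rewrite divr_gt0.
  exact: (harmonic_at_right H).
apply: cvg_trans cX; apply: near_eq_cvg; near=> n.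
rewrite hE ?invr_gt0 ?ltr0n//.
  near: n; have H : \forall x \near (0 : R)^'+, x <= t by exact: nbhs_right_le.
  exact: (harmonic_at_right H).
by rewrite (le_trans (ltW t1))// ler1n.
Unshelve. all: by end_near. Qed.

Lemma hnorm_hankel_tpow (m : nat) (t p b : R) : (0 < m)%N -> 0 < t -> t < 1 -> 0 < p ->
  hnorm p b (fun rho => `|hankel lam a (tpow (a * m%:R) t) rho|%:E) =
  ((nu_const lam a `^ p * t `^ ((dim - b) * p))%:E * hnorm p b (fun y => `|hG m y|%:E))%E.
Proof.
move=> m0 t0 t1 p0; have nc0 := nu_const_gt0 a0 hlam.
pose h (y : R) : \bar R := (((y `^ b)%:E * `|hG m y|%:E) `^ p * (y^-1)%:E)%E.
have mh : measurable_fun Rp h.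
  apply: emeasurable_funM; last by apply/measurable_EFinP; exact: measurable_inv_Rp.
  apply: (measurableT_comp (measurable_poweR p)); apply: emeasurable_funM.
    by apply/measurable_EFinP; exact: measurable_powR_Rp.
  by apply/measurable_EFinP; apply: measurable_abs; exact: measurable_hG.
have h0 y : 0 < y -> (0 <= h y)%E.
  by move=> y0; rewrite mule_ge0 ?poweR_ge0// lee_fin invr_ge0 ltW.
have mht : measurable_fun Rp (fun y => h (t * y)).
  apply: (measurable_comp (F := Rp)) mh _ => //.
  by move=> y [z /=]; rewrite !in_itv/= !andbT => z0 <-; rewrite mulr_gt0.
pose C := nu_const lam a `^ p * t `^ ((dim - b) * p) * t.
have C0 : 0 <= C by rewrite !mulr_ge0 ?powR_ge0 ?ltW.
have ht0 (y : R) : Rp y -> (0 <= h (t * y)%R)%E.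
  by rewrite /= in_itv/= andbT => y0; rewrite h0// mulr_gt0.
transitivity (C%:E * \int[mu]_(y in Rp) h (t * y)%R)%E.
  have := @ge0_integralZl _ _ _ mu Rp (measurable_itv _) _ mht C%:E ht0.
  rewrite lee_fin => /(_ C0) <-.
  rewrite /hnorm; apply: eq_integral => y; rewrite inE/= in_itv/= andbT => y0.
  rewrite hankel_tpow// /h /C -!EFinM ?poweR_EFin -?EFinM; congr EFin.
  rewrite (normrM (nu_const lam a)) (normrM (t `^ dim)) (ger0_norm (ltW nc0)).
  rewrite (ger0_norm (powR_ge0 t dim)).
  move: `|hG m (t * y)| (normr_ge0 (hG m (t * y))) => g g0.
  rewrite (@powRM _ t y b) ?(ltW t0) ?(ltW y0)//.
  rewrite !powRM ?mulr_ge0 ?powR_ge0 ?(ltW nc0)// -!powRrM.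
  rewrite (mulrBl p) powRBp//.
  have tb : t `^ (b * p) != 0 by rewrite gt_eqF ?powR_gt0.
  by field; rewrite tb !gt_eqF.
rewrite (int_scale t0 mh h0) muleA -EFinM; congr (_%:E * _)%E.
by rewrite /C mulfK// gt_eqF.
Qed.

(** [hG] is bounded below by a positive constant near the origin, where
    [dy / y] has infinite mass. *)
Lemma hnorm_hG_near0 (m : nat) (p b : R) : 0 < p ->
  (hnorm p b (fun y => `|hG m y|%:E) < +oo)%E -> 0 < b.
Proof.
move=> p0 fin; rewrite ltNge; apply/negP => b0.
have [e e0 He] := hX_ge_near0 a0 hlam m.
set s := a * m%:R + dim in He; have s0 : 0 < s by rewrite ltr_wpDl// mulr_ge0// ltW.
pose c := (2 * s)^-1; have c0 : 0 < c by rewrite invr_gt0 mulr_gt0.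
have gc (y : R) : 0 < y -> y <= e -> c <= `|hG m y|.
  move=> y0 ye; apply: le_trans (ler_norm _); rewrite /hG -/s.
  apply: le_trans (ler_wpM2l (powR_ge0 _ _) (He y y0 ye)).
  by rewrite mulrA -powRDp// addNr powRr0 mul1r.
move: fin; rewrite ltNge => /negP; apply.
have bp : b * p <= 0 by rewrite mulr_le0_ge0// ltW.
have cp : 0 < c `^ p by rewrite powR_gt0.
have <- : ((c `^ p)%:E * \int[mu]_(y in `]0%R, e]) (y `^ (b * p - 1))%:E = +oo)%E.
  by rewrite int_pow0_div// gt0_muley// lte_fin.
have sub : `]0%R, e]%classic `<=` Rp by move=> y; rewrite /= !in_itv/= andbT => /andP[].
rewrite ge0_integralZl_EFin ?powR_ge0//; last 2 first.
- by apply: measurable_funTS; exact: measurable_powR.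
- by move=> y _; exact: powR_ge0.
apply: (@le_trans _ _ (\int[mu]_(y in `]0%R, e]) (((y `^ b)%:E * `|hG m y|%:E) `^ p * (y^-1)%:E))%E).
  apply: le_int_ge0 => y /=; rewrite in_itv/= => /andP[y0 ye].
    by rewrite lee_fin mulr_ge0 ?powR_ge0.
  rewrite -EFinM lee_fin powRM ?powR_ge0// -powRrM.
  rewrite powRB1// mulrA.
  rewrite ler_pM2r ?invr_gt0// mulrC ler_wpM2l ?powR_ge0//.
  by rewrite ge0_ler_powR ?nnegrE ?(ltW p0) ?(ltW c0)// gc.
apply: ge0_subset_integral => //.
- apply: emeasurable_funM; last by apply/measurable_EFinP; exact: measurable_inv_Rp.
  apply: (measurableT_comp (measurable_poweR p)); apply: emeasurable_funM.
    by apply/measurable_EFinP; exact: measurable_powR_Rp.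
  by apply/measurable_EFinP; apply: measurable_abs; exact: measurable_hG.
- move=> y; rewrite /= in_itv/= andbT => y0.
  by rewrite -EFinM lee_fin mulr_ge0 ?powR_ge0// invr_ge0 ltW.
Qed.

(** At [b = dim - kap] the integrand is the one of [hW_diverges], and it grows
    with [b]. *)
Lemma hnorm_hG_neary (m : nat) (p b : R) : 1 < p ->
  (hnorm p b (fun y => `|hG m y|%:E) < +oo)%E -> b < dim - kap.
Proof.
move=> p1 fin; rewrite ltNge; apply/negP => bd; have p0 : 0 < p by lra.
have [x0 x1 div] := hW_diverges a0 hlam m p1.
move: fin; rewrite ltNge => /negP; apply; rewrite -div.
have sub : `[x0, +oo[%classic `<=` Rp.
  by move=> x; rewrite /= !in_itv/= !andbT; apply: lt_le_trans; exact: lt_le_trans x1.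
apply: (@le_trans _ _ (\int[mu]_(y in `[x0, +oo[) (((y `^ b)%:E * `|hG m y|%:E) `^ p * (y^-1)%:E))%E).
  apply: le_int_ge0 => y yx; have := sub _ yx; rewrite /= in_itv/= andbT => y0.
    by rewrite lee_fin divr_ge0 ?powR_ge0 ?ltW.
  have y1 : 1 <= y by move: yx; rewrite /= in_itv/= andbT; exact: le_trans.
  rewrite -EFinM lee_fin ler_pM2r ?invr_gt0//.
  rewrite ge0_ler_powR ?nnegrE ?(ltW p0) ?mulr_ge0 ?powR_ge0//.
  rewrite /hW /hG (normrM (y `^ _)) (ger0_norm (powR_ge0 _ _)).
  rewrite (normrM (y `^ _)) (ger0_norm (powR_ge0 _ _)).
  rewrite mulrA ler_wpM2r// -powRDp//.
  by rewrite ler_powR//; move: dim kap (a * m%:R) bd => D k z; lra.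
apply: ge0_subset_integral => //.
- apply: emeasurable_funM; last by apply/measurable_EFinP; exact: measurable_inv_Rp.
  apply: (measurableT_comp (measurable_poweR p)); apply: emeasurable_funM.
    by apply/measurable_EFinP; exact: measurable_powR_Rp.
  by apply/measurable_EFinP; apply: measurable_abs; exact: measurable_hG.
- move=> y; rewrite /= in_itv/= andbT => y0.
  by rewrite -EFinM lee_fin mulr_ge0 ?powR_ge0// invr_ge0 ltW.
Qed.

End Necessity.

(** * The equivalence *)

Section Roots.
Context {R : realType}.
Implicit Types (A B : \bar R) (n c p : R).

Lemma le_root n c p A B : 0 < n -> 0 < c -> 1 < p -> (0 <= A)%E -> (0 <= B)%E ->
  ((n%:E * A) `^ p^-1 <= c%:E * (n%:E * B) `^ p^-1)%E <-> (A <= (c `^ p)%:E * B)%E.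
Proof.
move=> n0 c0 p1 A0 B0; have p0 : 0 < p by lra.
have pV : p^-1 * p = 1 by rewrite mulVf// gt_eqF.
have n0' : (0 < n%:E)%E by rewrite lte_fin.
have nA : (0 <= n%:E * A)%E by rewrite mule_ge0// ltW.
have nB : (0 <= n%:E * B)%E by rewrite mule_ge0// ltW.
have cE : ((c%:E * (n%:E * B) `^ p^-1) = (n%:E * ((c `^ p)%:E * B)) `^ p^-1)%E.
  rewrite muleCA (@poweRM _ (c `^ p)%:E) ?lee_fin ?powR_ge0//.
  by rewrite poweR_EFin -powRrM divff ?gt_eqF// powRr1// ltW.
have nc : (0 <= n%:E * ((c `^ p)%:E * B))%E.
  by rewrite !mule_ge0 ?lee_fin ?powR_ge0// ltW.
rewrite cE; split => [h|h].
  have := poweR_le (ltW p0) (poweR_ge0 _ _) h.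
  by rewrite -!poweRrM pV !poweRe1// lee_pmul2l// lte_fin.
by apply: poweR_le => //; rewrite ?invr_ge0 ?(ltW p0)// lee_pmul2l.
Qed.

Lemma powR_bounded (th B : R) : (forall t, 0 < t -> t < 1 -> t `^ th <= B) -> 0 <= th.
Proof.
move=> H; rewrite leNgt; apply/negP => th0.
pose M := Num.max B 1 + 1.
have M1 : 1 < M by rewrite ltr_pwDr// le_max lexx orbT.
have M0 : 0 < M := lt_trans ltr01 M1.
have t0 : 0 < M `^ th^-1 by rewrite powR_gt0.
have t1 : M `^ th^-1 < 1.
  have s0 : 0 < - th^-1 by rewrite oppr_gt0 invr_lt0.
  rewrite -[th^-1]opprK powRN invf_lt1 ?powR_gt0//.
  have := @gt0_ltr_powR R _ s0 1 M; rewrite powR1; apply => //.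
  - by rewrite nnegrE.
  - by rewrite nnegrE ltW.
have := H _ t0 t1; rewrite -powRrM mulVf ?lt_eqF// powRr1 ?(ltW M0)//.
by apply/negP; rewrite -ltNge ltr_pwDr// le_max lexx.
Qed.

Lemma hoelder_conjugate_fin p : 1 < p ->
  1 / fine (hoelder_conjugate p%:E) = 1 - p^-1.
Proof.
move=> p1; have p0 : p != 0 by rewrite gt_eqF//; lra.
have p10 : p - 1 != 0 by rewrite gt_eqF// subr_gt0.
have -> : hoelder_conjugate p%:E = (p / (p - 1))%:E.
  apply/esym/hoelder_conjugateP => //; first by rewrite ltNyr.
  rewrite !inver (negbTE p0) mulf_eq0 invr_eq0 (negbTE p0) (negbTE p10)/=.
  rewrite -EFinD; congr EFin; field; by rewrite p0 p10.
by rewrite /=; field; rewrite p0 p10.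
Qed.

End Roots.

Theorem corollary3p3 (R : realType) (a lam p beta gamma : R)
  (ha : 0 < a) (hlam : 0 <= 4 * lam + a) (hp : 1 < p) :
  let p' := fine (hoelder_conjugate p%:E) in
  (forall C c0 : R, 0 < C -> 1 < c0 ->
     exists c1 c2 : R, [/\ 0 < c1, c1 <= c2 &
       forall f : R -> R,
         GM_with C c0 f ->
         (forall r : R, 0 < r -> 0 <= f r) ->
         (\int[lebesgue_measure]_(r in `]0%R, 1%R])
            (r `^ (2 * lam + a - 1) * `|f r|)%:E
          + variation_integral (fun r => r `^ (lam + a / 4))%R f 1 < +oo)%E ->
         (c1%:E * nu_norm lam a p (fun r => r `^ beta * f r)%R
            <= nu_norm lam a p (fun rho => rho `^ (- gamma) * hankel lam a f rho)%R)%E /\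
         (nu_norm lam a p (fun rho => rho `^ (- gamma) * hankel lam a f rho)%R
            <= c2%:E * nu_norm lam a p (fun r => r `^ beta * f r)%R)%E])
  <->
  beta - gamma = (2 * lam + a) * (1 / p' - 1 / p) /\
  (2 * lam + a) / p' - (4 * lam + 3 * a) / 4 < beta /\
  beta < (2 * lam + a) / p'.
Proof.
move=> p'; have p0 : 0 < p by lra.
have p'E : 1 / p' = 1 - p^-1 by exact: hoelder_conjugate_fin.
pose d := dim a lam; pose k := kap a lam.
(* the exponents of the two norms with respect to dr / r *)
pose b' := beta + d / p; pose b := - gamma + d / p.
have -> : (2 * lam + a) / p' = d - d / p.
  by rewrite -[p'^-1]mul1r p'E /d /dim; field; rewrite gt_eqF.
rewrite p'E.
have nc0 := nu_const_gt0 ha hlam.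
have d0 : 0 < d := dim_gt0 ha hlam.
have dE : d = 2 * k + a / 2 := dimE a lam.
have kE : (4 * lam + 3 * a) / 4 = d - k by rewrite /d /k /dim /kap; field.
have -> : (beta - gamma = (2 * lam + a) * (1 - p^-1 - 1 / p)) <-> (b = d - b').
  have -> : (2 * lam + a) * (1 - p^-1 - 1 / p) = d - 2 * (d / p).
    by rewrite /d /dim; field; rewrite gt_eqF.
  by rewrite /b /b'; split; move: (d / p) => z; lra.
rewrite kE.
split.
  move=> H.
  (* large enough for the norm of the test function at b' to be finite *)
  pose m := (Num.truncn (`|b'| / a)).+1.
  pose N := a * m%:R.
  have N0 : 0 < N by rewrite mulr_gt0// ltr0n.
  have bN : 0 < b' + N.
    have := Num.Theory.truncnS_gt (`|b'| / a); rewrite ltr_pdivrMr// -/m (mulrC m%:R) -/N => h.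
    by have := ler_norm (- b'); rewrite normrN; move: h; move: `|b'| => z; lra.
  have [c1 [c2 [c10 c12 Hf]]] := H (tpow_GM N) 2 (tpow_GM_gt0 N0) ltac:(by rewrite ltr1n).
  have c20 : 0 < c2 := lt_le_trans c10 c12.
  pose Y := hnorm p b (fun y => `|hG a lam m y|%:E).
  have Y0 : (0 <= Y)%E by exact: hnorm_ge0.
  pose K := ((b' + N) * p)^-1; have K0 : 0 < K by rewrite invr_gt0 mulr_gt0.
  have key t : 0 < t -> t < 1 ->
    ((t `^ (b' * p) * K)%:E <= (c1^-1 `^ p)%:E *
        ((nu_const lam a `^ p * t `^ ((d - b) * p))%:E * Y))%E /\
    ((nu_const lam a `^ p * t `^ ((d - b) * p))%:E * Y <=
       (c2 `^ p)%:E * (t `^ (b' * p) * K)%:E)%E.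
    move=> t0 t1; pose f := tpow N t.
    have vik := tpow_variation N0 t0 (kap_ge0 hlam) t1.
    have f01 := tpow_near_origin N0 t0 d0.
    have [V [T [VD fV _ T0 VT]]] := variation_majorant hlam (tpow_bv N0 t0) (tpow_cvg0 N t) vik.
    have mf : measurable_fun `](0 : R), +oo[ f by apply: measurable_funTS; exact: measurable_tpow.
    have mF := measurable_hankel ha hlam VD fV T0 VT f01.
    have [] := Hf f (tpow_GM_with N0 t0) (fun r _ => tpow_ge0 N t r) _.
      by apply: lte_add_pinfty.
    rewrite (nu_normE ha hlam beta p0 mf) (nu_normE ha hlam (- gamma) p0 mF) -/b -/b'.
    rewrite (hnorm_hankel_tpow ha hlam b _ t0 t1 p0)// (hnorm_tpow t0 p0 bN) -/Y -/K.
    have A0 : (0 <= (t `^ (b' * p) / ((b' + N) * p))%:E)%E.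
      by rewrite lee_fin mulr_ge0 ?powR_ge0 ?(ltW K0).
    have B0 : (0 <= (nu_const lam a `^ p * t `^ ((d - b) * p))%:E * Y)%E.
      by rewrite mule_ge0// lee_fin mulr_ge0 ?powR_ge0.
    have ci0 : 0 < c1^-1 by rewrite invr_gt0.
    rewrite -[in X in (X <= _)%E -> _](invrK c1) lee_pdivrMl//.
    by move=> /(le_root nc0 ci0 hp A0 B0).1 h1 /(le_root nc0 c20 hp B0 A0).1 h2.
  pose n := nu_const lam a `^ p; have n0 : 0 < n by rewrite powR_gt0.
  have h0 : (0 : R) < 2^-1 by rewrite invr_gt0.
  have h1 : (2^-1 : R) < 1 by rewrite invf_lt1// ltr1n.
  have Yfin : (Y < +oo)%E.
    rewrite ltey; apply/eqP => Yy; have [_] := key _ h0 h1.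
    by rewrite Yy gt0_muley ?lte_fin ?mulr_gt0 ?powR_gt0// -EFinM leye_eq.
  have bd := hnorm_hG_neary ha hlam hp Yfin.
  have bpos := hnorm_hG_near0 ha hlam p0 Yfin.
  have [y yE] : exists y : R, Y = y%:E by exists (fine Y); rewrite fineK// ge0_fin_numE.
  have y0 : 0 <= y by rewrite -lee_fin -yE.
  pose c := c1^-1 `^ p; have c0 : 0 < c by rewrite powR_gt0// invr_gt0.
  pose c' := c2 `^ p; have c'0 : 0 < c' by rewrite powR_gt0.
  have lo t : 0 < t -> t < 1 -> t `^ (b' * p) * K <= c * (n * t `^ ((d - b) * p) * y).
    by move=> t0 t1; have [+ _] := key t t0 t1; rewrite yE -!EFinM lee_fin.
  have up t : 0 < t -> t < 1 -> n * t `^ ((d - b) * p) * y <= c' * (t `^ (b' * p) * K).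
    by move=> t0 t1; have [_] := key t t0 t1; rewrite yE -!EFinM lee_fin.
  have yp : 0 < y.
    rewrite lt_neqAle y0 andbT eq_sym; apply/eqP => yz; have := lo _ h0 h1.
    by rewrite yz !mulr0 leNgt mulr_gt0// powR_gt0.
  (* homogeneity: as t tends to 0, each of the two bounds compares the
     exponents of t *)
  have e1 : 0 <= b' * p - (d - b) * p.
    apply: (@powR_bounded _ _ (c * n * y / K)) => t t0 t1.
    have tp : 0 < t `^ ((d - b) * p) by rewrite powR_gt0.
    rewrite powRBp// ler_pdivlMr// mulrAC ler_pdivrMr//.
    by apply: le_trans (lo t t0 t1) _; apply: le_of_eq; ring.
  have e2 : 0 <= (d - b) * p - b' * p.
    apply: (@powR_bounded _ _ (c' * K / (n * y))) => t t0 t1.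
    have tp : 0 < t `^ (b' * p) by rewrite powR_gt0.
    rewrite powRBp// ler_pdivlMr ?mulr_gt0// mulrAC ler_pdivrMr//.
    apply: (@le_trans _ _ (n * t `^ ((d - b) * p) * y)); last first.
      by apply: le_trans (up t t0 t1) _; apply: le_of_eq; ring.
    by apply: le_of_eq; ring.
  have bE : b = d - b'.
    have : (b' - (d - b)) * p = 0.
      by apply/eqP; rewrite eq_le mulrBl e1 andbT -oppr_ge0 opprB.
    by move=> /eqP; rewrite mulf_eq0 (gt_eqF p0) orbF subr_eq0 => /eqP ->; ring.
  split=> //; move: bE bd bpos; rewrite -/d -/k /b' /b.
  by move: (d / p) => z *; split; lra.
move=> [bE [bl bu]] C c0 C0 c01.
have b'0 : 0 < b' by move: bl dE ha; rewrite /b'; move: (kap_ge0 hlam) => k0; rewrite -/k in k0; move: (d / p) => z; lra.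
have b0 : 0 < b by rewrite bE; move: bu; rewrite /b'; move: (d / p) => z; lra.
have bd : b < d - k by rewrite bE; move: bl; rewrite /b'; move: (d / p) => z; lra.
have dbE : d - b = b' by rewrite bE; ring.
pose U := upper_const ha hlam * (b^-1 + (d - k - b)^-1) * C * (c0 `^ (d - b) / (d - b)).
pose L := c0 `^ b' / b' * (C * d / gauss a 1) * fine (gauss_moment a b').
have c00 : 0 < c0 by lra.
have U0 : 0 < U.
  have ib : 0 < b^-1 + (d - k - b)^-1 by rewrite addr_gt0 ?invr_gt0// subr_gt0.
  have cb : 0 < c0 `^ (d - b) / (d - b) by rewrite dbE divr_gt0 ?powR_gt0.
  exact: mulr_gt0 (mulr_gt0 (mulr_gt0 (upper_const_gt0 ha hlam) ib) C0) cb.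
have L0 : 0 < L.
  have cb : 0 < c0 `^ b' / b' by rewrite divr_gt0 ?powR_gt0.
  have cd : 0 < C * d / gauss a 1 by rewrite divr_gt0 ?mulr_gt0 ?gauss_gt0.
  have gm : 0 < fine (gauss_moment a b').
    by rewrite fine_gt0// gauss_moment_gt0// gauss_moment_lty.
  exact: mulr_gt0 (mulr_gt0 cb cd) gm.
have Li : 0 < L^-1 by rewrite invr_gt0.
exists L^-1, (Num.max L^-1 U); split => //; first by rewrite le_max lexx.
move=> f [_ _ bv f0 gm] fge fin.
have [f01 vik] : (\int[lebesgue_measure]_(r in `]0%R, 1%R])
    (r `^ (d - 1) * `|f r|)%:E < +oo)%E /\
    (variation_integral (fun r => (r `^ k)%R) f 1 < +oo)%E.
  have [l [lE _ lI _]] := variation_integral_powRP bv (kap_ge0 hlam).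
  have I0 : (0 <= \int[lebesgue_measure]_(r in `]0%R, 1%R]) (r `^ (d - 1) * `|f r|)%:E)%E.
    by apply: integral_ge0 => r _; rewrite lee_fin mulr_ge0 ?powR_ge0.
  have lNy : (-oo < l)%E by apply: lt_le_trans (lI 1 (lexx _)); rewrite ltNyr.
  move: fin; rewrite -/(dim a lam) -/(kap a lam) -/d -/k lE.
  case: (integral _ _ _) I0 => [x||]//; case: l lNy {lE lI} => [l||]//.
  by rewrite !ltry.
have [V [T [VD fV Vvi T0 VT]]] := variation_majorant hlam bv f0 vik.
have VG r : 0 < r -> ((V r)%:E <= C%:E * \int[lebesgue_measure]_(u in `[(r / c0)%R, +oo[) (`|f u| / u)%:E)%E.
  by move=> r0; apply: le_trans (Vvi r r0) (gm r r0).
have mf := measurable_f VD.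
have mF := measurable_hankel ha hlam VD fV T0 VT f01.
have ub := upper_bound ha hlam VD fV T0 VT f01 hp b0 bd C0 c01 VG.
have lb := lower_bound ha hlam VD fV T0 VT f01 fge f0 hp b'0 C0 c01 VG.
have dbE' : dim a lam - b' = b by rewrite -/d bE.
rewrite dbE' in lb; rewrite -/d dbE in ub.
rewrite (nu_normE ha hlam beta p0 mf) (nu_normE ha hlam (- gamma) p0 mF) -/b -/b' -/d.
have A0 := hnorm_ge0 p b' (fun r => `|f r|%:E).
have B0 := hnorm_ge0 p b (fun rho => `|hankel lam a f rho|%:E).
split.
  rewrite lee_pdivrMl//; exact: (le_root nc0 L0 hp A0 B0).2 lb.
apply: le_trans ((le_root nc0 U0 hp B0 A0).2 _) _.
  by rewrite /U dbE; exact: ub.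
by rewrite lee_wpmul2r ?poweR_ge0// lee_fin le_max lexx orbT.
Qed.
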